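(* Suppose $\boldsymbol{\epsilon}_t\in\mathbf{R}^d$, $t=1,\dots,T$, stem from an $(M,\alpha)$-short-range dependent random vector process (defined in the context) with $M>4$, $\alpha>4$, and suppose $d\asymp T$. Let $b_{t_1t_2}$, $t_1,t_2=1,\dots,T$, be real coefficients (allowed to depend on $T$) with $|b_{t_1t_2}|\le 1$ and $b_{t_1t_2}=0$ if $|t_1-t_2|<B$, where the integer $B=B_T>1$ satisfies $T^{2/\alpha}=o(B)$. Let $$Q=\sum_{t_1=1}^T\sum_{t_2=1}^T b_{t_1t_2}\left(\boldsymbol{\epsilon}_{t_1}^\top\boldsymbol{\epsilon}_{t_2}-\mathbf{E}[\boldsymbol{\epsilon}_{t_1}^\top\boldsymbol{\epsilon}_{t_2}]\right).$$ Then $$\|Q\|_{M/2}=O\left(\sqrt{d\sum_{t_1=1}^T\sum_{t_2=1}^T b_{t_1t_2}^2}+\frac{T^{5/2}}{B^\alpha}+\frac{T^{3/2}}{B^{\alpha-2}}\right).$$ In addition, there exists a constant $C>0$ such that for any integer $\ell\ge B$, $$\left\|\sum_{t_1=1}^T\sum_{t_2=1}^T b_{t_1t_2}\left(\boldsymbol{\epsilon}_{t_1}^\top\boldsymbol{\epsilon}_{t_2}-\mathbf{E}\left[\boldsymbol{\epsilon}_{t_1}^\top\boldsymbol{\epsilon}_{t_2}\mid\mathcal{F}_{t_1\vee t_2,\ell}\right]\right)\right\|_{M/2}\le C\sum_{q=1}^\infty\delta_q\sqrt{d\sum_{B\vee(\ell+1-q)\le|t_1-t_2|\le\ell}b_{t_1t_2}^2}+C\sqrt{d\sum_{|t_1-t_2|\ge\ell+1}b_{t_1t_2}^2}+\frac{CdT^{3/2}}{\ell^{\alpha-1}}+\frac{Cd\sqrt{T}}{B^\alpha},$$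 where the inner sums run over $t_1,t_2\in\{1,\dots,T\}$ satisfying the indicated constraints.
   Context: Notation. $\|X\|_m=(\mathbf{E}|X|^m)^{1/m}$ for a random variable $X$; $|\cdot|_2$ is the Euclidean norm; $a\vee b=\max(a,b)$. For sequences, $a_T=O(b_T)$ means $|a_T|\le C|b_T|$ for all $T$ with a constant $C$ not depending on $T$; $a_T\asymp b_T$ means $c\,a_T\le b_T\le C a_T$ for all $T$ with constants $0<c\le C<\infty$; $a_T=o(b_T)$ means $a_T/b_T\to0$. Constants do not depend on $T$ (nor on $d=d_T$) or on $\ell$. Process. $\{e_t:t\in\mathbf{Z}\}$ are independent (not necessarily identically distributed) random variables, and $\boldsymbol{\epsilon}_t=(\boldsymbol{\epsilon}_t^{(1)},\dots,\boldsymbol{\epsilon}_t^{(d)})^\top$, $t\in\mathbf{Z}$, with $\boldsymbol{\epsilon}_t^{(i)}=g_{t,T}^{(i)}(\dots,e_{t-1},e_t)$, where the $g_{t,T}^{(i)}$ are measurable functions that may vary with $t$ and with the sample size $T$ (the dependence of $\boldsymbol{\epsilon}_t$ on $T$ is suppressed). Let $e_t^\dagger$, $t\in\mathbf{Z}$, be mutually independent, independent of all $e_s$, with $e_t^\dagger$ having the same distribution as $e_t$. For $s\ge0$, $\boldsymbol{\epsilon}_t(s)$ has components $\boldsymbol{\epsilon}_t^{(i)}(s)=g_{t,T}^{(i)}(\dots,e_{t-s-1},e_{t-s}^\dagger,e_{t-s+1},\dots,e_t)$; for $s<0$, $\boldsymbol{\epsilon}_t(s)=\boldsymbol{\epsilon}_t$.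 Put $\delta_s=\sup_{t\in\mathbf{Z},|\mathbf{a}|_2=1}\|\mathbf{a}^\top(\boldsymbol{\epsilon}_t-\boldsymbol{\epsilon}_t(s))\|_M$. Definition ($(M,\alpha)$-short-range dependence, $M>1$, $\alpha>1$): $\boldsymbol{\epsilon}_t^{(i)}=g_{t,T}^{(i)}(\dots,e_{t-1},e_t)$ for all $t\in\mathbf{Z}$ and $i=1,\dots,d$, with independent random variables $e_t$ and measurable functions $g_{t,T}^{(i)}$; $\mathbf{E}[\boldsymbol{\epsilon}_t]=0$ for all $t$, $\sup_{t\in\mathbf{Z},|\mathbf{a}|_2=1}\|\mathbf{a}^\top\boldsymbol{\epsilon}_t\|_M=O(1)$, and $\sup_{s=0,1,\dots}(1+s)^\alpha\sum_{j=s}^\infty\delta_j=O(1)$. For $t\in\mathbf{Z}$ and an integer $a\ge0$, $\mathcal{F}_{t,a}$ is the $\sigma$-field generated by $e_t,e_{t-1},\dots,e_{t-a}$. *)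

(* Defs.v *)
From mathcomp Require Export all_boot all_order all_algebra.
From mathcomp Require Export all_classical all_reals all_analysis.

Set Implicit Arguments.
Unset Strict Implicit.
Unset Printing Implicit Defensive.

Import Order.TTheory GRing.Theory Num.Theory.
Import numFieldNormedType.Exports.

Local Open Scope classical_set_scope.
Local Open Scope ring_scope.

(* Sequences are indexed by the sample size T >= 1; the value at T = 0 is
   irrelevant everywhere. *)
Definition bigO_seq (R : realType) (a : nat -> \bar R) (b : nat -> R) : Prop :=
  exists C : R, forall T : nat, (0 < T)%N -> (`|a T| <= (C * `|b T|)%:E)%E.

Definition asymp_seq (R : realType) (a b : nat -> R) : Prop :=
  exists c C : R, [/\ 0 < c, c <= C &
    forall T : nat, (0 < T)%N -> c * a T <= b T <= C * a T].

Definition littleo_seq (R : realType) (a b : nat -> R) : Prop :=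
  (fun T => a T / b T) @ \oo --> (0 : R).

Definition dotv (R : realType) (d : nat) (u v : 'cV[R]_d) : R :=
  (u^T *m v) 0 0.

Definition enorm (R : realType) (d : nat) (u : 'cV[R]_d) : R :=
  Num.sqrt (dotv u u).

(* The subtraction is the one of int, hence not truncated. *)
Definition dist_nat (m n : nat) : nat := `|m%:Z - n%:Z|%N.

(* The real sequences (..., e_{t-1}, e_t) fed to the functions g are indexed by
   the lag: entry k is the value at time t - k.  They form the measurable space
   R^nat with the product sigma-algebra, generated by the coordinates. *)
Definition coordinate_sets (R : realType) : set (set (nat -> R)) :=
  \bigcup_k preimage_set_system setT (fun x : nat -> R => x k) measurable.

Definition path_measurable (R : realType) (f : (nat -> R) -> R) : Prop :=
  measurable_fun setT (f : g_sigma_algebraType (@coordinate_sets R) -> R).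

Section Probability.
Context (R : realType) (disp : measure_display) (Omega : measurableType disp).
Variable P : probability Omega R.

Definition mutually_independent (I : eqType) (X : I -> Omega -> R) : Prop :=
  forall (J : seq I) (A : I -> set R), uniq J ->
    (forall i, measurable (A i)) ->
    P (\bigcap_(i in [set` J]) (X i @^-1` A i)) =
    (\prod_(i <- J) P (X i @^-1` A i))%E.

(* The joint independence of the family indexed by int + int says at once that
   the e_t are independent, that the edag_t are independent, and that the two
   sequences are independent of each other. *)
Definition independent_copy (e edag : int -> {RV P >-> R}) : Prop :=
  mutually_independent
    (fun i : int + int =>
       match i with inl t => e t : Omega -> R | inr t => edag t end) /\
  forall (t : int) (A : set R), measurable A ->
    distribution P (edag t) A = distribution P (e t) A.

Definition Lpnorm (p : R) (X : Omega -> R) : \bar R :=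
  Lnorm P p%:E (EFin \o X).

(* Y is a version of E[X | F]; F is meant to be a sub-sigma-algebra of the
   measurable sets. *)
Definition cond_expectation_version
    (F : set (set Omega)) (X Y : Omega -> R) : Prop :=
  [/\ forall A : set R, measurable A -> F (Y @^-1` A),
      P.-integrable setT (EFin \o Y) &
      forall A : set Omega, F A ->
        (\int[P]_(w in A) (Y w)%:E = \int[P]_(w in A) (X w)%:E)%E].

Section Process.
Variables e edag : int -> {RV P >-> R}.

(* sigma(e_t, e_{t-1}, ..., e_{t-a}) *)
Definition sigma_window (t : int) (a : nat) : set (set Omega) :=
  <<s \bigcup_(k in [set k : nat | (k <= a)%N])
        preimage_set_system setT (e (t - k%:Z)) measurable >>.

Section FixedSampleSize.
Variables (d : nat) (g : int -> 'I_d -> (nat -> R) -> R).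

Definition epsilon (t : int) (w : Omega) : 'cV[R]_d :=
  \col_i g t i (fun k : nat => e (t - k%:Z) w).

(* For s < 0 no lag k matches, so that this is epsilon t w. *)
Definition epsilon_coupled (s t : int) (w : Omega) : 'cV[R]_d :=
  \col_i g t i (fun k : nat =>
    if k%:Z == s then edag (t - k%:Z) w else e (t - k%:Z) w).

Definition unit_directions : set (int * 'cV[R]_d) := [set ta | enorm ta.2 = 1].

Definition moment_sup (M : R) : \bar R :=
  ereal_sup [set Lpnorm M (fun w => dotv ta.2 (epsilon ta.1 w))
            | ta in unit_directions].

Definition delta (M : R) (s : int) : \bar R :=
  ereal_sup [set Lpnorm M
                  (fun w => dotv ta.2 (epsilon ta.1 w - epsilon_coupled s ta.1 w))
            | ta in unit_directions].

Definition delta_tail_sup (M alpha : R) : \bar R :=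
  ereal_sup [set (((1 + s%:R) `^ alpha)%:E *
                   \sum_(s <= j <oo) delta M j%:Z)%E | s in @setT nat].

Definition eps_dot (t1 t2 : nat) (w : Omega) : R :=
  dotv (epsilon t1%:Z w) (epsilon t2%:Z w).

End FixedSampleSize.

Definition short_range_dependent (M alpha : R) (d : nat -> nat)
    (g : forall T : nat, int -> 'I_(d T) -> (nat -> R) -> R) : Prop :=
  (1 < M /\ 1 < alpha) /\
  [/\ mutually_independent (fun t => e t : Omega -> R),
      (forall T t i, (0 < T)%N -> path_measurable (g T t i)),
      (forall T t i, (0 < T)%N -> ('E_P[fun w => (epsilon (g T) t w i 0)%R] = 0)%E),
      bigO_seq (fun T => moment_sup (g T) M) (fun=> 1) &
      bigO_seq (fun T => delta_tail_sup (g T) M alpha) (fun=> 1)].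

End Process.
End Probability.

(* Main.v *)
(* Let F_t be the vector epsilon_t as a function of the innovation path, and let
   E_{>u} be the conditional expectation given the innovations after time u, that
   is, the integral over the innovations up to time u.  For t2 < t1 expand the
   product F_{t1}.F_{t2} along the martingale differences
     P_{t2-q} = E_{>t2-q-1} - E_{>t2-q},  q >= 0.
   For fixed q, the sum over t1 is P_{t2-q} (A.F_{t2}) with A = sum_{t1} b F_{t1}.
   Up to an error governed by the tail of delta at the lag t1 - t2, A may be
   replaced by E_{>t2} A, which is independent of F_{t2}: the scalar product then
   costs sqrt d rather than d, and resampling e_{t2-q} produces the factor
   delta_q.  In t2 these terms form a reversed martingale difference sequence, so
   Rio's inequality adds them in quadrature, and the layers q are summed against
   the summable delta_q.  For the second bound, the layers of a pair with
   t1 - t2 <= l start only at q = l + 1 - (t1 - t2). *)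

From HB Require Import structures.
Require Import Defs.
From mathcomp Require Import measurable_realfun ring lra zify.

Set Implicit Arguments.
Unset Strict Implicit.
Unset Printing Implicit Defensive.

Import Order.TTheory GRing.Theory Num.Theory.
Import numFieldNormedType.Exports.

Local Open Scope classical_set_scope.
Local Open Scope ring_scope.

(** * Bounds in Lp *)

Section LpBounds.
Context (R : realType) (d : measure_display) (T : measurableType d).
Variable m : probability T R.
Implicit Types (p q c : R) (f g : T -> R).

(** Independence enters in one form only: the law of the innovations on path space is unchanged when
    any set of coordinates is replaced by those of an independent copy. Conditional expectations
    become integrals over the replaced coordinates, defined at every path, and E_J E_K is the
    conditional expectation given the common coordinates of J and K, nested or not. Conditioning on
    all innovations after time t - l - 1 reproduces F_{t,l}, since the products at hand ignore
    innovations later than t; this dictates the reversed direction of the martingales. The obstacle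
    is the dependence between A and F_{t2}: the error of removing it carries d instead of sqrt d and
    is paid for by the gap B, as the tails summed over lags at least B are of order B^(1 - alpha).
    With d of order T this error is T^2 B^(1 - alpha), the geometric mean of the two error terms of
    the first bound. Rio's inequality is used at exponent M / 2, hence M > 4. [Lpbound] joins
    measurability to a real bound, which keeps the arithmetic of constants out of the extended
    reals. *)

Definition Lpbound p f c :=
  measurable_fun setT f /\ ('N[m]_p%:E[EFin \o f] <= c%:E)%E.

Lemma Lpbound_meas p f c : Lpbound p f c -> measurable_fun setT f.
Proof. by case. Qed.

Lemma Lpbound_ge0 p f c : Lpbound p f c -> 0 <= c.
Proof. by case=> _ h; rewrite -lee_fin (le_trans _ h) ?Lnorm_ge0. Qed.

Lemma eq_Lpbound p f g c : f =1 g -> Lpbound p f c -> Lpbound p g c.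
Proof. by move=> /funext ->. Qed.

Lemma measurable_powR_norm p f : measurable_fun setT f ->
  measurable_fun setT (fun x => `|f x| `^ p).
Proof.
move=> mf; apply: (@measurableT_comp _ _ _ _ _ _ (@powR R ^~ p)) => //.
exact: measurableT_comp.
Qed.

Lemma Lnorm_powR p f : 0 < p ->
  ('N[m]_p%:E[EFin \o f] `^ p = \int[m]_x (`|f x| `^ p)%:E)%E.
Proof. by move=> p0; rewrite poweR_Lnorm ?gt_eqF//. Qed.

(** Raising to the power p removes the root, so that bounds can be compared under the integral sign,
    almost everywhere or through Tonelli. *)
Lemma LpboundP p f c : 0 < p -> 0 <= c -> measurable_fun setT f ->
  Lpbound p f c <-> (\int[m]_x (`|f x| `^ p)%:E <= (c `^ p)%:E)%E.
Proof.
move=> p0 c0 mf; rewrite -Lnorm_powR// -poweR_EFin; split.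
  by move=> [_ h]; apply: gt0_ler_poweR => //;
    rewrite ?in_itv/= ?leey ?lee_fin ?Lnorm_ge0 ?c0 ?ltW.
move=> h; split=> //.
have := @gt0_ler_poweR R p^-1 _ _ _ _ _ h.
rewrite -!poweRrM mulfV ?gt_eqF// !poweRe1 ?Lnorm_ge0 ?lee_fin//; apply.
- by rewrite invr_ge0 ltW.
- by rewrite in_itv/= leey andbT Lnorm_powR// integral_ge0// => x _;
    rewrite lee_fin powR_ge0.
- by rewrite in_itv/= leey andbT lee_fin powR_ge0.
Qed.

Lemma Lpbound_le p f c c' : c <= c' -> Lpbound p f c -> Lpbound p f c'.
Proof. by move=> cc [mf h]; split=> //; rewrite (le_trans h) ?lee_fin. Qed.

Lemma LpboundD p f g a b : 1 <= p -> Lpbound p f a -> Lpbound p g b ->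
  Lpbound p (fun x => f x + g x) (a + b).
Proof.
move=> p1 [mf hf] [mg hg]; split; first exact: measurable_funD.
by rewrite (le_trans (minkowski_EFin m mf mg p1))// EFinD leeD.
Qed.

Lemma Lpbound_cst p (k : R) : 0 < p -> Lpbound p (fun=> k) `|k|.
Proof.
move=> p0; apply/LpboundP => //.
by rewrite integral_cst//= probability_setT mule1.
Qed.

Lemma Lpbound0 p : 0 < p -> Lpbound p (fun=> 0) 0.
Proof. by move=> p0; rewrite -{2}(@normr0 _ R); exact: Lpbound_cst. Qed.

Lemma LpboundZ p f a (k : R) : 0 < p -> Lpbound p f a ->
  Lpbound p (fun x => k * f x) (`|k| * a).
Proof.
move=> p0 hf; have a0 := Lpbound_ge0 hf; have mf := Lpbound_meas hf.
have mkf : measurable_fun setT (fun x => k * f x).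
  exact: measurable_funM.
apply/LpboundP => //; first by rewrite mulr_ge0.
rewrite powRM// EFinM.
under eq_integral => x _ do rewrite normrM powRM// EFinM.
rewrite ge0_integralZl//; last exact/measurable_EFinP/measurable_powR_norm.
apply: lee_wpmul2l; first by rewrite lee_fin powR_ge0.
exact: (LpboundP p0 a0 mf).1 hf.
Qed.

Lemma LpboundN p f a : 0 < p -> Lpbound p f a -> Lpbound p (fun x => - f x) a.
Proof.
move=> p0 /(LpboundZ (-1) p0); rewrite normrN1 mul1r.
by under eq_fun do rewrite mulN1r.
Qed.

Lemma LpboundB p f g a b : 1 <= p -> Lpbound p f a -> Lpbound p g b ->
  Lpbound p (fun x => f x - g x) (a + b).
Proof.
by move=> p1 hf hg; apply: LpboundD => //; apply: LpboundN => //;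
  rewrite (lt_le_trans ltr01).
Qed.

Lemma Lpbound_sum p (I : Type) (r : seq I) (P : pred I) (F : I -> T -> R)
    (a : I -> R) : 1 <= p -> (forall i, P i -> Lpbound p (F i) (a i)) ->
  Lpbound p (fun x => \sum_(i <- r | P i) F i x) (\sum_(i <- r | P i) a i).
Proof.
move=> p1 h; elim: r => [|i r IH].
  rewrite big_nil; under eq_fun do rewrite big_nil.
  by apply: Lpbound0; rewrite (lt_le_trans ltr01).
rewrite big_cons; under eq_fun do rewrite big_cons.
by case: ifPn => // Pi; apply: LpboundD => //; exact: h.
Qed.

Lemma Lpbound_ae_le p f g a : 0 < p -> Lpbound p f a -> measurable_fun setT g ->
  {ae m, forall x, `|g x| <= `|f x|} -> Lpbound p g a.
Proof.
move=> p0 hf mg fg; have a0 := Lpbound_ge0 hf.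
have mf := Lpbound_meas hf.
apply/LpboundP => //; move/LpboundP : hf => /(_ p0 a0 mf); apply: le_trans.
apply: ae_ge0_le_integral => //.
- exact/measurable_EFinP/measurable_powR_norm.
- exact/measurable_EFinP/measurable_powR_norm.
by apply: filterS fg => x /= h _; rewrite lee_fin ge0_ler_powR ?nnegrE// ltW.
Qed.

Lemma Lpbound_ae p f g a : 0 < p -> Lpbound p f a -> measurable_fun setT g ->
  {ae m, forall x, f x = g x} -> Lpbound p g a.
Proof.
by move=> p0 hf mg fg; apply: Lpbound_ae_le hf _ _ => //;
  apply: filterS fg => x ->.
Qed.

(** Balls of Lp are closed: Minkowski gives the bound c + e for every e > 0. An infinite expansion
    thus inherits any bound common to its partial sums. *)
Lemma Lpbound_closure p f c : 1 <= p ->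
  (forall e, 0 < e -> exists2 g, Lpbound p g c & Lpbound p (fun x => f x - g x) e) ->
  Lpbound p f c.
Proof.
move=> p1 h; have H e : 0 < e -> Lpbound p f (c + e).
  move=> /h[g hg hfg]; have := LpboundD p1 hg hfg.
  by under eq_fun do rewrite addrC subrK.
split; first exact: (Lpbound_meas (H 1 ltr01)).
by apply/lee_addgt0Pr => e e0; have [] := H e e0.
Qed.

Lemma Lpbound_pow p s f a : 0 < p -> 0 < s -> 0 <= a -> measurable_fun setT f ->
  Lpbound p (fun x => `|f x| `^ s) (a `^ s) <-> Lpbound (s * p) f a.
Proof.
move=> p0 s0 a0 mf.
rewrite LpboundP ?powR_ge0//; last exact: measurable_powR_norm.
rewrite LpboundP ?mulr_gt0// powRrM.
under eq_integral do rewrite ger0_norm ?powR_ge0// -powRrM.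
by [].
Qed.

Lemma Lpbound_hoelder p q f g a b : 0 < p -> 0 < q -> p^-1 + q^-1 = 1 ->
  Lpbound p f a -> Lpbound q g b -> Lpbound 1 (fun x => f x * g x) (a * b).
Proof.
move=> p0 q0 pq [mf hf] [mg hg]; split; first exact: measurable_funM.
rewrite (le_trans (hoelder m mf mg p0 q0 pq))// EFinM.
by rewrite lee_pmul ?Lnorm_ge0.
Qed.

(** Cauchy-Schwarz applied to |f|^(p/2) and |g|^(p/2). *)
Lemma LpboundM p f g a b : 0 < p -> Lpbound p f a -> Lpbound p g b ->
  Lpbound (p / 2) (fun x => f x * g x) (a * b).
Proof.
move=> p0 hf hg; have a0 := Lpbound_ge0 hf; have b0 := Lpbound_ge0 hg.
have mf := Lpbound_meas hf; have mg := Lpbound_meas hg.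
have p20 : 0 < p / 2 by rewrite divr_gt0.
rewrite -[p / 2]mulr1; apply/Lpbound_pow => //; first by rewrite mulr_ge0.
  exact: measurable_funM.
rewrite powRM//; under eq_fun do rewrite normrM powRM//.
apply: (@Lpbound_hoelder 2 2) => //; first by lra.
  by apply/Lpbound_pow => //; rewrite divfK.
by apply/Lpbound_pow => //; rewrite divfK.
Qed.

Lemma Lpbound_half p f a : 0 < p -> Lpbound p f a -> Lpbound (p / 2) f a.
Proof.
move=> p0 hf; have := LpboundM p0 hf (Lpbound_cst 1 p0).
by rewrite normr1 mulr1; under eq_fun do rewrite mulr1.
Qed.

Lemma Lpbound_one p f a : 1 <= p -> Lpbound p f a -> Lpbound 1 f a.
Proof.
rewrite le_eqVlt => /predU1P[<-//|p1] hf.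
have p0 : 0 < p by rewrite (lt_trans ltr01).
have q0 : 0 < p / (p - 1) by rewrite divr_gt0// subr_gt0.
have := Lpbound_hoelder p0 q0 _ hf (Lpbound_cst 1 q0).
rewrite normr1 mulr1; under eq_fun do rewrite mulr1; apply.
by rewrite invf_div mulrBl mul1r mulfV ?gt_eqF// subrKC.
Qed.

Lemma Lpbound1_integral f a : Lpbound 1 f a ->
  m.-integrable setT (EFin \o f) /\ `|\int[m]_x f x| <= a.
Proof.
move=> hf; have mf := Lpbound_meas hf; have a0 := Lpbound_ge0 hf.
have : (\int[m]_x (`|f x|)%:E <= a%:E)%E.
  move/LpboundP : hf => /(_ ltr01 a0 mf); rewrite powRr1//.
  by under eq_integral do rewrite powRr1//.
move=> h; have intf : m.-integrable setT (EFin \o f).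
  apply/integrableP; split; first exact/measurable_EFinP.
  by rewrite (le_lt_trans h) ?ltry.
split=> //; rewrite -lee_fin EFin_normr_Rintegral//.
by rewrite (le_trans _ h)// le_abse_integral//; exact/measurable_EFinP.
Qed.

Lemma Lpbound_integrable p f a : 1 <= p -> Lpbound p f a ->
  m.-integrable setT (EFin \o f).
Proof. by move=> p1 /(Lpbound_one p1)/Lpbound1_integral[]. Qed.

End LpBounds.

(** * Rio's inequality *)

Section RioInequality.
Context (R : realType).
Implicit Type p : R.

(** With u = p h, (1 + h)^p = exp (p ln (1 + h)) <= exp u <= 1 / (1 - u), and 1 / (1 - u) <= 1 + u +
    2 u^2 as long as u <= 1/2. *)
Lemma powR_1D_le p (h : R) : 0 < p -> `|p * h| <= 1 / 2 -> `|h| < 1 ->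
  (1 + h) `^ p <= 1 + p * h + 2 * (p * h) ^+ 2.
Proof.
move=> p0 /ler_normlP[ph1 ph2] /ltr_normlP[h1 _].
have h0 : 0 < 1 + h by lra.
rewrite /powR gt_eqF//.
have le1 : p * ln (1 + h) <= p * h by rewrite ler_pM2l// le_ln1Dx//; lra.
rewrite (le_trans (_ : _ <= expR (p * h))) ?ler_expR//.
set u := p * h in ph1 ph2 le1 *.
have := expR_ge1Dx (- u); rewrite expRN => h2.
have e0 := expR_gt0 u.
have : (1 - u) * expR u <= 1.
  by rewrite -ler_pdivlMr// div1r.
nra.
Qed.

(** The first summand serves the regime |x| < 2 p |y|, where |x + y| <= (2 p + 1) |y|; the second is
    the quadratic remainder of [powR_1D_le]. *)
Definition taylor_const p := (2 * p + 1) `^ p + 2 * p ^+ 2.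

Lemma taylor_const_ge1 p : 2 < p -> 1 <= taylor_const p.
Proof.
move=> p2; have : 1 <= (2 * p + 1) `^ p by rewrite -{1}(powRr0 (2 * p + 1)) ler_powR//; lra.
by rewrite /taylor_const; have := sqr_ge0 p; lra.
Qed.

(* Second-order Taylor expansion when |y| <= |x| / (2 p); otherwise |x + y|^p is
   itself of the order of |y|^p. *)
Lemma powR_normD_le p (x y : R) : 2 < p ->
  `|x + y| `^ p <= `|x| `^ p + p * (`|x| `^ (p - 2) * (x * y)) +
     taylor_const p * (`|x| `^ (p - 2) * (y * y) + `|y| `^ p).
Proof.
move=> p2; have p0 : 0 < p by lra.
have C0 : 0 <= (2 * p + 1) `^ p by exact: powR_ge0.
have [xy|xy] := lerP (2 * p * `|y|) `|x|.
  have [->|x0] := eqVneq x 0.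
    rewrite normr0 add0r mul0r !mulr0 addr0 !powR0 ?gt_eqF ?subr_gt0// mul0r !add0r.
    rewrite ler_peMl ?powR_ge0//.
    exact: taylor_const_ge1.
  have nx0 : 0 < `|x| by rewrite normr_gt0.
  pose h := y / x.
  have yE : y = x * h by rewrite mulrCA mulfV// mulr1.
  have hx : `|p * h| <= 1 / 2.
    rewrite /h !normrM normfV (gtr0_norm p0) mulrA ler_pdivrMr//; lra.
  have h1 : `|h| < 1.
    move: hx; rewrite normrM gtr0_norm// => hx.
    have := normr_ge0 h; nra.
  have h1D : 0 < 1 + h by move/ltr_normlP : h1 => []; lra.
  rewrite {1}yE -{1}[x]mulr1 -mulrDr normrM powRM// (gtr0_norm h1D).
  apply: (le_trans (ler_wpM2l (powR_ge0 _ _) (powR_1D_le p0 hx h1))).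
  have xp : `|x| `^ p = `|x| `^ (p - 2) * (x * x).
    have -> : x * x = `|x| `^ 2 by rewrite powR_mulrn// real_normK// num_real.
    by rewrite -powRD ?subrK// gt_eqF.
  rewrite xp yE.
  have k0 := powR_ge0 (`|x|) (p - 2).
  have k1 := powR_ge0 (`|x * h|) p.
  have C2 : 2 * p ^+ 2 <= taylor_const p by rewrite /taylor_const; lra.
  have xh : 0 <= `|x| `^ (p - 2) * (x * h * (x * h)) by rewrite mulr_ge0// -expr2 sqr_ge0.
  have : taylor_const p * `|x * h| `^ p >= 0.
    by rewrite mulr_ge0// (le_trans _ C2)// mulr_ge0 ?sqr_ge0.
  have := ler_wpM2r xh C2.
  nra.
have ny0 : 0 < `|y|.
  by rewrite lt_def normr_ge0 andbT; apply/eqP => y0; move: xy;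
   rewrite y0 mulr0 ltNge normr_ge0.
have h1 : `|x + y| `^ p <= (2 * p + 1) `^ p * `|y| `^ p.
  rewrite -powRM//; last lra.
  apply: ge0_ler_powR; rewrite ?nnegrE ?normr_ge0//; first exact: ltW.
    by rewrite mulr_ge0//; lra.
  by rewrite (le_trans (ler_normD _ _))//; lra.
(* The first-order term may be negative here; it is at least -2 p^2 |x|^(p-2) y^2, which the summand
   2 p^2 of [taylor_const] absorbs. *)
have h2 : - (`|x| `^ (p - 2) * (2 * p * (y * y))) <= `|x| `^ (p - 2) * (x * y).
  rewrite -mulrN ler_wpM2l ?powR_ge0//.
  rewrite lerNl (le_trans (ler_norm _))// normrN normrM.
  have -> : y * y = `|y| * `|y| by rewrite -normrM ger0_norm// -expr2 sqr_ge0.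
  by rewrite mulrA ler_wpM2r// ltW.
have := ler_wpM2l (ltW p0) h2.
have k0 := powR_ge0 (`|x|) (p - 2).
have k1 := powR_ge0 (`|x|) p.
have k2 := powR_ge0 (`|y|) p.
have k3 : 0 <= `|x| `^ (p - 2) * (y * y) by rewrite mulr_ge0// -expr2 sqr_ge0.
rewrite /taylor_const.
set A := (2 * p + 1) `^ p in h1 C0 *.
have : 0 <= A * (`|x| `^ (p - 2) * (y * y)) by rewrite mulr_ge0.
have : 0 <= (2 * p ^+ 2) * `|y| `^ p by rewrite mulr_ge0// mulr_ge0// sqr_ge0.
nra.
Qed.

(** The power lies above its tangent at x; this is Young's inequality for the product of x + z and
    x^(r-1). *)
Lemma powRD_ge r (x z : R) : 1 < r -> 0 <= x -> 0 <= z ->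
  x `^ r + r * (x `^ (r - 1) * z) <= (x + z) `^ r.
Proof.
move=> r1 x0 z0.
have r0 : 0 < r by lra.
have q0 : 0 < r / (r - 1) by rewrite divr_gt0//; lra.
have rq : r^-1 + (r / (r - 1))^-1 = 1.
  by rewrite invf_div mulrBl mul1r mulfV ?gt_eqF// subrKC.
have := conjugate_powR (addr_ge0 x0 z0) (powR_ge0 x (r - 1)) r0 q0 rq.
have -> : (x `^ (r - 1)) `^ (r / (r - 1)) = x `^ r.
  by rewrite -powRrM mulrCA mulfV ?mulr1//; lra.
rewrite mulrDl mulr_powRB1// invf_div => h.
have := ler_wpM2l (ltW r0) h.
have -> : r * ((x + z) `^ r / r + x `^ r * ((r - 1) / r)) =
    (x + z) `^ r + x `^ r * (r - 1) by field; rewrite gt_eqF.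
lra.
Qed.

Lemma powR_superadd r (x z : R) : 1 < r -> 0 <= x -> 0 <= z ->
  x `^ r + z `^ r <= (x + z) `^ r.
Proof.
move=> r1 x0 z0; have r0 : 0 < r by lra.
rewrite -(mulr_powRB1 (addr_ge0 x0 z0) r0) -(mulr_powRB1 x0 r0).
rewrite -(mulr_powRB1 z0 r0) mulrDl.
have r10 : 0 <= r - 1 by rewrite subr_ge0 ltW.
have xz0 : 0 <= x + z by rewrite addr_ge0.
by apply: lerD; apply: ler_wpM2l => //; apply: ge0_ler_powR => //; lra.
Qed.

Definition rio_const p := 2 * taylor_const p.

(** With r = p / 2 the right side is (a^2 + c b^2)^r for c = [rio_const p]. It dominates both the
    tangent bound [powRD_ge] and the bound [powR_superadd]. Their average yields the two remainder
    terms, and the factor 2 in [rio_const] pays for averaging. *)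
Lemma rio_combine p (a b : R) : 2 < p -> 0 <= a -> 0 <= b ->
  a `^ p + taylor_const p * (a `^ (p - 2) * (b * b) + b `^ p) <=
  (Num.sqrt (a ^+ 2 + rio_const p * b ^+ 2)) `^ p.
Proof.
move=> p2 a0 b0; have C1 := taylor_const_ge1 p2.
have K0 : 0 <= rio_const p by rewrite /rio_const; lra.
have r1 : 1 < p / 2 by lra.
have sq (c : R) s : 0 <= c -> c `^ (2 * s) = (c ^+ 2) `^ s.
  by move=> c0; rewrite powRrM powR_mulrn.
have Kb0 : 0 <= rio_const p * b ^+ 2 by rewrite mulr_ge0 ?sqr_ge0.
have aKb0 : 0 <= a ^+ 2 + rio_const p * b ^+ 2 by rewrite addr_ge0 ?sqr_ge0.
rewrite -(powR12_sqrt aKb0) -powRrM.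
have -> : 2^-1 * p = p / 2 by rewrite mulrC.
have h1 := powRD_ge r1 (sqr_ge0 a) Kb0.
have h2 := powR_superadd r1 (sqr_ge0 a) Kb0.
have e1 : a `^ p = (a ^+ 2) `^ (p / 2) by rewrite -sq// mulrC divfK.
have e2 : a `^ (p - 2) = (a ^+ 2) `^ (p / 2 - 1) by rewrite -sq//; congr powR; lra.
have e3 : b `^ p = (b ^+ 2) `^ (p / 2) by rewrite -sq// mulrC divfK.
rewrite e1 e2 e3 -expr2.
have h3 : rio_const p * (b ^+ 2) `^ (p / 2) <= (rio_const p * b ^+ 2) `^ (p / 2).
  rewrite powRM ?sqr_ge0// ler_wpM2r ?powR_ge0//.
  by rewrite -{1}(powRr1 K0) ler_powR//; rewrite /rio_const; lra.
have k0 : 0 <= (a ^+ 2) `^ (p / 2 - 1) * b ^+ 2 by rewrite mulr_ge0 ?powR_ge0 ?sqr_ge0.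
set X := (a ^+ 2) `^ (p / 2) in h1 h2 *.
set Y := (a ^+ 2) `^ (p / 2 - 1) in h1 k0 *.
set Z := (b ^+ 2) `^ (p / 2) in h3 *.
have : 0 <= (p / 2 - 1) * (taylor_const p * (Y * b ^+ 2)).
  by apply: mulr_ge0; [lra|apply: mulr_ge0 => //; lra].
move: h1 h3; rewrite /rio_const; set C := taylor_const p in C1 *.
nra.
Qed.

Context (d : measure_display) (T : measurableType d) (m : probability T R).

(** The first-order term of [powR_normD_le] integrates to zero by hypothesis; Hölder with exponents
    p / (p - 2) and p / 2 controls the second-order one. The square of a keeps the coefficient 1, so
    that iterating does not inflate the constant. *)
Lemma Lpbound_rio_step p (S D : T -> R) a b : 2 < p ->
  Lpbound m p S a -> Lpbound m p D b ->
  \int[m]_x (`|S x| `^ (p - 2) * S x * D x) = 0 ->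
  Lpbound m p (fun x => S x + D x) (Num.sqrt (a ^+ 2 + rio_const p * b ^+ 2)).
Proof.
move=> p2 hS hD orth.
have p0 : 0 < p by lra.
have a0 := Lpbound_ge0 hS; have b0 := Lpbound_ge0 hD.
have mS := Lpbound_meas hS; have mD := Lpbound_meas hD.
have iSp : Lpbound m 1 (fun x => `|S x| `^ p) (a `^ p).
  by apply/Lpbound_pow => //; rewrite mulr1.
have iDp : Lpbound m 1 (fun x => `|D x| `^ p) (b `^ p).
  by apply/Lpbound_pow => //; rewrite mulr1.
have q0 : 0 < p / (p - 2) by rewrite divr_gt0//; lra.
have hSq : Lpbound m (p / (p - 2)) (fun x => `|S x| `^ (p - 2)) (a `^ (p - 2)).
  apply/Lpbound_pow => //; first lra.
  by rewrite mulrCA mulfV ?mulr1//; lra.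
have pq : (p / (p - 2))^-1 + (p / 2)^-1 = 1.
  by rewrite !invf_div -mulrDl subrK mulfV// gt_eqF.
have h20 : 0 < p / 2 by lra.
have iSD2 := Lpbound_hoelder q0 h20 pq hSq (LpboundM p0 hD hD).
have iSSD := Lpbound_hoelder q0 h20 pq hSq (LpboundM p0 hS hD).
have [I1 J1] := Lpbound1_integral iSp.
have [I2 J2] := Lpbound1_integral iDp.
have [I3 J3] := Lpbound1_integral iSD2.
have [I4 _] := Lpbound1_integral iSSD.
apply/LpboundP; rewrite ?sqrtr_ge0//; first exact: measurable_funD.
pose C := taylor_const p.
pose G x := `|S x| `^ p + p * (`|S x| `^ (p - 2) * (S x * D x)) +
     C * (`|S x| `^ (p - 2) * (D x * D x) + `|D x| `^ p).
have b5 := LpboundZ p ltr01 iSSD.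
have b6 := LpboundD (lexx 1) iSD2 iDp.
have b7 := LpboundZ C ltr01 b6.
have b8 := LpboundD (lexx 1) iSp b5.
have [I5 _] := Lpbound1_integral b5.
have [I6 _] := Lpbound1_integral b6.
have [I7 _] := Lpbound1_integral b7.
have [I8 _] := Lpbound1_integral b8.
have [IG _] := Lpbound1_integral (LpboundD (lexx 1) b8 b7).
apply: (@le_trans _ _ (\int[m]_x (G x)%:E)%E).
  apply: ge0_le_integral => //.
  - exact/measurable_EFinP/measurable_powR_norm/measurable_funD.
  - exact: (measurable_int m).
  - by move=> x _; rewrite lee_fin; exact: powR_normD_le.
rewrite -(fineK (integrable_fin_num measurableT IG)) lee_fin.
apply: le_trans (rio_combine p2 a0 b0).
rewrite -/(Rintegral m setT G) /G RintegralD// RintegralD// RintegralZl// RintegralZl//.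
have -> : \int[m]_x (`|S x| `^ (p - 2) * (S x * D x)) = 0.
  by rewrite -[RHS]orth; under eq_Rintegral do rewrite mulrA.
rewrite mulr0 addr0 RintegralD//.
have C1 := taylor_const_ge1 p2; rewrite -/C in C1 *.
have C0 : 0 <= C := le_trans ler01 C1.
apply: lerD; first exact: le_trans (ler_norm _) J1.
apply: ler_wpM2l => //; apply: lerD; first exact: le_trans (ler_norm _) J3.
exact: le_trans (ler_norm _) J2.
Qed.

Lemma Lpbound_rio p (D : nat -> T -> R) (c : nat -> R) n : 2 < p ->
  (forall i, (i < n)%N -> Lpbound m p (D i) (c i)) ->
  (forall i, (i < n)%N ->
     \int[m]_x (`|\sum_(j < i) D j x| `^ (p - 2) * (\sum_(j < i) D j x) * D i x) = 0) ->
  Lpbound m p (fun x => \sum_(j < n) D j x)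
    (Num.sqrt (rio_const p * \sum_(j < n) c j ^+ 2)).
Proof.
move=> p2; have p0 : 0 < p by lra.
have K0 : 0 <= rio_const p by have := taylor_const_ge1 p2; rewrite /rio_const; lra.
elim: n => [|n IH] hD orth.
  rewrite big_ord0 mulr0 sqrtr0; under eq_fun do rewrite big_ord0.
  exact: Lpbound0.
under eq_fun do rewrite big_ord_recr/=.
rewrite big_ord_recr/= mulrDr.
have {}IH := IH (fun i h => hD i (ltnW h)) (fun i h => orth i (ltnW h)).
have := Lpbound_rio_step p2 IH (hD _ (ltnSn n)) (orth _ (ltnSn n)).
by rewrite sqr_sqrtr// mulr_ge0// sumr_ge0// => i _; exact: sqr_ge0.
Qed.

End RioInequality.

(** * Path space and resampling *)

Section PathSpace.
Context (R : realType).

(** For the index type [nat] this is [coordinate_sets], so that a [path_measurable] function is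
    measurable on [paths R nat]. *)
Definition coord_sets (I : Type) : set (set (I -> R)) :=
  \bigcup_k preimage_set_system setT (fun x : I -> R => x k) measurable.

Definition paths (I : Type) := g_sigma_algebraType (@coord_sets I).

Lemma measurable_coord (I : Type) (i : I) :
  measurable_fun setT (fun x : paths I => x i).
Proof. by move=> _ A mA; apply: sub_sigma_algebra; exists i => //; exists A. Qed.

Lemma measurable_into_paths (I : Type) d (T : measurableType d) (f : T -> paths I) :
  (forall i, measurable_fun setT (fun w => f w i)) -> measurable_fun setT f.
Proof.
move=> mf; apply: (@measurability d _ T (paths I) setT f (@coord_sets I)) => //.
by move=> _ [_ [i _ [A mA <-]] <-]; rewrite !setTI; have := mf i measurableT A mA; rewrite setTI.
Qed.

(** A set is attached to every index, equal to [setT] off a finite list under [finite_support];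
    resampling then splits a box coordinate by coordinate. *)
Definition box (I : Type) (A : I -> set R) : set (paths I) :=
  [set x | forall i, A i (x i)].

Definition finite_support (I : eqType) (s : seq I) (A : I -> set R) :=
  [/\ uniq s, forall i, measurable (A i) & forall i, i \notin s -> A i = setT].

Lemma boxE (I : eqType) (s : seq I) (A : I -> set R) : finite_support s A ->
  box A = \bigcap_(i in [set` s]) ((fun x : paths I => x i) @^-1` A i).
Proof.
move=> [_ _ AT]; apply/seteqP; split => [x h i _|x h i]; first exact: h.
by have [/h//|/AT ->//] := boolP (i \in s).
Qed.

Lemma measurable_box (I : eqType) (s : seq I) A : finite_support s A ->
  measurable (box A : set (paths I)).
Proof.
move=> fA; rewrite (boxE fA).
apply: fin_bigcap_measurable => // i _; rewrite -[X in measurable X]setTI.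
by case: fA => _ mA _; exact: measurable_coord.
Qed.

Definition boxes (I : eqType) : set (set (paths I)) :=
  [set E | exists s A, finite_support s A /\ E = box A].

Lemma boxes_setI (I : eqType) : setI_closed (@boxes I).
Proof.
move=> _ _ [s [A [[us mA sA] ->]]] [s' [A' [[us' mA' sA'] ->]]].
exists (undup (s ++ s')), (fun i => A i `&` A' i); split.
  split; first exact: undup_uniq.
    by move=> i; exact: measurableI.
  by move=> i; rewrite mem_undup mem_cat negb_or => /andP[/sA -> /sA' ->]; rewrite setTI.
apply/seteqP; split => [x [hx hx'] i|x hx]; first by split; [exact: hx|exact: hx'].
by split => i; have [] := hx i.
Qed.

Lemma measurable_boxes (I : eqType) (E : set (paths I)) :
  measurable E -> <<s @boxes I >> E.
Proof.
apply: smallest_sub; first exact: smallest_sigma_algebra.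
move=> _ [k _ [A mA <-]]; apply: sub_sigma_algebra.
exists [:: k], (fun i => if i == k then A else setT); split.
  split=> //; first by move=> i; case: ifP.
  by move=> i; rewrite inE => /negbTE ->.
rewrite setTI; apply/seteqP; split => [x Ax i|x /(_ k)] /=; last by rewrite eqxx.
by case: eqP => // ->.
Qed.

(** Boxes generate the sigma-algebra and are closed under intersection, so agreement on them
    suffices. *)
Lemma paths_measure_eq (I : eqType) (m1 m2 : probability (paths I) R) :
  (forall s A, finite_support s A -> m1 (box A) = m2 (box A)) ->
  forall E, measurable E -> m1 E = m2 E.
Proof.
move=> h E /measurable_boxes.
apply: (@g_sigma_algebra_measure_unique _ _ _ (@boxes I) _ (fun=> setT)).
- by move=> _ [s [A [/measurable_box ? ->]]].
- move=> _; exists [::], (fun=> setT); split; first by split.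
  by apply/seteqP; split.
- by rewrite bigcup_const//; exists 0%N.
- exact: boxes_setI.
- by move=> _ [s [A [fA ->]]]; exact: h fA.
- by move=> k; rewrite /= probability_setT ltry.
Qed.

(* When y is an independent copy of x, the innovations outside J are resampled. *)
Definition mix (I : Type) (J : pred I) (x y : paths I) : paths I :=
  fun i => if J i then x i else y i.

Definition mixz (I : Type) (J : pred I) (z : paths I * paths I) : paths I :=
  mix J z.1 z.2.

Lemma measurable_mixz (I : Type) (J : pred I) : measurable_fun setT (@mixz I J).
Proof.
apply: measurable_into_paths => i; rewrite /mixz /mix; case: (J i).
  by apply: (measurableT_comp (measurable_coord i)).
by apply: (measurableT_comp (measurable_coord i)).
Qed.

HB.instance Definition _ (I : Type) (J : pred I) :=
  isMeasurableFun.Build _ _ _ _ (@mixz I J) (@measurable_mixz I J).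

(** Independence of the coordinates, in the form of stability under resampling; the calculus of
    [condE] rests on this property alone. *)
Definition mix_invariant (I : Type) (mu : probability (paths I) R) :=
  forall (J : pred I) E, measurable E ->
    (mu \x mu)%E (mixz J @^-1` E) = mu E.

End PathSpace.

(** * The law of an independent family, and of the family together with its copy *)

Section JointLaw.
Context (R : realType) (d : measure_display) (Omega : measurableType d).
Variables (P : probability Omega R).

Definition joint (I : Type) (X : I -> {RV P >-> R}) : Omega -> paths R I :=
  fun w i => X i w.

Lemma measurable_joint (I : Type) (X : I -> {RV P >-> R}) :
  measurable_fun setT (joint X).
Proof. by apply: measurable_into_paths => i; exact: measurable_funP. Qed.

HB.instance Definition _ (I : Type) (X : I -> {RV P >-> R}) :=
  isMeasurableFun.Build _ _ _ _ (joint X) (measurable_joint X).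

Definition law (I : Type) (X : I -> {RV P >-> R}) : probability (paths R I) R :=
  distribution P (joint X).

Lemma law_box (I : eqType) (X : I -> {RV P >-> R}) s A :
  mutually_independent P (fun i => X i : Omega -> R) -> finite_support s A ->
  law X (box A) = (\prod_(i <- s) P (X i @^-1` A i))%E.
Proof.
move=> indX fA; have [us mA sA] := fA.
rewrite -indX// (boxE fA) /law /= /distribution /pushforward preimage_bigcap.
by [].
Qed.

(** The preimage of a box is a product of two boxes, one constraining the coordinates in J and the
    other the rest; independence recombines the two products of probabilities into one. *)
Lemma mix_invariant_law (I : eqType) (X : I -> {RV P >-> R}) :
  mutually_independent P (fun i => X i : Omega -> R) -> mix_invariant (law X).
Proof.
move=> indX J E mE.
pose f : {mfun (paths R I * paths R I)%type >-> paths R I} := mixz J.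
apply: (@paths_measure_eq R I (distribution (law X \x law X)%E f) (law X)) => // s A fA.
have [us mA sA] := fA.
pose A1 i := if J i then A i else setT.
pose A2 i := if J i then setT else A i.
have fA1 : finite_support s A1.
  by split=> // i; rewrite /A1; case: ifP => // _; exact: sA.
have fA2 : finite_support s A2.
  by split=> // i; rewrite /A2; case: ifP => // _; exact: sA.
transitivity ((law X \x law X)%E (box A1 `*` box A2)).
  rewrite /= /distribution /pushforward; congr (_ _).
  apply/seteqP; split => [z h|z [h1 h2] i]; rewrite /f /mixz /mix /=.
    by split=> i; have := h i; rewrite /f /mixz /mix /A1 /A2 /=; case: (J i).
  by have := h1 i; have := h2 i; rewrite /A1 /A2 /=; case: (J i).
rewrite product_measure1E; [|exact: measurable_box fA1|exact: measurable_box fA2].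
apply: (etrans (congr2 mule (law_box indX fA1) (law_box indX fA2))).
apply: etrans (esym (law_box indX fA)).
rewrite -big_split; apply: eq_bigr => i _ /=.
by rewrite /A1 /A2; case: (J i); rewrite preimage_setT probability_setT ?mule1 ?mul1e.
Qed.

Section PairLaw.
Context (I : eqType) (X Y : I -> {RV P >-> R}).

Let Z (i : I + I) : {RV P >-> R} := match i with inl t => X t | inr t => Y t end.

Hypothesis indX : mutually_independent P (fun i => X i : Omega -> R).
Hypothesis indZ : mutually_independent P (fun i => Z i : Omega -> R).
Hypothesis XY : forall i A, measurable A -> distribution P (Y i) A = distribution P (X i) A.

Let split_paths (z : paths R (I + I)) : paths R I * paths R I :=
  ((fun i => z (inl i)), (fun i => z (inr i))).

Let merge_paths (z : paths R I * paths R I) : paths R (I + I) :=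
  fun i => match i with inl t => z.1 t | inr t => z.2 t end.

Let measurable_split : measurable_fun setT split_paths.
Proof.
by apply: measurable_fun_pair; apply: measurable_into_paths => i; exact: measurable_coord.
Qed.

Let measurable_merge : measurable_fun setT merge_paths.
Proof.
apply: measurable_into_paths => -[i|i].
  exact: (measurableT_comp (measurable_coord i) measurable_fst).
exact: (measurableT_comp (measurable_coord i) measurable_snd).
Qed.

HB.instance Definition _ :=
  isMeasurableFun.Build _ _ _ _ merge_paths measurable_merge.

(** This identifies the coupling of [e] with [edag] as two independent draws from one law, the
    setting in which [mixz] operates. It is checked on boxes indexed by the sum type. *)
Lemma pair_law (E : set (paths R I * paths R I)) : measurable E ->
  P ((fun w => (joint X w, joint Y w)) @^-1` E) = (law X \x law X)%E E.
Proof.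
move=> mE.
pose f : {mfun (paths R I * paths R I)%type >-> paths R (I + I)} := merge_paths.
have mE' : measurable (split_paths @^-1` E).
  by rewrite -[X in measurable X]setTI; exact: measurable_split.
transitivity (law Z (split_paths @^-1` E)); first by [].
rewrite (@paths_measure_eq R _ (law Z) (distribution (law X \x law X)%E f) _ _ mE').
  by rewrite /= /distribution /pushforward; congr (_ _); apply/seteqP; split => -[].
move=> s A fA; have [us mA sA] := fA.
(* The support is rearranged as its left indices followed by its right ones, so that the product
   over it splits between the two factors. *)
pose s1 := undup (pmap (fun i : I + I => if i is inl t then Some t else None) s).
pose s2 := undup (pmap (fun i : I + I => if i is inr t then Some t else None) s).
have fA1 : finite_support s1 (A \o inl).
  split; [exact: undup_uniq|by move=> i; exact: mA|move=> i h; apply: sA].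
  apply: contra h; rewrite mem_undup mem_pmap => h.
  by apply/mapP; exists (inl i).
have fA2 : finite_support s2 (A \o inr).
  split; [exact: undup_uniq|by move=> i; exact: mA|move=> i h; apply: sA].
  apply: contra h; rewrite mem_undup mem_pmap => h.
  by apply/mapP; exists (inr i).
have fA' : finite_support (map inl s1 ++ map inr s2) A.
  split=> //.
    rewrite cat_uniq !map_inj_uniq ?undup_uniq ?andbT/=; try by move=> ? ? [].
    by apply/hasPn => _ /mapP[i _ ->]; apply/negP => /mapP[].
  case=> i; rewrite mem_cat negb_or => /andP[h1 h2].
    have [_ _ /(_ i)/= ->//] := fA1.
    by apply: contra h1 => h; apply/mapP; exists i.
  have [_ _ /(_ i)/= ->//] := fA2.
  by apply: contra h2 => h; apply/mapP; exists i.
transitivity ((law X \x law X)%E (box (A \o inl) `*` box (A \o inr))).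
  rewrite product_measure1E; [|exact: measurable_box fA1|exact: measurable_box fA2].
  apply: (etrans (law_box indZ fA')).
  apply: etrans (esym (congr2 mule (law_box indX fA1) (law_box indX fA2))).
  rewrite big_cat !big_map; congr (_ * _)%E; apply: eq_bigr => i _.
  exact: XY.
rewrite /= /distribution /pushforward; congr (_ _).
apply/seteqP; split => [z [h1 h2] [i|i]|z h]; [exact: h1|exact: h2|].
by split=> i; [exact: (h (inl i))|exact: (h (inr i))].
Qed.

End PairLaw.

End JointLaw.

Lemma Rintegral_prob_cst (R : realType) d (T : measurableType d)
  (m : probability T R) (k : R) : \int[m]_x k = k.
Proof. by rewrite Rintegral_cst//= probability_setT mulr1. Qed.

Section Disintegration.
Context (R : realType) (d1 d2 : measure_display).
Context (T1 : measurableType d1) (T2 : measurableType d2).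
Variables (m1 : probability T1 R) (m2 : probability T2 R).

(** Jensen's inequality without an integrability assumption: if the right side is infinite there is
    nothing to prove, otherwise [h] is in Lp. *)
Lemma Rintegral_section_le p (h : T2 -> R) : 1 <= p -> measurable_fun setT h ->
  ((`|\int[m2]_y h y| `^ p)%:E <= \int[m2]_y (`|h y| `^ p)%:E)%E.
Proof.
move=> p1 mh; have p0 : 0 < p by lra.
set v := (\int[m2]_y (`|h y| `^ p)%:E)%E.
have v0 : (0 <= v)%E by apply: integral_ge0 => y _; rewrite lee_fin powR_ge0.
have [voo|vfin] := eqVneq v +oo%E; first by rewrite voo leey.
have vE : v = (fine v)%:E by rewrite fineK// ge0_fin_numE// ltey.
have fv0 : 0 <= fine v by exact: fine_ge0.
have hb : Lpbound m2 p h (fine v `^ p^-1).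
  by apply/LpboundP; rewrite ?powR_ge0// -powRrM mulVf ?gt_eqF// powRr1// -vE.
have [_ le] := Lpbound1_integral (Lpbound_one p1 hb).
rewrite vE lee_fin (le_trans (ge0_ler_powR _ _ _ le)) ?nnegrE ?powR_ge0//; first exact: ltW.
by rewrite -powRrM mulVf ?gt_eqF// powRr1.
Qed.

(** Jensen on each section, then Tonelli: averaging over the second variable does not increase the
    norm. *)
Lemma Lpbound_section p (F : T1 * T2 -> R) c : 1 <= p ->
  Lpbound (m1 \x m2)%E p F c -> Lpbound m1 p (fun x => \int[m2]_y F (x, y)) c.
Proof.
move=> p1 hF; have p0 : 0 < p by lra.
have c0 := Lpbound_ge0 hF; have mF := Lpbound_meas hF.
have mFx x : measurable_fun setT (fun y => F (x, y)).
  exact: (measurableT_comp mF (pair1_measurable x)).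
have iF := Lpbound_integrable p1 hF.
have mI : measurable_fun setT (fun x => \int[m2]_y F (x, y)).
  apply: (@measurableT_comp _ _ _ _ _ _ (@fine R)); first exact: fine_measurable.
  exact: (measurable_fubini_F iF).
apply/LpboundP => //.
apply: le_trans ((LpboundP _ p0 c0 mF).1 hF).
have mp : measurable_fun setT (fun z => (`|F z| `^ p)%:E).
  exact/measurable_EFinP/measurable_powR_norm.
rewrite fubini_tonelli1//.
apply: ge0_le_integral => //.
- exact/measurable_EFinP/measurable_powR_norm.
- by apply: measurable_fun_fubini_tonelli_F => // z; rewrite lee_fin powR_ge0.
- by move=> x _; exact: Rintegral_section_le.
Qed.

End Disintegration.

(** * Conditional expectations by integrating out coordinates *)

Section CondExp.
Context (R : realType) (Ix : Type) (mu : probability (paths R Ix) R).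
Hypothesis mu_mix : mix_invariant mu.

Local Notation S := (paths R Ix).
Implicit Types (J K : pred Ix) (f g : S -> R).

(** A pointwise substitute for measurability with respect to the coordinates in J. It is available
    because [condE] is defined at every path, and it needs no completion by null sets. *)
Definition depends_on J f := forall x y : S, (forall i, J i -> x i = y i) -> f x = f y.

(* For a law invariant under [mix] this is a version of the conditional expectation
   given the coordinates in J. *)
Definition condE J f (x : S) : R := \int[mu]_y f (mix J x y).

Lemma depends_on_mix J f x y : depends_on J f -> f (mix J x y) = f x.
Proof. by move=> h; apply: h => i Ji; rewrite /mix Ji. Qed.

Lemma mix_integral_ge0 J (f : S -> \bar R) : measurable_fun setT f ->
  (forall x, 0 <= f x)%E ->
  (\int[(mu \x mu)%E]_z f (mixz J z) = \int[mu]_x f x)%E.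
Proof.
move=> mf f0.
rewrite -(@ge0_integral_pushforward _ _ _ _ _ (mixz J) (measurable_mixz J) _ setT f)//.
apply: eq_measure_integral => /= A mA _.
exact: mu_mix.
Qed.

Lemma Lpbound_mix p J f c : 0 < p -> Lpbound mu p f c ->
  Lpbound (mu \x mu)%E p (fun z => f (mixz J z)) c.
Proof.
move=> p0 hf; have c0 := Lpbound_ge0 hf; have mf := Lpbound_meas hf.
apply/LpboundP => //; first exact: (measurableT_comp mf (measurable_mixz J)).
rewrite (mix_integral_ge0 J (f := fun x => (`|f x| `^ p)%:E)).
- exact: ((LpboundP _ p0 c0 mf).1 hf).
- exact/measurable_EFinP/measurable_powR_norm.
- by move=> x; rewrite lee_fin powR_ge0.
Qed.

Lemma Lpbound_condE p J f c : 1 <= p -> Lpbound mu p f c ->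
  Lpbound mu p (condE J f) c.
Proof.
move=> p1 /(Lpbound_mix J (lt_le_trans ltr01 p1)).
exact: Lpbound_section.
Qed.

Lemma integrable_Lpbound1 f : mu.-integrable setT (EFin \o f) ->
  exists c, Lpbound mu 1 f c.
Proof.
move=> /integrableP[mf lf].
exists (fine (\int[mu]_x `|(EFin \o f) x|)%E); split; first exact/measurable_EFinP.
by rewrite Lnorm1 fineK// ge0_fin_numE// integral_ge0.
Qed.

Lemma integrable_condE J f : mu.-integrable setT (EFin \o f) ->
  mu.-integrable setT (EFin \o condE J f).
Proof.
by move=> /integrable_Lpbound1[c /(Lpbound_condE J (lexx 1))/Lpbound1_integral[]].
Qed.

Lemma integrable_mix J f : mu.-integrable setT (EFin \o f) ->
  (mu \x mu)%E.-integrable setT (EFin \o (fun z => f (mixz J z))).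
Proof. by move=> /integrable_Lpbound1[c /(Lpbound_mix J ltr01)/Lpbound1_integral[]]. Qed.

Lemma ae_integrable_mix J f : mu.-integrable setT (EFin \o f) ->
  {ae mu, forall x, mu.-integrable setT (EFin \o (fun y => f (mix J x y)))}.
Proof. by move=> /(integrable_mix J)/ae_integrable1. Qed.

Lemma condE_dep J f : depends_on J (condE J f).
Proof.
move=> x y xy; rewrite /condE; apply: eq_Rintegral => z _; congr f.
by apply/funext => i; rewrite /mix; case: ifP => // /xy.
Qed.

(** Conditioning brings in no coordinate that f ignores. This is what reduces an infinite future to
    a finite window. *)
Lemma condE_depI J K f : depends_on K f -> depends_on (predI J K) (condE J f).
Proof.
move=> Kf x y xy; rewrite /condE; apply: eq_Rintegral => z _; apply: Kf => i Ki.
by rewrite /mix; case: ifP => // Ji; apply: xy; rewrite /= Ji.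
Qed.

Lemma condE_id J f : depends_on J f -> condE J f = f.
Proof.
move=> Jf; apply/funext => x; rewrite /condE.
under eq_Rintegral do rewrite depends_on_mix//.
by rewrite Rintegral_prob_cst.
Qed.

Lemma condE_indep J f : depends_on (predC J) f -> condE J f = fun=> \int[mu]_x f x.
Proof.
move=> Jf; apply/funext => x; rewrite /condE; apply: eq_Rintegral => y _.
by apply: Jf => i /= /negbTE; rewrite /mix => ->.
Qed.

(** Only almost everywhere: the inner integral is additive at those x for which both sections are
    integrable, and Fubini provides almost all of them. *)
Lemma condED J f g : mu.-integrable setT (EFin \o f) -> mu.-integrable setT (EFin \o g) ->
  {ae mu, forall x, condE J (fun x => f x + g x) x = condE J f x + condE J g x}.
Proof.
move=> /(ae_integrable_mix J) + /(ae_integrable_mix J).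
by apply: filterS2 => x hf hg; rewrite /condE RintegralD.
Qed.

Lemma condEZ J f k : mu.-integrable setT (EFin \o f) ->
  {ae mu, forall x, condE J (fun x => k * f x) x = k * condE J f x}.
Proof.
by move=> /(ae_integrable_mix J); apply: filterS => x hf; rewrite /condE RintegralZl.
Qed.

Lemma condEB J f g : mu.-integrable setT (EFin \o f) -> mu.-integrable setT (EFin \o g) ->
  {ae mu, forall x, condE J (fun x => f x - g x) x = condE J f x - condE J g x}.
Proof.
move=> /(ae_integrable_mix J) + /(ae_integrable_mix J).
by apply: filterS2 => x hf hg; rewrite /condE RintegralB.
Qed.

Lemma condE_pull J f g : depends_on J f -> mu.-integrable setT (EFin \o g) ->
  {ae mu, forall x, condE J (fun x => f x * g x) x = f x * condE J g x}.
Proof.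
move=> Jf /(ae_integrable_mix J); apply: filterS => x hg.
rewrite /condE -RintegralZl//.
by apply: eq_Rintegral => y _; rewrite depends_on_mix.
Qed.

Lemma Lpbound0_ae p f : 0 < p -> Lpbound mu p f 0 -> {ae mu, forall x, f x = 0}.
Proof.
move=> p0 [mf]; rewrite le_eqVlt ltNge Lnorm_ge0 orbF => /eqP.
move/Lnorm_eq0_eq0 => /(_ ((measurable_EFinP _ _).2 mf)).
rewrite lte_fin => /(_ p0); apply: filterS => x /(_ I) [].
by [].
Qed.

Lemma ae_Lpbound0 p f : 0 < p -> measurable_fun setT f ->
  {ae mu, forall x, f x = 0} -> Lpbound mu p f 0.
Proof.
move=> p0 mf; move=> h; apply: (Lpbound_ae p0 (Lpbound0 mu p0)) => //.
by apply: filterS h => x ->.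
Qed.

Lemma condE_ae J f g : mu.-integrable setT (EFin \o f) -> mu.-integrable setT (EFin \o g) ->
  {ae mu, forall x, f x = g x} -> {ae mu, forall x, condE J f x = condE J g x}.
Proof.
move=> intf intg fg.
have mf : measurable_fun setT f by apply/measurable_EFinP; exact: (measurable_int mu).
have mg : measurable_fun setT g by apply/measurable_EFinP; exact: (measurable_int mu).
have : Lpbound mu 1 (fun x => f x - g x) 0.
  apply: ae_Lpbound0 => //; first exact: measurable_funB.
  by apply: filterS fg => x ->; rewrite subrr.
move=> /(Lpbound_condE J (lexx 1))/(Lpbound0_ae ltr01).
have := condEB J intf intg.
by apply: filterS2 => x -> /eqP; rewrite subr_eq0 => /eqP.
Qed.

(** Fubini turns the left side into an integral over the product space, where the resampled path has
    law [mu] again; positive and negative parts are handled separately. *)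
Lemma integral_condE J f : mu.-integrable setT (EFin \o f) ->
  \int[mu]_x condE J f x = \int[mu]_x f x.
Proof.
move=> intf; rewrite /Rintegral; congr fine.
have i2 := integrable_mix J intf.
transitivity (\int[mu]_x \int[mu]_y (f (mix J x y))%:E)%E.
  apply: ae_eq_integral => //.
  - exact: (measurable_int mu (integrable_condE J intf)).
  - exact: (measurable_fubini_F i2).
  apply: filterS (ae_integrable_mix J intf) => x hx _.
  by rewrite /condE /Rintegral fineK// (integrable_fin_num _ hx).
rewrite (integral12_prod_meas1 i2).
rewrite [LHS]integralE [RHS]integralE; congr (_ - _)%E.
  rewrite -(mix_integral_ge0 J (f := (EFin \o f)^\+%E)) //; first by apply: eq_integral => z _; rewrite unlock.
  by apply: measurable_funepos; exact: (measurable_int mu).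
rewrite -(mix_integral_ge0 J (f := (EFin \o f)^\-%E)) //; first by apply: eq_integral => z _; rewrite unlock.
by apply: measurable_funeneg; exact: (measurable_int mu).
Qed.

Lemma mix_mixI J K (x y z : S) :
  mix K (mix J x y) z = mix (predI J K) x (mix K y z).
Proof.
apply/funext => i; rewrite /mix /=.
by case: (J i); case: (K i).
Qed.

(** By [mix_mixI] two successive resamplings amount to one in which only the coordinates in both J
    and K are kept. Independence makes this valid for sets that are not nested, as needed for
    [after] against [other]. *)
Lemma condE_tower J K f : mu.-integrable setT (EFin \o f) ->
  {ae mu, forall x, condE J (condE K f) x = condE (predI J K) f x}.
Proof.
move=> /(ae_integrable_mix (predI J K)); apply: filterS => x hx.
rewrite {3}/condE -(integral_condE K hx) /condE; apply: eq_Rintegral => y _.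
by apply: eq_Rintegral => z _; rewrite mix_mixI.
Qed.

(** f minus its conditional expectation is the average over y of f x - f (mix J x y), so a bound for
    the coupling carries over. The coupling coefficients delta enter the argument here. *)
Lemma Lpbound_sub_condE p J f c k : 1 <= p -> Lpbound mu p f k ->
  Lpbound (mu \x mu)%E p (fun z => f z.1 - f (mixz J z)) c ->
  Lpbound mu p (fun x => f x - condE J f x) c.
Proof.
move=> p1 hf hz; have p0 : 0 < p by lra.
apply: (Lpbound_ae p0 (Lpbound_section p1 hz)).
  by apply: measurable_funB; [case: hf|case: (Lpbound_condE J p1 hf)].
apply: filterS (ae_integrable_mix J (Lpbound_integrable p1 hf)) => x hx.
rewrite /= RintegralB//; last first.
  by apply: finite_measure_integrable_cst.
by rewrite Rintegral_prob_cst.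
Qed.

(** This supplies the orthogonality required by [Lpbound_rio]. *)
Lemma integral_mul_condE0 J f g : depends_on J f ->
  mu.-integrable setT (EFin \o g) -> mu.-integrable setT (EFin \o (fun x => f x * g x)) ->
  {ae mu, forall x, condE J g x = 0} -> \int[mu]_x (f x * g x) = 0.
Proof.
move=> Jf ig ifg g0; rewrite -(integral_condE J ifg).
rewrite -(Rintegral_prob_cst mu 0) /Rintegral.
congr fine; apply: ae_eq_integral => //.
  exact: (measurable_int mu (integrable_condE J ifg)).
have := condE_pull Jf ig.
by move: g0; apply: filterS2 => x h -> _; rewrite h mulr0.
Qed.

End CondExp.

(** * Convergence in Lp of conditional expectations along exhausting sets of coordinates *)

Section MartingaleDensity.
Import HBSimple.
Context (R : realType) (Ix : eqType) (mu : probability (paths R Ix) R).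
Hypothesis mu_mix : mix_invariant mu.
Variable J : nat -> pred Ix.
Hypothesis J_exhausts : forall i, exists N, forall n, (N <= n)%N -> J n i.

Local Notation S := (paths R Ix).
Local Notation E n f := (condE mu (J n) f).
Implicit Types f g : S -> R.

Definition condE_cvg p f := forall e, 0 < e -> exists N, forall n, (N <= n)%N ->
  Lpbound mu p (fun x => f x - E n f x) e.

(** An e/3 argument: f - E f is (f - g) - E (f - g) + (g - E g), and E is a contraction. *)
Lemma condE_cvg_closure p f k : 1 <= p -> Lpbound mu p f k ->
  (forall e, 0 < e -> exists g c, [/\ Lpbound mu p g c, condE_cvg p g &
     Lpbound mu p (fun x => f x - g x) e]) -> condE_cvg p f.
Proof.
move=> p1 hf h e e0; have p0 : 0 < p by lra.
have [g [c [hg cg hfg]]] := h (e / 3) ltac:(by rewrite divr_gt0).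
have [N hN] := cg (e / 3) ltac:(by rewrite divr_gt0).
exists N => n /hN {}hN.
have h3 := LpboundD p1 (LpboundB p1 hfg (Lpbound_condE mu_mix (J n) p1 hfg)) hN.
have -> : e = e / 3 + e / 3 + e / 3 by lra.
apply: (Lpbound_ae p0 h3).
  by apply: measurable_funB; [case: hf|case: (Lpbound_condE mu_mix (J n) p1 hf)].
have := condEB mu_mix (J n) (Lpbound_integrable p1 hf) (Lpbound_integrable p1 hg).
by apply: filterS => x ->; lra.
Qed.

Lemma condE_cvgD p f g a b : 1 <= p -> Lpbound mu p f a -> Lpbound mu p g b ->
  condE_cvg p f -> condE_cvg p g -> condE_cvg p (fun x => f x + g x).
Proof.
move=> p1 hf hg cf cg e e0; have p0 : 0 < p by lra.
have [N1 h1] := cf (e / 2) ltac:(by rewrite divr_gt0).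
have [N2 h2] := cg (e / 2) ltac:(by rewrite divr_gt0).
exists (maxn N1 N2) => n; rewrite geq_max => /andP[/h1 {}h1 /h2 {}h2].
have -> : e = e / 2 + e / 2 by lra.
apply: (Lpbound_ae p0 (LpboundD p1 h1 h2)).
  have hfg := LpboundD p1 hf hg.
  by apply: measurable_funB; [case: hfg|case: (Lpbound_condE mu_mix (J n) p1 hfg)].
have := condED mu_mix (J n) (Lpbound_integrable p1 hf) (Lpbound_integrable p1 hg).
by apply: filterS => x ->; lra.
Qed.

Lemma condE_cvg_fixed p f c : 0 < p -> Lpbound mu p f c ->
  (exists N, forall n, (N <= n)%N -> depends_on (J n) f) -> condE_cvg p f.
Proof.
move=> p0 hf [N hN] e e0; exists N => n /hN {}hN; rewrite condE_id//.
apply: (eq_Lpbound (f := fun=> 0)) => [x|]; first by rewrite subrr.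
by apply: Lpbound_le (Lpbound0 mu p0); exact: ltW.
Qed.

Lemma condE_cvgZ p f a k : 1 <= p -> Lpbound mu p f a ->
  condE_cvg p f -> condE_cvg p (fun x => k * f x).
Proof.
move=> p1 hf cf e e0; have p0 : 0 < p by lra.
have k0 : 0 < `|k| + 1 by rewrite ltr_wpDl.
have [N h] := cf (e / (`|k| + 1)) ltac:(by rewrite divr_gt0).
exists N => n /h {}h.
have hk := LpboundZ k p0 h.
have le : `|k| * (e / (`|k| + 1)) <= e.
  rewrite mulrCA ler_piMr ?(ltW e0)// ler_pdivrMr// mul1r lerDl//.
apply: (Lpbound_ae p0 (Lpbound_le le hk)).
  have hkf := LpboundZ k p0 hf.
  by apply: measurable_funB; [case: hkf|case: (Lpbound_condE mu_mix (J n) p1 hkf)].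
have := condEZ mu_mix (J n) k (Lpbound_integrable p1 hf).
by apply: filterS => x ->; rewrite mulrBr.
Qed.

Lemma condE_cvg_sum p (n : nat) (F : nat -> S -> R) (a : nat -> R) : 1 <= p ->
  (forall i, (i < n)%N -> Lpbound mu p (F i) (a i)) ->
  (forall i, (i < n)%N -> condE_cvg p (F i)) ->
  condE_cvg p (fun x => \sum_(i < n) F i x).
Proof.
move=> p1; have p0 : 0 < p by lra.
elim: n => [|n IH] hF cF.
  have -> : (fun x => \sum_(i < 0) F i x) = (fun=> 0).
    by apply/funext => x; rewrite big_ord0.
  by apply: (condE_cvg_fixed p0 (Lpbound0 mu p0)); exists 0%N.
have -> : (fun x => \sum_(i < n.+1) F i x) = (fun x => \sum_(i < n) F i x + F n x).
  by apply/funext => x; rewrite big_ord_recr.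
have hS : Lpbound mu p (fun x => \sum_(i < n) F i x) (\sum_(i < n) a i).
  apply: (@Lpbound_sum _ _ _ mu p _ (index_enum 'I_n) xpredT (fun i => F i) (fun i => a i) p1).
  by move=> i _; apply: hF; rewrite ltnS ltnW.
apply: condE_cvgD p1 hS (hF _ (ltnSn n)) _ _; last exact: cF.
by apply: IH => i h; [apply: hF|apply: cF]; rewrite ltnS ltnW.
Qed.

Lemma Lpbound_indic p (A : set S) : 0 < p -> measurable A ->
  Lpbound mu p (\1_A) 1.
Proof.
move=> p0 mA; have := Lpbound_cst mu 1 p0; rewrite normr1 => h1.
apply: (Lpbound_ae_le p0 h1) => //.
by apply: aeW => x; rewrite /= indicE; case: (_ \in _); rewrite ?normr1 ?normr0.
Qed.

Lemma Lpbound1_indic (A : set S) : measurable A ->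
  Lpbound mu 1 (\1_A) (fine (mu A)).
Proof.
move=> mA; split => //.
rewrite Lnorm1 fineK ?fin_num_measure//.
under eq_integral do rewrite /= ger0_norm//.
by rewrite integral_indic// setIT.
Qed.

(* The sets with this property form a Dynkin system containing the cylinders. *)
Lemma condE_cvg_indic (A : set S) : measurable A -> condE_cvg 1 (\1_A).
Proof.
move=> mA; pose D : set (set S) := [set A | measurable A /\ condE_cvg 1 (\1_A)].
suff : D A by case.
have : <<d @boxes R Ix >> A.
  rewrite setI_closed_g_dynkin_g_sigma_algebra; last exact: boxes_setI.
  exact: measurable_boxes.
apply: smallest_sub => [|_ [s [B [fB ->]]]]; last first.
  split; first exact: measurable_box fB.
  apply: (condE_cvg_fixed ltr01 (Lpbound_indic ltr01 (measurable_box fB))).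
  (* Once J n contains the finitely many constrained indices, the indicator of the box is left fixed
     by conditioning. *)
  have [N hN] : exists N, forall n, (N <= n)%N -> forall i, i \in s -> J n i.
    elim: (s) => [|i s' [N hN]]; first by exists 0%N.
    have [N' hN'] := J_exhausts i; exists (maxn N N') => n.
    rewrite geq_max => /andP[/hN {}hN /hN' {}hN'] j.
    by rewrite inE => /predU1P[->//|/hN].
  exists N => n /hN {}hN x y xy; rewrite !indicE; congr (_%:R).
  have [_ _ sB] := fB.
  have iff : box B x <-> box B y.
    split=> h i; have := h i; have [/hN/xy ->//|/sB ->//] := boolP (i \in s).
  by congr nat_of_bool; apply/idP/idP; rewrite !inE iff.
split.
- split => //; apply: (condE_cvg_fixed ltr01 (Lpbound_indic ltr01 measurableT)).
  by exists 0%N => n _ x y _; rewrite !indicE !in_setT.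
- move=> B [mB cB]; split; first exact: measurableC.
  have -> : \1_(~` B) = (fun x : S => 1 + (-1) * \1_B x) :> (S -> R).
    apply/funext => x; rewrite !indicE in_setC.
    by case: (_ \in _); rewrite /= ?mulr1 ?subrr ?mulr0 ?addr0.
  have hB := Lpbound_indic ltr01 mB.
  apply: (condE_cvgD (lexx 1) (Lpbound_cst mu 1 ltr01) (LpboundZ (-1) ltr01 hB)).
    by apply: (condE_cvg_fixed ltr01 (Lpbound_cst mu 1 ltr01)); exists 0%N.
  exact: condE_cvgZ hB cB.
move=> F tF DF; have mF n : measurable (F n) by case: (DF n).
have mU : measurable (\bigcup_n F n) by exact: bigcupT_measurable.
split => //; apply: (condE_cvg_closure (lexx 1) (Lpbound_indic ltr01 mU)) => e e0.
(* The part of the disjoint union missed by its first k members: these sets decrease to the empty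
   set, so their mass, which is the L1 distance to the partial sum of indicators, tends to 0. *)
pose V k := \bigcup_n F n `\` \big[setU/set0]_(i < k) F i.
have mW k : measurable (\big[setU/set0]_(i < k) F i) by exact: bigsetU_measurable.
have mV k : measurable (V k) by exact: measurableD.
have Vcap : \bigcap_k V k = set0.
  apply/seteqP; split => // x h; have [[n _ Fnx] _] := h 0%N Logic.I.
  have [_] := h n.+1 Logic.I; apply.
  by rewrite big_ord_recr; right.
have Vcvg : mu (V k) @[k --> \oo] --> 0%E.
  rewrite -(measure0 mu) -Vcap; apply: nonincreasing_cvg_mu => //.
  - by rewrite ltey_eq fin_num_measure.
  - by rewrite Vcap.
  move=> a b ab; apply/subsetPset; apply: setDS.
  exact: subset_bigsetU.
have [k hk] : exists k, fine (mu (V k)) < e.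
  move/fine_cvgP : Vcvg => [_ /cvgrPdist_lt/(_ e e0)[k _ /(_ k (leqnn k))]].
  rewrite /= sub0r normrN => h; exists k.
  by rewrite (le_lt_trans _ h)// ler_norm.
exists (fun x => \sum_(i < k) \1_(F i) x), (\sum_(i < k) 1); split.
- by apply: Lpbound_sum => // i _; exact: Lpbound_indic.
- apply: (condE_cvg_sum (F := fun i => \1_(F i)) (a := fun=> 1) (lexx 1)) => i _.
    exact: Lpbound_indic.
  by case: (DF i).
have -> : (fun x => \1_(\bigcup_n F n) x - \sum_(i < k) \1_(F i) x) = \1_(V k) :> (S -> R).
  have sumE n x : \sum_(i < n) \1_(F i) x = \1_(\big[setU/set0]_(i < n) F i) x :> R.
    elim: n => [|n IHn]; first by rewrite !big_ord0 indic0.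
    rewrite !big_ord_recr/= IHn !indicE in_setU.
    have [xn|] := boolP (x \in F n); last by rewrite orbF addr0.
    suff /negbTE -> : x \notin \big[setU/set0]_(i < n) F i by rewrite add0r.
    apply/negP; rewrite inE -bigcup_mkord => -[i /= ilt Fi].
    move: tF => /(_ i n Logic.I Logic.I) ein.
    have : i = n by apply: ein; exists x; split => //; exact/set_mem.
    by move=> ein'; rewrite ein' ltnn in ilt.
  apply/funext => x; rewrite sumE !indicE /V in_setD.
  have [|xN] := boolP (x \in \big[setU/set0]_(i < k) F i); last by rewrite subr0 /= andbT.
  rewrite inE => /(@bigsetU_bigcup _ F k) [i _ Fi].
  by rewrite mem_set ?subrr//; exists i.
exact: Lpbound_le (ltW hk) (Lpbound1_indic (mV k)).
Qed.

Lemma condE_cvg1 f : mu.-integrable setT (EFin \o f) -> condE_cvg 1 f.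
Proof.
move=> intf; have [c hf] := integrable_Lpbound1 intf.
apply: (condE_cvg_closure (lexx 1) hf) => e e0.
have [g [ig _ gf]] := approximation_sfun_integrable measurableT intf.
have [n hn] : exists n, (\int[mu]_z `|(f z)%:E - (g n z)%:E| <= e%:E)%E.
  move/fine_cvgP : gf => [[a _ fin] /cvgrPdist_lt/(_ e e0)[k _ h]].
  exists (maxn a k); rewrite -[leLHS]fineK; last exact: (fin _ (leq_maxl _ _)).
  have := h _ (leq_maxr a k); rewrite /= sub0r normrN => {}h.
  by rewrite lee_fin (le_trans (ler_norm _))// ltW.
have [k hk] := integrable_Lpbound1 (ig n).
exists (g n), k; split => //; last first.
  split; last by rewrite Lnorm1.
  by apply: measurable_funB; [case: hf|case: hk].
have mA r : measurable (g n @^-1` [set r]).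
  by rewrite -[X in measurable X]setTI; apply: measurable_funP.
have -> : g n = (fun x => \sum_(i < size (finmap.enum_fset (fset_set (range (g n)))))
     (finmap.enum_fset (fset_set (range (g n))))`_i *
      \1_(g n @^-1` [set (finmap.enum_fset (fset_set (range (g n))))`_i]) x) :> (S -> R).
  by apply/funext => x; exact: fimfunEord.
set s := finmap.enum_fset _.
apply: (condE_cvg_sum (F := fun i x => s`_i * \1_(g n @^-1` [set s`_i]) x)
  (a := fun i => `|s`_i| * 1) (lexx 1)) => i _.
  exact: LpboundZ (Lpbound_indic ltr01 (mA _)).
exact: condE_cvgZ (Lpbound_indic ltr01 (mA _)) (condE_cvg_indic (mA _)).
Qed.

Lemma condE_bounded K f k : measurable_fun setT f -> (forall x, `|f x| <= k) ->
  forall x, `|condE mu K f x| <= k.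
Proof.
move=> mf fk x.
have k0 : 0 <= k := le_trans (normr_ge0 _) (fk x).
have h : Lpbound mu 1 (fun y => f (mix K x y)) k.
  have := Lpbound_cst mu k ltr01; rewrite ger0_norm// => h.
  apply: (Lpbound_ae_le ltr01 h).
    apply: (measurableT_comp mf).
    exact: (measurableT_comp (measurable_mixz K) (pair1_measurable x)).
  by apply: aeW => y /=; rewrite (ger0_norm k0).
by have [] := Lpbound1_integral h.
Qed.

Lemma condE_cvg_bounded p f k : 1 <= p -> measurable_fun setT f ->
  (forall x, `|f x| <= k) -> condE_cvg p f.
Proof.
move=> p1 mf fk e e0; have p0 : 0 < p by lra.
have k0 : 0 <= k := le_trans (normr_ge0 _) (fk point).
have hf : Lpbound mu p f k.
  have := Lpbound_cst mu k p0; rewrite ger0_norm// => h.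
  by apply: (Lpbound_ae_le p0 h) => //; apply: aeW => y /=; rewrite (ger0_norm k0).
(* For h = f - E f, bounded by 2 k + 1, |h|^p <= K |h| turns L1 convergence into Lp convergence; the
   added 1 keeps K positive when k = 0. *)
pose K := (2 * k + 1) `^ (p - 1).
have K0 : 0 < K by rewrite powR_gt0//; lra.
have ep0 : 0 < e `^ p / K by rewrite divr_gt0// powR_gt0.
have [N hN] := condE_cvg1 (Lpbound_integrable p1 hf) ep0.
exists N => n /hN {}hN.
have mh : measurable_fun setT (fun x => f x - E n f x) by case: hN.
apply/LpboundP => //; first exact: ltW.
have hz := LpboundZ K ltr01 hN.
have mKh := Lpbound_meas hz.
have := (LpboundP mu ltr01 (Lpbound_ge0 hz) mKh).1 hz.
rewrite powRr1; last exact: Lpbound_ge0 hz.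
rewrite (gtr0_norm K0) mulrCA mulfV ?gt_eqF// mulr1; apply: le_trans.
apply: ge0_le_integral => //.
- exact/measurable_EFinP/measurable_powR_norm.
- exact/measurable_EFinP/measurable_powR_norm.
move=> x _; rewrite lee_fin powRr1//.
rewrite -mulr_powRB1// normrM (gtr0_norm K0) mulrC ler_wpM2r//.
have hb : `|f x - E n f x| <= 2 * k + 1.
  rewrite (le_trans (ler_normB _ _))//.
  have := fk x; have := condE_bounded (J n) mf fk x; lra.
apply: ge0_ler_powR => //; first lra.
by rewrite nnegrE; lra.
Qed.

(** Truncation at height k reduces to bounded functions; the truncation error tends to 0 in Lp by
    dominated convergence. *)
Lemma condE_cvg_Lp p f c : 1 <= p -> Lpbound mu p f c -> condE_cvg p f.
Proof.
move=> p1 hf; have p0 : 0 < p by lra.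
have mf := Lpbound_meas hf.
apply: (condE_cvg_closure p1 hf) => e e0.
pose fk k x := if `|f x| <= k%:R then f x else 0.
have mfk k : measurable_fun setT (fk k).
  apply: measurable_fun_ifT => //.
  by apply: measurable_fun_ler => //; exact: measurableT_comp.
pose h k x := (`|f x - fk k x| `^ p)%:E.
have hE k x : f x - fk k x = if `|f x| <= k%:R then 0 else f x.
  by rewrite /fk; case: ifP; rewrite ?subrr ?subr0.
have ifp : mu.-integrable setT (EFin \o (fun x => `|f x| `^ p)).
  have : Lpbound mu 1 (fun x => `|f x| `^ p) (c `^ p).
    by apply/Lpbound_pow; rewrite ?mulr1//; exact: Lpbound_ge0 hf.
  by move=> /Lpbound1_integral[].
have mh k : measurable_fun setT (h k).
  by apply/measurable_EFinP/measurable_powR_norm/measurable_funB.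
have [] := @dominated_convergence _ _ _ mu _ measurableT h (cst 0%E) _ mh _ _ ifp _ => //.
- apply: aeW => x _; apply: cvg_near_cst.
  exists (Num.bound `|f x|) => // k /= hk; rewrite /h hE ifT ?normr0 ?powR0 ?gt_eqF//.
  rewrite (le_trans (ltW (archi_boundP _)))// ler_nat//.
- apply: aeW => x k _; rewrite /h hE /=.
  rewrite lee_fin ger0_norm ?powR_ge0//; case: ifP => //.
  by rewrite normr0 powR0 ?gt_eqF// powR_ge0.
move=> _ _; rewrite integral0 => cv.
have ep0 : 0 < e `^ p by rewrite powR_gt0.
have [k hk] : exists k, (\int[mu]_x h k x <= (e `^ p)%:E)%E.
  move/fine_cvgP : cv => [[a _ fin] /cvgrPdist_lt/(_ _ ep0)[k _ hh]].
  exists (maxn a k); rewrite -[leLHS]fineK; last exact: (fin _ (leq_maxl _ _)).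
  have := hh _ (leq_maxr a k); rewrite /= sub0r normrN => {}hh.
  by rewrite lee_fin (le_trans (ler_norm _))// ltW.
have fkk x : `|fk k x| <= k%:R.
  by rewrite /fk; case: ifP => //; rewrite normr0 ler0n.
exists (fk k), k%:R; split.
- have := Lpbound_cst mu k%:R p0; rewrite ger0_norm// => hh.
  by apply: (Lpbound_ae_le p0 hh) => //; apply: aeW => y /=; rewrite normr_nat.
- exact: condE_cvg_bounded p1 (mfk k) fkk.
- by apply/LpboundP => //; [exact: ltW|exact: measurable_funB].
Qed.

End MartingaleDensity.

(** * Limits in Lp of sequences of functions *)

Section LpConvergence.
Context (R : realType) (d : measure_display) (T : measurableType d) (m : probability T R).
Implicit Types (F : T -> R) (G : nat -> T -> R).

Definition Lpcvg p F G := forall e, 0 < e -> exists N, forall n, (N <= n)%N ->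
  Lpbound m p (fun x => F x - G n x) e.

Lemma Lpcvg_bound p F G c : 1 <= p -> Lpcvg p F G ->
  (forall n, Lpbound m p (G n) c) -> Lpbound m p F c.
Proof.
move=> p1 FG Gc; apply: Lpbound_closure => // e e0.
by have [N h] := FG e e0; exists (G N) => //; exact: h.
Qed.

Lemma Lpcvg0 p : 0 < p -> Lpcvg p (fun=> 0) (fun _ _ => 0).
Proof.
move=> p0 e e0; exists 0%N => n _; apply: (eq_Lpbound (f := fun=> 0)).
  by move=> x; rewrite subr0.
by apply: Lpbound_le (Lpbound0 m p0); exact: ltW.
Qed.

Lemma LpcvgD p F F' G G' : 1 <= p -> Lpcvg p F G -> Lpcvg p F' G' ->
  Lpcvg p (fun x => F x + F' x) (fun n x => G n x + G' n x).
Proof.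
move=> p1 h h' e e0.
have [N1 h1] := h (e / 2) ltac:(by rewrite divr_gt0).
have [N2 h2] := h' (e / 2) ltac:(by rewrite divr_gt0).
exists (maxn N1 N2) => n; rewrite geq_max => /andP[/h1 {}h1 /h2 {}h2].
have -> : e = e / 2 + e / 2 by lra.
by apply: eq_Lpbound (LpboundD p1 h1 h2) => x /=; lra.
Qed.

Lemma LpcvgZ p F G k : 0 < p -> Lpcvg p F G ->
  Lpcvg p (fun x => k * F x) (fun n x => k * G n x).
Proof.
move=> p0 h e e0.
have k0 : 0 < `|k| + 1 by rewrite ltr_wpDl.
have [N hN] := h (e / (`|k| + 1)) ltac:(by rewrite divr_gt0).
exists N => n /hN {}hN.
have le : `|k| * (e / (`|k| + 1)) <= e.
  by rewrite mulrCA ler_piMr ?(ltW e0)// ler_pdivrMr// mul1r lerDl.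
apply: eq_Lpbound (Lpbound_le le (LpboundZ k p0 hN)) => x /=.
by rewrite mulrBr.
Qed.

Lemma Lpcvg_sum p (I : Type) (r : seq I) (P : pred I) (F : I -> T -> R)
    (G : I -> nat -> T -> R) : 1 <= p -> (forall i, P i -> Lpcvg p (F i) (G i)) ->
  Lpcvg p (fun x => \sum_(i <- r | P i) F i x) (fun n x => \sum_(i <- r | P i) G i n x).
Proof.
move=> p1 h; have p0 : 0 < p by lra.
elim: r => [|i r IH] e e0.
  have [N hN] := Lpcvg0 p0 e0; exists N => n /hN.
  by apply: eq_Lpbound => x; rewrite !big_nil.
have [Pi|Pi] := boolP (P i).
  have [N hN] := LpcvgD p1 (h i Pi) IH e0; exists N => n /hN.
  by apply: eq_Lpbound => x; rewrite !big_cons Pi.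
have [N hN] := IH e e0; exists N => n /hN.
by apply: eq_Lpbound => x; rewrite !big_cons (negbTE Pi).
Qed.

Lemma ae_eq_sum (I : Type) (r : seq I) (P : pred I) (F G : I -> T -> R) :
  (forall i, P i -> {ae m, forall x, F i x = G i x}) ->
  {ae m, forall x, \sum_(i <- r | P i) F i x = \sum_(i <- r | P i) G i x}.
Proof.
move=> h; elim: r => [|i r IH].
  by apply: aeW => x; rewrite !big_nil.
have [Pi|Pi] := boolP (P i).
  have := h i Pi; move: IH; apply: filterS2 => x e1 e2.
  by rewrite !big_cons Pi e1 e2.
by move: IH; apply: filterS => x e1; rewrite !big_cons (negbTE Pi) e1.
Qed.

Lemma Lpbound_pow2_mul p F F' a b : 2 < p -> Lpbound m p F a -> Lpbound m p F' b ->
  Lpbound m 1 (fun x => `|F x| `^ (p - 2) * (F x * F' x)) (a `^ (p - 2) * (a * b)).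
Proof.
move=> p2 hF hF'; have p0 : 0 < p by lra.
have q0 : 0 < p / (p - 2) by rewrite divr_gt0//; lra.
have pq : (p / (p - 2))^-1 + (p / 2)^-1 = 1.
  by rewrite !invf_div -mulrDl subrK mulfV// gt_eqF.
apply: (Lpbound_hoelder q0 _ pq _ (LpboundM p0 hF hF')); first lra.
apply/Lpbound_pow => //; [lra|exact: Lpbound_ge0 hF|by case: hF|].
by rewrite mulrCA mulfV ?mulr1//; lra.
Qed.

End LpConvergence.

Section CondExpSums.
Context (R : realType) (Ix : Type) (mu : probability (paths R Ix) R).
Hypothesis mu_mix : mix_invariant mu.
Local Notation S := (paths R Ix).

Lemma condE_sum p (J : pred Ix) (I : Type) (r : seq I) (P : pred I)
    (F : I -> S -> R) (c a : I -> R) : 1 <= p ->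
  (forall i, P i -> Lpbound mu p (F i) (a i)) ->
  {ae mu, forall x, condE mu J (fun x => \sum_(i <- r | P i) c i * F i x) x =
     \sum_(i <- r | P i) c i * condE mu J (F i) x}.
Proof.
move=> p1 h; have p0 : 0 < p by lra.
elim: r => [|i r IH].
  apply: aeW => x; rewrite big_nil.
  have -> : (fun x : S => \sum_(i <- [::] | P i) c i * F i x) = fun=> 0.
    by apply/funext => y; rewrite big_nil.
  by rewrite /condE Rintegral_prob_cst.
have [Pi|Pi] := boolP (P i); last first.
  have -> : (fun x : S => \sum_(i <- i :: r | P i) c i * F i x) =
      fun x => \sum_(i <- r | P i) c i * F i x.
    by apply/funext => y; rewrite big_cons (negbTE Pi).
  by move: IH; apply: filterS => x; rewrite big_cons (negbTE Pi).
have -> : (fun x : S => \sum_(i <- i :: r | P i) c i * F i x) =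
    fun x => c i * F i x + \sum_(i <- r | P i) c i * F i x.
  by apply/funext => y; rewrite big_cons Pi.
have hc := LpboundZ (c i) p0 (h i Pi).
have hs := @Lpbound_sum _ _ _ mu p _ r P (fun i x => c i * F i x) _ p1
  (fun j Pj => LpboundZ (c j) p0 (h j Pj)).
have e1 := condED mu_mix J (Lpbound_integrable p1 hc) (Lpbound_integrable p1 hs).
have e2 := condEZ mu_mix J (c i) (Lpbound_integrable p1 (h i Pi)).
by apply: filterS3 e1 e2 IH => x -> -> ->; rewrite big_cons Pi.
Qed.

(* [fg - E(fg) = f(g - Eg) + (f - Ef) Eg - E((f - Ef) g)] *)
Lemma Lpbound_mul_sub_condE p (J : pred Ix) (f g : S -> R) a b a' b' : 2 <= p ->
  Lpbound mu p f a -> Lpbound mu p g b ->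
  Lpbound mu p (fun x => f x - condE mu J f x) a' ->
  Lpbound mu p (fun x => g x - condE mu J g x) b' ->
  Lpbound mu (p / 2) (fun x => f x * g x - condE mu J (fun x => f x * g x) x)
    (a * b' + 2 * (a' * b)).
Proof.
move=> p2 hf hg hf' hg'.
have p0 : 0 < p by lra. have p1 : 1 <= p by lra. have h1 : 1 <= p / 2 by lra.
have h0 : 0 < p / 2 by lra.
have hEf := Lpbound_condE mu_mix J p1 hf.
have hEg := Lpbound_condE mu_mix J p1 hg.
have k1 := LpboundM p0 hf hg'.
have k2 := LpboundM p0 hf' hEg.
have k3 := LpboundM p0 hf' hg.
have k4 := LpboundM p0 hEf hg.
have k5 := LpboundM p0 hf hg.
have Ek3 := Lpbound_condE mu_mix J h1 k3.
have -> : a * b' + 2 * (a' * b) = a * b' + a' * b + a' * b by lra.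
apply: (Lpbound_ae h0 (LpboundB h1 (LpboundD h1 k1 k2) Ek3)).
  by apply: measurable_funB; [case: k5|case: (Lpbound_condE mu_mix J h1 k5)].
have e1 := condED mu_mix J (Lpbound_integrable h1 k3) (Lpbound_integrable h1 k4).
have e2 := condE_pull mu_mix (@condE_dep _ _ mu J f) (Lpbound_integrable p1 hg).
apply: filterS2 e1 e2 => x.
under [X in condE mu J X]eq_fun do rewrite -mulrDl subrK.
by move=> -> ->; lra.
Qed.

(* Conditionally on the coordinates in J, the A i are constants, and the bound on
   linear forms of B applies with v = A x; this is where sqrt n replaces n. *)
Lemma Lpbound_dot_indep (p : R) n (J : pred Ix) (A B : 'I_n -> S -> R) (a b : R) : 2 <= p -> 0 <= a -> 0 <= b ->
  (forall i, depends_on J (A i)) -> (forall i, depends_on (predC J) (B i)) ->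
  (forall i, Lpbound mu p (A i) a) ->
  (forall v : 'I_n -> R, Lpbound mu p (fun x => \sum_i v i * B i x)
     (b * Num.sqrt (\sum_i v i ^+ 2))) ->
  Lpbound mu p (fun x => \sum_i A i x * B i x) (Num.sqrt n%:R * a * b).
Proof.
move=> p2 a0 b0 depA depB hA hB.
have p0 : 0 < p by lra. have p1 : 1 <= p by lra.
have h20 : 0 < p / 2 by lra.
have hAA : Lpbound mu (p / 2) (fun x => \sum_i A i x * A i x) (\sum_(i < n) a * a).
  apply: (@Lpbound_sum _ _ _ mu (p / 2) _ (index_enum 'I_n) xpredT (fun i x => A i x * A i x)).
    lra.
  by move=> i _; exact: LpboundM.
have Bi i : measurable_fun setT (B i).
  have := hB (fun k => (k == i)%:R); case=> + _.
  have -> // : (fun x => \sum_k (k == i)%:R * B k x) = B i.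
  apply/funext => x; rewrite (bigD1 i)//= eqxx mul1r big1 ?addr0// => k /negbTE ->.
  by rewrite mul0r.
have mAB : measurable_fun setT (fun x => \sum_i A i x * B i x).
  by apply: measurable_sum => i; apply: measurable_funM => //; case: (hA i).
have nA0 x : 0 <= \sum_i A i x * A i x.
  by apply: sumr_ge0 => i _; rewrite -expr2 sqr_ge0.
have na : \sum_(i < n) a * a = n%:R * a ^+ 2.
  by rewrite sumr_const card_ord expr2 mulr_natl.
have hN : Lpbound mu p (fun x => b * Num.sqrt (\sum_i A i x * A i x)) (Num.sqrt n%:R * a * b).
  have hN' : Lpbound mu p (fun x => `|\sum_i A i x * A i x| `^ (2^-1)) ((\sum_(i < n) a * a) `^ 2^-1).
    apply/Lpbound_pow => //; last by rewrite mulrC.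
    - by rewrite na mulr_ge0 ?sqr_ge0.
    - by case: hAA.
  have := LpboundZ b p0 hN'; rewrite (ger0_norm b0) na powR12_sqrt ?mulr_ge0 ?sqr_ge0//.
  rewrite sqrtrM// sqrtr_sqr (ger0_norm a0) mulrC.
  by apply: eq_Lpbound => x; rewrite powR12_sqrt// ger0_norm.
apply/LpboundP => //; first by rewrite !mulr_ge0// sqrtr_ge0.
have mN := Lpbound_meas hN.
apply: le_trans ((LpboundP mu p0 (Lpbound_ge0 hN) mN).1 hN).
have mp := (measurable_EFinP _ _).2 (measurable_powR_norm p mAB).
rewrite -(mix_integral_ge0 mu_mix J (f := fun x => (`|\sum_i A i x * B i x| `^ p)%:E))//.
have mz := measurableT_comp mp (measurable_mixz J).
rewrite fubini_tonelli1//.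
apply: ge0_le_integral => //.
- by move=> x _; apply: integral_ge0 => y _; rewrite lee_fin powR_ge0.
- by apply: measurable_fun_fubini_tonelli_F.
- exact/measurable_EFinP/measurable_powR_norm.
move=> x _; rewrite /fubini_F /mixz /=.
under eq_integral => y _.
  have -> : \sum_i A i (mix J x y) * B i (mix J x y) = \sum_i A i x * B i y.
    apply: eq_bigr => i _; rewrite (depends_on_mix _ _ (depA i)); congr (_ * _).
    by apply: depB => j /negbTE /= Jj; rewrite /mix Jj.
  over.
have hx := hB (fun i => A i x); have mx := Lpbound_meas hx.
rewrite ger0_norm; last by rewrite mulr_ge0// sqrtr_ge0.
exact: ((LpboundP mu p0 (Lpbound_ge0 hx) mx).1 hx).
Qed.

End CondExpSums.

(** The conditioning sets [after u] grow as u decreases, so a martingale sum over time has to be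
    built from the last index downwards. *)
Lemma big_nat_desc (V : nmodType) (F : nat -> V) n :
  \sum_(1 <= t < n.+1) F t = \sum_(j < n) F (n - j)%N.
Proof.
rewrite big_nat_rev big_add1 /= big_mkord; apply: eq_bigr => j _.
by congr F; lia.
Qed.

(** * Martingale differences along the past *)

Section Projections.
Context (R : realType) (mu : probability (paths R int) R).
Hypothesis mu_mix : mix_invariant mu.
Local Notation S := (paths R int).
Implicit Types (f : S -> R) (s t u v : int).

Definition after u : pred int := fun i => u < i.
Definition other s : pred int := fun i => i != s.

Definition proj s f (x : S) : R := condE mu (after (s - 1)) f x - condE mu (after s) f x.

Lemma after_other s : predI (after (s - 1)) (other s) =1 after s.
Proof. by move=> i; rewrite /after /other /=; lia. Qed.

Lemma depends_on_sub (J K : pred int) f : depends_on J f -> (forall i, J i -> K i) ->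
  depends_on K f.
Proof. by move=> h JK x y xy; apply: h => i /JK; exact: xy. Qed.

Lemma condE_eq (J K : pred int) f : J =1 K -> condE mu J f = condE mu K f.
Proof. by move=> /funext ->. Qed.

Lemma condE_after_tower u v f : u <= v -> mu.-integrable setT (EFin \o f) ->
  {ae mu, forall x, condE mu (after v) (condE mu (after u) f) x = condE mu (after v) f x}.
Proof.
move=> uv fi; have := condE_tower mu_mix (after v) (after u) fi.
have E : predI (after v) (after u) =1 after v by move=> i; rewrite /after /=; lia.
by rewrite (condE_eq f E).
Qed.

Lemma Lpbound_projB p s f k : 1 <= p -> Lpbound mu p f k -> Lpbound mu p (proj s f) (k + k).
Proof. by move=> p1 hf; apply: LpboundB => //; exact: Lpbound_condE. Qed.

(** [proj s f] is the conditional expectation, given [after (s - 1)], of f minus its mean over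
    coordinate s, because [after (s - 1)] without s is [after s]. Contraction then gives the
    bound. *)
Lemma Lpbound_proj p s f k c : 1 <= p -> Lpbound mu p f k ->
  Lpbound mu p (fun x => f x - condE mu (other s) f x) c ->
  Lpbound mu p (proj s f) c.
Proof.
move=> p1 hf hc; have p0 : 0 < p by lra.
apply: (Lpbound_ae p0 (Lpbound_condE mu_mix (after (s - 1)) p1 hc)).
  by case: (Lpbound_projB s p1 hf).
have fi := Lpbound_integrable p1 hf.
have ei := Lpbound_integrable p1 (Lpbound_condE mu_mix (other s) p1 hf).
have := condE_tower mu_mix (after (s - 1)) (other s) fi.
rewrite (condE_eq f (@after_other s)).
have := condEB mu_mix (after (s - 1)) fi ei.
by apply: filterS2 => x -> ->.
Qed.

Lemma proj_dep s f : depends_on (after (s - 1)) (proj s f).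
Proof.
move=> x y xy; rewrite /proj; congr (_ - _); first exact: condE_dep.
by apply: condE_dep => i si; apply: xy; move: si; rewrite /after; lia.
Qed.

Lemma condE_proj p s f k : 1 <= p -> Lpbound mu p f k ->
  {ae mu, forall x, condE mu (after s) (proj s f) x = 0}.
Proof.
move=> p1 hf; have fi := Lpbound_integrable p1 hf.
have e1 := Lpbound_integrable p1 (Lpbound_condE mu_mix (after (s - 1)) p1 hf).
have e2 := Lpbound_integrable p1 (Lpbound_condE mu_mix (after s) p1 hf).
have := condEB mu_mix (after s) e1 e2.
have := @condE_after_tower (s - 1) s f ltac:(lia) fi.
apply: filterS2 => x h1 h2; rewrite /proj h2 h1.
by rewrite (condE_id mu (@condE_dep _ _ mu (after s) f)) subrr.
Qed.

Lemma sum_proj t n f x : \sum_(j < n) proj (t - j%:Z) f x =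
  condE mu (after (t - n%:Z)) f x - condE mu (after t) f x.
Proof.
elim: n => [|n IH]; first by rewrite big_ord0 subr0 subrr.
rewrite big_ord_recr /= IH /proj.
have -> : t - n%:Z - 1 = t - n.+1%:Z by lia.
lra.
Qed.

Lemma condE_after_cvg p t f c : 1 <= p -> Lpbound mu p f c ->
  Lpcvg mu p f (fun n => condE mu (after (t - n%:Z)) f).
Proof.
move=> p1 hf; apply: (condE_cvg_Lp mu_mix _ p1 hf) => i.
by exists `|t - i|.+1%N => n; rewrite /after; lia.
Qed.

(** The terms with index larger than t depend on innovations after t - a only, and given those [H t]
    has mean zero; hence the partial sums taken from n downwards satisfy the orthogonality of Rio's
    inequality. The shift a is the lag of the projection. *)
Lemma Lpbound_rio_desc p (a : int) (H : nat -> S -> R) (c : nat -> R) n : 2 < p ->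
  (forall t : nat, (0 < t <= n)%N -> Lpbound mu p (H t) (c t)) ->
  (forall t : nat, (0 < t <= n)%N -> depends_on (after (t%:Z - a - 1)) (H t)) ->
  (forall t : nat, (0 < t <= n)%N ->
     {ae mu, forall x, condE mu (after (t%:Z - a)) (H t) x = 0}) ->
  Lpbound mu p (fun x => \sum_(1 <= t < n.+1) H t x)
    (Num.sqrt (rio_const p * \sum_(1 <= t < n.+1) c t ^+ 2)).
Proof.
move=> p2 hH dH eH; have p1 : 1 <= p by lra.
rewrite big_nat_desc.
apply: (eq_Lpbound (f := fun x => \sum_(j < n) H (n - j)%N x)).
  by move=> x; rewrite big_nat_desc.
have rng i : (i < n)%N -> (0 < n - i <= n)%N by lia.
apply: (Lpbound_rio (D := fun j => H (n - j)%N) (c := fun j => c (n - j)%N) p2).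
  by move=> i /rng; exact: hH.
move=> i ilt; have hi := hH _ (rng i ilt).
have hS : Lpbound mu p (fun x => \sum_(j < i) H (n - j)%N x) (\sum_(j < i) c (n - j)%N).
  apply: (@Lpbound_sum _ _ _ mu p _ (index_enum 'I_i) xpredT (fun j => H (n - j)%N)) => // j _.
  by apply: hH; have := ltn_ord j; lia.
have hint := Lpbound_pow2_mul p2 hS hi.
apply: (integral_mul_condE0 mu_mix (J := after ((n - i)%N%:Z - a))
  (f := fun x => `|\sum_(j < i) H (n - j)%N x| `^ (p - 2) * (\sum_(j < i) H (n - j)%N x))).
- move=> x y xy.
  have -> : \sum_(j < i) H (n - j)%N x = \sum_(j < i) H (n - j)%N y; last by [].
  apply: eq_bigr => j _; apply: dH; first by have := ltn_ord j; lia.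
  by move=> k; rewrite /after => hk; apply: xy; rewrite /after; have := ltn_ord j; lia.
- exact: Lpbound_integrable p1 hi.
- by apply: (Lpbound_integrable (lexx 1)); apply: eq_Lpbound hint => x /=; rewrite mulrA.
- exact: eH (rng i ilt).
Qed.

End Projections.

(** * Arithmetic of indices, square roots and power sums *)

Lemma sqrt_sum_scale (R : realType) (I : Type) (r : seq I) (P : pred I)
    (c : I -> R) (K k : R) : 0 <= K -> 0 <= k ->
  Num.sqrt (K * \sum_(i <- r | P i) (`|c i| * k) ^+ 2) =
  k * (Num.sqrt K * Num.sqrt (\sum_(i <- r | P i) c i ^+ 2)).
Proof.
move=> K0 k0.
have -> : \sum_(i <- r | P i) (`|c i| * k) ^+ 2 = k ^+ 2 * \sum_(i <- r | P i) c i ^+ 2.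
  rewrite mulr_sumr; apply: eq_bigr => i _.
  by rewrite exprMn real_normK ?num_real// mulrC.
by rewrite mulrCA sqrtrM ?sqr_ge0// sqrtr_sqr (ger0_norm k0) sqrtrM.
Qed.

Definition upto (t : int) : pred int := fun i => i <= t.

Lemma upto_predC_after t k : upto t k -> predC (after t) k.
Proof. by rewrite /upto /after /=; lia. Qed.

Lemma after_other_sub t (q : nat) k : after t k -> other (t - q%:Z) k.
Proof. by rewrite /other /after; lia. Qed.

Lemma subz_subn (a b : nat) : (b <= a)%N -> a%:Z - (a - b)%N%:Z = b%:Z.
Proof. by lia. Qed.

Lemma subz_subn_add (a b q : nat) : (b <= a)%N ->
  a%:Z - (a - b + q)%N%:Z = b%:Z - q%:Z.
Proof. by lia. Qed.

(** This detaches from the main terms [mm] an error r common to all n terms, by (m + r)^2 <= 2 (m^2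
    + r^2); in quadrature the error costs sqrt n only. *)
Lemma sqrt_sumD_le (R : realType) (K r : R) (mm : nat -> R) n : 0 <= K -> 0 <= r ->
  Num.sqrt (K * \sum_(1 <= t < n.+1) (mm t + r) ^+ 2) <=
  Num.sqrt K * Num.sqrt 2 *
    (Num.sqrt (\sum_(1 <= t < n.+1) mm t ^+ 2) + Num.sqrt n%:R * r).
Proof.
move=> K0 r0; rewrite sqrtrM// -mulrA ler_wpM2l ?sqrtr_ge0//.
set S := \sum_(1 <= t < n.+1) mm t ^+ 2.
have S0 : 0 <= S by apply: sumr_ge0 => t _; exact: sqr_ge0.
have le : \sum_(1 <= t < n.+1) (mm t + r) ^+ 2 <= 2 * (S + n%:R * r ^+ 2).
  have -> : 2 * (S + n%:R * r ^+ 2) = \sum_(1 <= t < n.+1) 2 * (mm t ^+ 2 + r ^+ 2).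
    by rewrite (mulr_natl (r ^+ 2) n) -mulr_sumr big_split /= sumr_const_nat subSS subn0.
  by apply: ler_sum => t _; have := sqr_ge0 (mm t - r); rewrite sqrrB sqrrD; lra.
have X0 : 0 <= Num.sqrt S + Num.sqrt n%:R * r.
  by rewrite addr_ge0 ?mulr_ge0 ?sqrtr_ge0.
rewrite (le_trans (ler_wsqrtr le))// sqrtrM// ler_wpM2l ?sqrtr_ge0//.
rewrite -(ler_sqr (sqrtr_ge0 _) X0) sqr_sqrtr ?addr_ge0 ?mulr_ge0 ?sqr_ge0//.
rewrite sqrrD exprMn !sqr_sqrtr//.
have : 0 <= Num.sqrt S * (Num.sqrt n%:R * r) by rewrite !mulr_ge0 ?sqrtr_ge0.
lra.
Qed.

Lemma sum_from (V : zmodType) (a k : nat) (P : nat -> V) :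
  \sum_(j < a + k) (if (a <= j)%N then P j else 0) =
  \sum_(j < a + k) P j - \sum_(j < a) P j.
Proof.
elim: k => [|k IH].
  rewrite addn0 subrr big1// => j _; by rewrite leqNgt ltn_ord.
by rewrite addnS !big_ord_recr /= IH leq_addr addrAC.
Qed.

Lemma half_lt_succ (l : nat) : (l < l./2.+1 * 2)%N.
Proof. by rewrite mulSn muln2 -{1}(odd_double_half l); case: (odd l). Qed.

Lemma half_succ_le_sub (l q : nat) : (q <= l./2)%N -> (l./2.+1 <= l.+1 - q)%N.
Proof. by have := odd_double_half l; case: (odd l); lia. Qed.

Lemma maxn_sub_add (l q : nat) : (maxn l q).+1 = (maxn 1 (l.+1 - q) + q)%N.
Proof. by lia. Qed.

Lemma before_near_start (l q t1 t2 : nat) : (t1 < t2 + maxn 1 (l.+1 - q))%N ->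
  (l.+1 - (t1 - t2) <= q)%N -> ~~ (t2 < t1 <= t2 + l)%N.
Proof. by lia. Qed.

Lemma near_start_time (l t1 t2 : nat) : (t2 < t1 <= t2 + l)%N ->
  t2%:Z - (l.+1 - (t1 - t2))%N%:Z = t1%:Z - l%:Z - 1.
Proof. by lia. Qed.

Lemma sqrt_nat_le (R : realType) (n : nat) : (0 < n)%N -> Num.sqrt n%:R <= n%:R :> R.
Proof.
move=> n0; have n1 : 1 <= n%:R :> R by rewrite ler1n.
have := ler_wsqrtr n1; rewrite sqrtr1 => s1.
by rewrite -[leRHS](sqr_sqrtr (ler0n R n)) expr2 ler_peMl// sqrtr_ge0.
Qed.

Lemma powR2_split (R : realType) (al : R) : 2 `^ al = 2 * 2 `^ (al - 1) :> R.
Proof.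
have e : al = 1 + (al - 1) by lra.
rewrite {1}e (@powRD R 2 1 (al - 1)); last by rewrite pnatr_eq0 implybT.
by rewrite powRr1.
Qed.

Lemma powRN_le (R : realType) (x y r : R) : 0 < x -> x <= y -> 0 <= r ->
  y `^ (- r) <= x `^ (- r).
Proof.
move=> x0 xy r0; have y0 : 0 < y := lt_le_trans x0 xy.
rewrite !powRN lef_pV2 ?posrE ?powR_gt0//.
by apply: ge0_ler_powR => //; rewrite nnegrE ltW.
Qed.

(** Writing -al = (2 - al) - 2, the first power is at most L^(2 - al), while (1 + v)^(-2) <= 1/v -
    1/(v + 1) telescopes to at most 1/L. *)
Lemma sum_powRN_le (R : realType) (al : R) (L k : nat) : 2 < al -> (0 < L)%N ->
  \sum_(j < k) (1 + (L + j)%:R) `^ (- al) <= L%:R `^ (1 - al).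
Proof.
move=> al2 L0; have L0' : 0 < L%:R :> R by rewrite ltr0n.
have step j : (1 + (L + j)%:R) `^ (- al) <=
    L%:R `^ (2 - al) * ((L + j)%:R^-1 - (L + j.+1)%:R^-1) :> R.
  have u0 : 0 < (L + j)%:R :> R by rewrite ltr0n addn_gt0 L0.
  have v0 : 0 < 1 + (L + j)%:R :> R by lra.
  have -> : (L + j.+1)%:R = 1 + (L + j)%:R :> R by rewrite addnS -natr1 addrC.
  have e : - al = (2 - al) + (- 2) by lra.
  rewrite {1}e powRD; last by rewrite (gt_eqF v0) implybT.
  apply: ler_pM; rewrite ?powR_ge0//.
    have -> : 2 - al = - (al - 2) by lra.
    apply: powRN_le => //; last lra.
    by rewrite natrD; have := ler0n R j; lra.
  have -> : (L + j)%:R^-1 - (1 + (L + j)%:R)^-1 = ((L + j)%:R * (1 + (L + j)%:R))^-1 :> R.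
    move: u0 v0; move: ((L + j)%:R) => u u0 v0.
    by field; rewrite (gt_eqF u0) (gt_eqF v0).
  rewrite powRN (powR_mulrn _ (ltW v0)) lef_pV2 ?posrE ?mulr_gt0 ?exprn_gt0//.
  by rewrite expr2; apply: ler_wpM2r; lra.
have h : \sum_(j < k) (1 + (L + j)%:R) `^ (- al) <=
    L%:R `^ (2 - al) * (L%:R^-1 - (L + k)%:R^-1) :> R.
  elim: k => [|k IH]; first by rewrite big_ord0 addn0 subrr mulr0.
  rewrite big_ord_recr /=; apply: le_trans (lerD IH (step k)) _.
  by rewrite -mulrDr addrA subrK.
apply: (le_trans h).
have -> : L%:R `^ (1 - al) = L%:R `^ (2 - al) * L%:R^-1 :> R.
  rewrite -(powR_inv1 (ltW L0')) -powRD ?(gt_eqF L0') ?implybT//.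
  by congr powR; lra.
apply: ler_wpM2l; first exact: powR_ge0.
by rewrite gerBl invr_ge0 ler0n.
Qed.

(** Coefficients bounded by 1 and vanishing at lags below L leave a sum over the lags from L on. The
    coefficient gap B becomes decay through this bound. *)
Lemma sum_shift_le (R : realType) (f : nat -> R) (c : nat -> R) (n t2 L : nat) :
  (forall j, 0 <= f j) -> (forall t, `|c t| <= 1) -> (0 < t2)%N ->
  (forall t, (t < t2 + L)%N -> c t = 0) ->
  \sum_(1 <= t < n.+1) `|c t| * f (t - t2)%N <= \sum_(j < n) f (L + j)%N.
Proof.
move=> f0 c1 t20 cL.
have [lt|le] := ltnP n (t2 + L).
  rewrite big_nat big1 ?sumr_ge0// => t /andP[_ tn].
  by rewrite cL ?normr0 ?mul0r//; lia.
rewrite (big_cat_nat _ (n := t2 + L))/=; [|lia|lia].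
rewrite big_nat big1 ?add0r; last by move=> t /andP[_ /cL ->]; rewrite normr0 mul0r.
rewrite -{1}[(t2 + L)%N]add0n big_addn big_mkord.
set k := (n.+1 - (t2 + L))%N.
have nE : (k + (t2 + L - 1))%N = n by rewrite /k; lia.
rewrite -[in leRHS]nE.
rewrite big_split_ord /= -[leLHS]addr0; apply: lerD; last exact: sumr_ge0.
apply: ler_sum => j _.
have -> : (j + (t2 + L) - t2 = L + j)%N by lia.
by rewrite ler_piMl.
Qed.

Lemma dist_natC t1 t2 : dist_nat t1 t2 = dist_nat t2 t1.
Proof. by rewrite /dist_nat distnC. Qed.

Lemma dist_natE t1 t2 : (t2 <= t1)%N -> dist_nat t1 t2 = (t1 - t2)%N.
Proof. by rewrite /dist_nat; lia. Qed.

Lemma dist_natxx t : dist_nat t t = 0%N.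
Proof. by rewrite dist_natE// subnn. Qed.

(** * Reduction to pairs with t2 < t1 *)

Section LowerPart.
Context (R : realType) (n : nat).
Implicit Types (b : nat -> nat -> R) (P : pred nat).

(** It also vanishes outside the sample, so that hypotheses on b known for indices 1 to n become
    bounds valid at all indices. *)
Definition lower b t1 t2 : R := if [&& t2 < t1, 0 < t2 & t1 <= n]%N then b t1 t2 else 0.

Definition flip b t1 t2 : R := b t2 t1.

Lemma sum_lower b (f : nat -> nat -> R) :
  (forall t, (0 < t <= n)%N -> b t t = 0) ->
  \sum_(1 <= t1 < n.+1) \sum_(1 <= t2 < n.+1) b t1 t2 * f t1 t2 =
  \sum_(1 <= t1 < n.+1) \sum_(1 <= t2 < n.+1) lower b t1 t2 * f t1 t2 +
  \sum_(1 <= t1 < n.+1) \sum_(1 <= t2 < n.+1) lower (flip b) t1 t2 * f t2 t1.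
Proof.
move=> b0; rewrite [X in _ + X]exchange_big_nat -big_split /=.
apply: eq_big_nat => t1 /andP[t10 t1n]; rewrite -big_split /=.
apply: eq_big_nat => t2 /andP[t20 t2n]; rewrite /lower /flip.
rewrite t10 t20 -[(t1 <= n)%N]ltnS t1n -[(t2 <= n)%N]ltnS t2n !andbT.
case: ltngtP => h; rewrite ?mul0r ?addr0 ?add0r//.
by rewrite h b0 ?mul0r// t10 -ltnS.
Qed.

Lemma sum_lower_sqr b P :
  \sum_(1 <= t1 < n.+1) \sum_(1 <= t2 < n.+1)
    (if P (t1 - t2)%N then lower b t1 t2 else 0) ^+ 2 <=
  \sum_(1 <= t1 < n.+1) \sum_(1 <= t2 < n.+1 | P (dist_nat t1 t2)) b t1 t2 ^+ 2.
Proof.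
apply: ler_sum => t1 _; rewrite [leRHS]big_mkcond; apply: ler_sum => t2 _ /=.
rewrite /lower; have [/andP[t12 _]|_] := boolP [&& _, _ & _].
  by rewrite dist_natE ?(ltnW t12)//; case: (P _); rewrite ?expr0n.
by case: (P (t1 - t2)%N); rewrite expr0n /=; case: ifP; rewrite ?sqr_ge0.
Qed.

Lemma sum_flip_sqr b P :
  \sum_(1 <= t1 < n.+1) \sum_(1 <= t2 < n.+1 | P (dist_nat t1 t2)) flip b t1 t2 ^+ 2 =
  \sum_(1 <= t1 < n.+1) \sum_(1 <= t2 < n.+1 | P (dist_nat t1 t2)) b t1 t2 ^+ 2.
Proof.
under eq_bigr do rewrite big_mkcond.
rewrite exchange_big_nat /=; apply: eq_bigr => t2 _; rewrite [RHS]big_mkcond.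
by apply: eq_bigr => t1 _; rewrite dist_natC.
Qed.

Lemma lower_le1 b t1 t2 :
  (forall t1 t2, (0 < t1 <= n)%N -> (0 < t2 <= n)%N -> `|b t1 t2| <= 1) ->
  `|lower b t1 t2| <= 1.
Proof.
move=> b1; rewrite /lower; case: ifP => [/and3P[h1 h2 h3]|_]; last by rewrite normr0.
by apply: b1; lia.
Qed.

Lemma lower_eq0 b L t1 t2 :
  (forall t1 t2, (0 < t1 <= n)%N -> (0 < t2 <= n)%N -> (dist_nat t1 t2 < L)%N -> b t1 t2 = 0) ->
  (t1 < t2 + L)%N -> lower b t1 t2 = 0.
Proof.
move=> b0 tL; rewrite /lower; case: ifP => // /and3P[h1 h2 h3].
by apply: b0; rewrite ?dist_natE; lia.
Qed.

(** As f is symmetric, the upper triangle of b is the lower triangle of [flip b]; one bound, proved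
    for both matrices, is paid twice. *)
Lemma Lpbound_lower d (T : measurableType d) (m : probability T R) p b
    (f : nat -> nat -> T -> R) c : 1 <= p ->
  (forall t, (0 < t <= n)%N -> b t t = 0) ->
  (forall t1 t2, f t1 t2 = f t2 t1) ->
  (forall b', b' = b \/ b' = flip b -> Lpbound m p (fun x =>
    \sum_(1 <= t1 < n.+1) \sum_(1 <= t2 < n.+1) lower b' t1 t2 * f t1 t2 x) c) ->
  Lpbound m p (fun x => \sum_(1 <= t1 < n.+1) \sum_(1 <= t2 < n.+1) b t1 t2 * f t1 t2 x) (2 * c).
Proof.
move=> p1 b0 fC h; rewrite mulr2n mulrDl !mul1r.
apply: eq_Lpbound (LpboundD p1 (h b (or_introl erefl)) (h (flip b) (or_intror erefl))) => x.
rewrite (sum_lower (fun t1 t2 => f t1 t2 x) b0); congr (_ + _).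
by apply: eq_bigr => t1 _; apply: eq_bigr => t2 _; rewrite fC.
Qed.

End LowerPart.

(** * The quadratic form on path space *)

Section FixedSampleSize.
Context (R : realType) (mu : probability (paths R int) R).
Hypothesis mu_mix : mix_invariant mu.
Local Notation S := (paths R int).
Variables (d : nat) (F : int -> 'I_d -> S -> R).
(** Short-range dependence read on path space: [dl j] bounds the effect of the innovation at lag j,
    and [tl u] dominates every partial sum of [dl] from u on. Working with partial sums keeps
    infinite series out. *)
Variables (M K : R) (dl tl : nat -> R).

Hypothesis M4 : 4 < M.
Hypothesis K0 : 0 <= K.
Hypothesis dl0 : forall j, 0 <= dl j.
Hypothesis F_dep : forall t i, depends_on (upto t) (F t i).
Hypothesis F_lin : forall t (v : 'I_d -> R),
  Lpbound mu M (fun x => \sum_i v i * F t i x) (K * Num.sqrt (\sum_i v i ^+ 2)).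
Hypothesis F_lin_delta : forall t (v : 'I_d -> R) (j : nat),
  Lpbound mu M (fun x => \sum_i v i * F t i x -
     condE mu (other (t - j%:Z)) (fun x => \sum_i v i * F t i x) x)
    (dl j * Num.sqrt (\sum_i v i ^+ 2)).
Hypothesis F_mean : forall t i, \int[mu]_x F t i x = 0.
Hypothesis dl_tail : forall u n, \sum_(j < n) dl (u + j)%N <= tl u.

Let M0 : 0 < M. Proof. by move: M4; lra. Qed.
Let M1 : 1 <= M. Proof. by move: M4; lra. Qed.
Let M2 : 2 < M. Proof. by move: M4; lra. Qed.
Let p1 : 1 <= M / 2. Proof. by move: M4; lra. Qed.
Let p2 : 2 < M / 2. Proof. by move: M4; lra. Qed.
Let p0 : 0 < M / 2. Proof. by move: M4; lra. Qed.

Let tl0 u : 0 <= tl u.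
Proof. by have := dl_tail u 0; rewrite big_ord0. Qed.

Let unit_sum i (f : 'I_d -> R) : \sum_k (k == i)%:R * f k = f i.
Proof.
rewrite (bigD1 i)//= eqxx mul1r big1 ?addr0// => k /negbTE ->.
by rewrite mul0r.
Qed.

Let unit_norm i : Num.sqrt (\sum_(k < d) ((k == i)%:R : R) ^+ 2) = 1.
Proof.
rewrite (bigD1 i)//= eqxx expr1n big1 ?addr0 ?sqrtr1// => k /negbTE ->.
by rewrite expr0n.
Qed.

Lemma Lpbound_coord t i : Lpbound mu M (F t i) K.
Proof.
have := F_lin t (fun k => (k == i)%:R); rewrite unit_norm mulr1.
by apply: eq_Lpbound => x; rewrite unit_sum.
Qed.

Lemma Lpbound_coord_delta t i (j : nat) :
  Lpbound mu M (fun x => F t i x - condE mu (other (t - j%:Z)) (F t i) x) (dl j).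
Proof.
have := F_lin_delta t (fun k => (k == i)%:R) j; rewrite unit_norm mulr1.
have -> : (fun x => \sum_k (k == i)%:R * F t k x) = F t i.
  by apply/funext => x; rewrite unit_sum.
by apply: eq_Lpbound => x; rewrite unit_sum.
Qed.

Lemma condE_after_coord t i : condE mu (after t) (F t i) = fun=> 0.
Proof.
rewrite condE_indep; first by rewrite F_mean.
apply: depends_on_sub (@F_dep t i) _ => k.
exact: upto_predC_after.
Qed.

Lemma LpcvgBr p (f z : S -> R) G : Lpcvg mu p f G ->
  Lpcvg mu p (fun x => f x - z x) (fun n x => G n x - z x).
Proof.
move=> h e e0; have [N hN] := h e e0; exists N => n /hN.
by apply: eq_Lpbound => x; lra.
Qed.

(** The difference is the series of the projections at lags u, u + 1 and so on, each bounded by the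
    matching [dl]; closedness of balls passes to the limit. *)
Lemma Lpbound_coord_tail t i u :
  Lpbound mu M (fun x => F t i x - condE mu (after (t - u%:Z)) (F t i) x) (tl u).
Proof.
have cv := LpcvgBr (condE mu (after (t - u%:Z)) (F t i))
  (condE_after_cvg mu_mix (t - u%:Z) M1 (Lpbound_coord t i)).
apply: (Lpcvg_bound M1 cv) => n; apply: (Lpbound_le (dl_tail u n)).
apply: (eq_Lpbound (f := fun x => \sum_(j < n) proj mu (t - u%:Z - j%:Z) (F t i) x)).
  by move=> x; rewrite sum_proj.
apply: (@Lpbound_sum _ _ _ mu M _ (index_enum 'I_n) xpredT
  (fun j => proj mu (t - u%:Z - j%:Z) (F t i))) => // j _.
apply: (Lpbound_proj mu_mix M1 (Lpbound_coord t i)).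
have -> : t - u%:Z - j%:Z = t - (u + j)%N%:Z by lia.
exact: Lpbound_coord_delta.
Qed.

(** At a fixed lag j the projections form reversed martingale differences in t, so the coefficients
    enter through the root of their sum of squares. Summing over j then costs the factor [tl 0]. *)
Lemma Lpbound_lincomb (c : nat -> R) i n :
  Lpbound mu M (fun x => \sum_(1 <= t < n.+1) c t * F t%:Z i x)
    (tl 0 * (Num.sqrt (rio_const M) * Num.sqrt (\sum_(1 <= t < n.+1) c t ^+ 2))).
Proof.
have cv : Lpcvg mu M (fun x => \sum_(1 <= t < n.+1) c t * F t%:Z i x)
    (fun N x => \sum_(1 <= t < n.+1) c t * condE mu (after (t%:Z - N%:Z)) (F t%:Z i) x).
  apply: (@Lpcvg_sum _ _ _ mu M _ _ _ (fun t x => c t * F t%:Z i x)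
    (fun t N x => c t * condE mu (after (t%:Z - N%:Z)) (F t%:Z i) x) M1) => t _.
  exact: (LpcvgZ _ M0 (condE_after_cvg mu_mix _ M1 (Lpbound_coord _ _))).
apply: (Lpcvg_bound M1 cv) => N.
apply: (eq_Lpbound (f := fun x => \sum_(j < N) \sum_(1 <= t < n.+1)
    c t * proj mu (t%:Z - j%:Z) (F t%:Z i) x)).
  move=> x; rewrite exchange_big; apply: eq_bigr => t _ /=.
  by rewrite -mulr_sumr sum_proj condE_after_coord subr0.
set C := (X in _ * X); have C0 : 0 <= C by rewrite mulr_ge0// sqrtr_ge0.
apply: (@Lpbound_le _ _ _ mu M _ (\sum_(j < N) dl (0 + j)%N * C)).
  by rewrite -mulr_suml ler_wpM2r.
apply: (@Lpbound_sum _ _ _ mu M _ (index_enum 'I_N) xpredT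
  (fun j x => \sum_(1 <= t < n.+1) c t * proj mu (t%:Z - j%:Z) (F t%:Z i) x)) => // j _.
have hp t : Lpbound mu M (proj mu (t - j%:Z) (F t i)) (dl j).
  exact: (Lpbound_proj mu_mix M1 (Lpbound_coord t i) (Lpbound_coord_delta t i j)).
have -> : dl (0 + j)%N * C = Num.sqrt (rio_const M * \sum_(1 <= t < n.+1) (`|c t| * dl j) ^+ 2).
  rewrite add0n sqrt_sum_scale//.
  by have := taylor_const_ge1 M2; rewrite /rio_const; lra.
apply: (Lpbound_rio_desc mu_mix (a := j%:Z)
  (H := fun t x => c t * proj mu (t%:Z - j%:Z) (F t%:Z i) x) M2) => t _.
- exact: LpboundZ.
- by move=> x y xy; congr (_ * _); exact: (@proj_dep _ mu).
- have h1 := condEZ mu_mix (after (t%:Z - j%:Z)) (c t) (Lpbound_integrable M1 (hp t%:Z)).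
  have h2 := condE_proj mu_mix (t%:Z - j%:Z) M1 (Lpbound_coord t%:Z i).
  by move: h1 h2; apply: filterS2 => x -> ->; rewrite mulr0.
Qed.

Definition quad (t1 t2 : int) (x : S) : R := \sum_i F t1 i x * F t2 i x.

Lemma Lpbound_quad t1 t2 : Lpbound mu (M / 2) (quad t1 t2) (\sum_(i < d) K * K).
Proof.
apply: (@Lpbound_sum _ _ _ mu (M / 2) _ (index_enum 'I_d) xpredT
  (fun i x => F t1 i x * F t2 i x)) => // i _.
exact: LpboundM (Lpbound_coord t1 i) (Lpbound_coord t2 i).
Qed.

(** * One projection of one column: t2 and the lag q are fixed *)

Section OneColumn.
(** [rho] bounds the past-dependent remainder [rem] of A, and [sigma] the effect on it of the
    innovation at time s = t2 - q, which sits at lag t1 - t2 + q of F_{t1}. *)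
Variables (n t2 q : nat) (c : nat -> R) (rho sigma : R).
Hypothesis c0 : forall t1, (t1 <= t2)%N -> c t1 = 0.
Hypothesis rhoP : \sum_(1 <= t1 < n.+1) `|c t1| * tl (t1 - t2)%N <= rho.
Hypothesis sigmaP : \sum_(1 <= t1 < n.+1) `|c t1| * dl (t1 - t2 + q)%N <= sigma.

Let A i (x : S) := \sum_(1 <= t1 < n.+1) c t1 * F t1%:Z i x.
Let a := tl 0 * (Num.sqrt (rio_const M) * Num.sqrt (\sum_(1 <= t < n.+1) c t ^+ 2)).
Let s : int := t2%:Z - q%:Z.
Let Aind i := condE mu (after t2%:Z) (A i).
Let rem i (x : S) := A i x - Aind i x.
Let Es f := condE mu (other s) f.

Let a0 : 0 <= a.
Proof. by rewrite mulr_ge0// mulr_ge0// sqrtr_ge0. Qed.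

Let hA i : Lpbound mu M (A i) a. Proof. exact: Lpbound_lincomb. Qed.
Let hAind i : Lpbound mu M (Aind i) a. Proof. exact: Lpbound_condE. Qed.

Let Aind_dep i : depends_on (other s) (Aind i).
Proof.
apply: depends_on_sub (@condE_dep _ _ mu (after t2%:Z) (A i)) _ => k.
exact: after_other_sub.
Qed.

Let hAindF i : Lpbound mu (M / 2) (fun x => Aind i x * F t2%:Z i x) (a * K).
Proof. exact: LpboundM (hAind i) (Lpbound_coord _ _). Qed.

Let hremF i : Lpbound mu (M / 2) (fun x => rem i x * F t2%:Z i x) ((a + a) * K).
Proof. exact: LpboundM (LpboundB M1 (hA i) (hAind i)) (Lpbound_coord _ _). Qed.

Let sumF_sub_ae (J : pred int) (v : 'I_d -> R) :
  {ae mu, forall x, \sum_i v i * F t2%:Z i x -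
     condE mu J (fun x => \sum_i v i * F t2%:Z i x) x =
     \sum_i v i * (F t2%:Z i x - condE mu J (F t2%:Z i) x)}.
Proof.
have := condE_sum mu_mix J (index_enum 'I_d) (P := xpredT) v M1
  (fun i _ => Lpbound_coord t2%:Z i).
apply: filterS => x ->; rewrite -sumrB; apply: eq_bigr => i _.
by rewrite mulrBr.
Qed.

(** [Aind] sees only innovations after t2, and the increment of F_{t2} only those up to t2, so
    [Lpbound_dot_indep] applies. Its exponent M is lowered to M / 2 to match the remainder. *)
Let main_bound :
  Lpbound mu (M / 2) (fun x => \sum_i Aind i x * (F t2%:Z i x - Es (F t2%:Z i) x))
    (Num.sqrt d%:R * a * dl q).
Proof.
apply: Lpbound_half => //.
apply: (Lpbound_dot_indep mu_mix (J := after t2%:Z)) => //.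
- by move: M4; lra.
- by move=> i; exact: condE_dep.
- move=> i; have depF : depends_on (predC (after t2%:Z)) (F t2%:Z i).
    by apply: depends_on_sub (@F_dep t2%:Z i) _ => k; exact: upto_predC_after.
  move=> x y xy; congr (_ - _); first exact: depF.
  have := condE_depI mu (J := other s) depF; apply.
  by move=> k /= /andP[_ hk]; exact: xy.
- move=> v; apply: (Lpbound_ae M0 (F_lin_delta t2%:Z v q)).
    apply: measurable_sum => i; apply: measurable_funM => //.
    have h := Lpbound_coord t2%:Z i.
    by case: (LpboundB M1 h (Lpbound_condE mu_mix (other s) M1 h)).
  exact: sumF_sub_ae.
Qed.

Let rem_bound i : Lpbound mu M (rem i) rho.
Proof.
apply: (Lpbound_le rhoP).
have h : Lpbound mu M (fun x => \sum_(1 <= t1 < n.+1) c t1 *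
    (F t1%:Z i x - condE mu (after t2%:Z) (F t1%:Z i) x))
    (\sum_(1 <= t1 < n.+1) `|c t1| * tl (t1 - t2)%N).
  apply: (@Lpbound_sum _ _ _ mu M _ _ _ (fun t1 x => c t1 *
    (F t1%:Z i x - condE mu (after t2%:Z) (F t1%:Z i) x))) => // t1 _.
  have [le|lt] := leqP t1 t2.
    rewrite c0// normr0 mul0r; apply: (eq_Lpbound (f := fun=> 0)).
      by move=> x; rewrite mul0r.
    exact: Lpbound0.
  apply: LpboundZ => //; have := Lpbound_coord_tail t1%:Z i (t1 - t2)%N.
  by rewrite subz_subn// ltnW.
apply: (Lpbound_ae M0 h).
  by case: (LpboundB M1 (hA i) (hAind i)).
have := condE_sum mu_mix (after t2%:Z) (index_iota 1 n.+1) (P := xpredT) c M1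
  (fun t _ => Lpbound_coord t%:Z i).
apply: filterS => x e; rewrite /rem /Aind e /A -sumrB.
by apply: eq_bigr => t _; rewrite mulrBr.
Qed.

(** Since s <= t2, averaging over the innovation at s leaves [Aind] fixed, so its effect on [rem]
    equals its effect on A. *)
Let rem_sub_bound i : Lpbound mu M (fun x => rem i x - Es (rem i) x) sigma.
Proof.
apply: (Lpbound_le sigmaP).
have h : Lpbound mu M (fun x => \sum_(1 <= t1 < n.+1) c t1 *
    (F t1%:Z i x - condE mu (other s) (F t1%:Z i) x))
    (\sum_(1 <= t1 < n.+1) `|c t1| * dl (t1 - t2 + q)%N).
  apply: (@Lpbound_sum _ _ _ mu M _ _ _ (fun t1 x => c t1 *
    (F t1%:Z i x - condE mu (other s) (F t1%:Z i) x))) => // t1 _.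
  have [le|lt] := leqP t1 t2.
    rewrite c0// normr0 mul0r; apply: (eq_Lpbound (f := fun=> 0)).
      by move=> x; rewrite mul0r.
    exact: Lpbound0.
  apply: LpboundZ => //; have := Lpbound_coord_delta t1%:Z i (t1 - t2 + q)%N.
  by rewrite subz_subn_add// ltnW.
have hrem := LpboundB M1 (hA i) (hAind i).
apply: (Lpbound_ae M0 h).
  by case: (LpboundB M1 hrem (Lpbound_condE mu_mix (other s) M1 hrem)).
have e1 := condE_sum mu_mix (other s) (index_iota 1 n.+1) (P := xpredT) c M1
  (fun t _ => Lpbound_coord t%:Z i).
have e2 := condEB mu_mix (other s) (Lpbound_integrable M1 (hA i)) (Lpbound_integrable M1 (hAind i)).
move: e1 e2; apply: filterS2 => x e1 e2; rewrite /Es {}e2 (condE_id mu (@Aind_dep i)).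
have -> : rem i x - (condE mu (other s) (A i) x - Aind i x) =
    A i x - condE mu (other s) (A i) x by rewrite /rem; ring.
rewrite [condE mu (other s) (A i) x]e1 /A -sumrB.
by apply: eq_bigr => t _; rewrite mulrBr.
Qed.

(** The column splits as [Aind] plus [rem], each multiplied by F_{t2}. [Aind] is pulled out of [Es],
    which leaves [main_bound]; the products with [rem] are bounded component by component, hence the
    factor d. *)
Lemma Lpbound_column :
  Lpbound mu (M / 2) (proj mu s (fun x => \sum_(1 <= t1 < n.+1) c t1 * quad t1%:Z t2%:Z x))
    (Num.sqrt d%:R * a * dl q + d%:R * (rho * dl q + 2 * (sigma * K))).
Proof.
have YE : (fun x => \sum_(1 <= t1 < n.+1) c t1 * quad t1%:Z t2%:Z x) =
    (fun x => \sum_i 1 * (Aind i x * F t2%:Z i x) + \sum_i 1 * (rem i x * F t2%:Z i x)).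
  apply/funext => x; rewrite -big_split /=.
  transitivity (\sum_i A i x * F t2%:Z i x); last first.
    by apply: eq_bigr => i _; rewrite /rem; lra.
  rewrite /quad; under eq_bigr do rewrite mulr_sumr.
  rewrite exchange_big; apply: eq_bigr => i _ /=; rewrite mulr_suml.
  by apply: eq_bigr => t _; rewrite mulrA.
have hY : Lpbound mu (M / 2) (fun x => \sum_(1 <= t1 < n.+1) c t1 * quad t1%:Z t2%:Z x)
    (\sum_(1 <= t1 < n.+1) `|c t1| * (\sum_(i < d) K * K)).
  apply: (@Lpbound_sum _ _ _ mu (M / 2) _ _ _ (fun t1 x => c t1 * quad t1%:Z t2%:Z x)) => // t1 _.
  exact: LpboundZ p0 (Lpbound_quad _ _).
apply: (Lpbound_proj mu_mix p1 hY).
have h2 : Lpbound mu (M / 2) (fun x => \sum_i (rem i x * F t2%:Z i x -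
    Es (fun x => rem i x * F t2%:Z i x) x)) (\sum_(i < d) (rho * dl q + 2 * (sigma * K))).
  apply: (@Lpbound_sum _ _ _ mu (M / 2) _ (index_enum 'I_d) xpredT
    (fun i x => rem i x * F t2%:Z i x - Es (fun x => rem i x * F t2%:Z i x) x)) => // i _.
  apply: (Lpbound_mul_sub_condE mu_mix _ (rem_bound i) (Lpbound_coord t2%:Z i)).
  - by move: M4; lra.
  - exact: rem_sub_bound.
  - exact: Lpbound_coord_delta.
rewrite sumr_const card_ord in h2; rewrite (mulr_natl _ d).
apply: (Lpbound_ae p0 (LpboundD p1 main_bound h2)).
  by case: (LpboundB p1 hY (Lpbound_condE mu_mix (other s) p1 hY)).
rewrite YE.
have S1 : Lpbound mu (M / 2) (fun x => \sum_i 1 * (Aind i x * F t2%:Z i x)) (\sum_(i < d) `|1| * (a * K)).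
  by apply: (@Lpbound_sum _ _ _ mu (M / 2) _ (index_enum 'I_d) xpredT
    (fun i x => 1 * (Aind i x * F t2%:Z i x))) => // i _; exact: LpboundZ.
have S2 : Lpbound mu (M / 2) (fun x => \sum_i 1 * (rem i x * F t2%:Z i x)) (\sum_(i < d) `|1| * ((a + a) * K)).
  by apply: (@Lpbound_sum _ _ _ mu (M / 2) _ (index_enum 'I_d) xpredT
    (fun i x => 1 * (rem i x * F t2%:Z i x))) => // i _; exact: LpboundZ.
have e0 := condED mu_mix (other s) (Lpbound_integrable p1 S1) (Lpbound_integrable p1 S2).
have e1 := condE_sum mu_mix (other s) (index_enum 'I_d) (P := xpredT) (fun=> 1) p1 (fun i _ => hAindF i).
have e2 := condE_sum mu_mix (other s) (index_enum 'I_d) (P := xpredT) (fun=> 1) p1 (fun i _ => hremF i).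
have e3 := @ae_eq_sum _ _ _ mu _ (index_enum 'I_d) xpredT _ _ (fun i _ =>
  condE_pull mu_mix (Aind_dep i) (Lpbound_integrable M1 (Lpbound_coord t2%:Z i))).
apply: filterS2 (filterI e0 e1) (filterI e2 e3) => x [E0 E1] [E2 E3].
rewrite [X in _ = X - _](congr1 (fun f => f x) YE) E0 E1 E2 /Es opprD addrACA; congr (_ + _).
  under [in RHS]eq_bigr do rewrite mul1r.
  under [X in _ = _ - X]eq_bigr do rewrite mul1r.
  rewrite E3 -sumrB; apply: eq_bigr => i _; rewrite mulrBr//.
rewrite -sumrB; apply: eq_bigr => i _; rewrite !mul1r//.
Qed.

End OneColumn.

(** * Summation over the columns and over the lags of the projections *)

Section Layers.
Variables (n : nat) (b : nat -> nat -> R) (q0 : nat -> nat -> nat) (rho sigma : nat -> R).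
Hypothesis b0 : forall t1 t2, (t1 <= t2)%N -> b t1 t2 = 0.

(* For the lag q of the innovation e_{t2-q}, only the pairs whose expansion starts
   at q0 t1 t2 <= q contribute. *)
Definition layer q t1 t2 : R := if (q0 t1 t2 <= q)%N then b t1 t2 else 0.

Hypothesis rhoP : forall q t2, (0 < t2 <= n)%N ->
  \sum_(1 <= t1 < n.+1) `|layer q t1 t2| * tl (t1 - t2)%N <= rho q.
Hypothesis sigmaP : forall q t2, (0 < t2 <= n)%N ->
  \sum_(1 <= t1 < n.+1) `|layer q t1 t2| * dl (t1 - t2 + q)%N <= sigma q.

Definition layer_norm q :=
  Num.sqrt (\sum_(1 <= t1 < n.+1) \sum_(1 <= t2 < n.+1) layer q t1 t2 ^+ 2).

Let kappa := Num.sqrt (rio_const (M / 2)) * Num.sqrt 2.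
Let kappa0 : 0 <= kappa. Proof. by rewrite mulr_ge0 ?sqrtr_ge0. Qed.

(** [kappa] combines Rio's constant at M / 2 with the sqrt 2 of [sqrt_sumD_le]. The first term
    collects the main parts of the columns through [Lpbound_lincomb]; the second is the decoupling
    error of n columns added in quadrature. *)
Definition layer_bound q := kappa *
  (Num.sqrt d%:R * tl 0 * Num.sqrt (rio_const M) * (dl q * layer_norm q) +
   Num.sqrt n%:R * (d%:R * (rho q * dl q + 2 * (sigma q * K)))).

Let rio0 p : 2 < p -> 0 <= rio_const p :> R.
Proof. by move=> /taylor_const_ge1; rewrite /rio_const; lra. Qed.

Lemma Lpbound_layer q : (0 < n)%N ->
  Lpbound mu (M / 2) (fun x => \sum_(1 <= t2 < n.+1)
    proj mu (t2%:Z - q%:Z) (fun x => \sum_(1 <= t1 < n.+1) layer q t1 t2 * quad t1%:Z t2%:Z x) x)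
  (layer_bound q).
Proof.
move=> n0.
have l0 t1 t2 : (t1 <= t2)%N -> layer q t1 t2 = 0.
  by move=> h; rewrite /layer b0//; case: ifP.
have hY t2 : Lpbound mu (M / 2) (fun x => \sum_(1 <= t1 < n.+1) layer q t1 t2 * quad t1%:Z t2%:Z x)
    (\sum_(1 <= t1 < n.+1) `|layer q t1 t2| * (\sum_(i < d) K * K)).
  apply: (@Lpbound_sum _ _ _ mu (M / 2) _ _ _ (fun t1 x => layer q t1 t2 * quad t1%:Z t2%:Z x)) => // t1 _.
  exact: LpboundZ p0 (Lpbound_quad _ _).
pose k := Num.sqrt d%:R * tl 0 * Num.sqrt (rio_const M) * dl q.
pose mm t2 := k * Num.sqrt (\sum_(1 <= t1 < n.+1) layer q t1 t2 ^+ 2).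
pose r := d%:R * (rho q * dl q + 2 * (sigma q * K)).
have k0 : 0 <= k by rewrite /k !mulr_ge0 ?sqrtr_ge0.
have rho0 : 0 <= rho q.
  apply: le_trans (rhoP q (t2 := n) _); last by rewrite n0 leqnn.
  by apply: sumr_ge0 => t _; rewrite mulr_ge0.
have sigma0 : 0 <= sigma q.
  apply: le_trans (sigmaP q (t2 := n) _); last by rewrite n0 leqnn.
  by apply: sumr_ge0 => t _; rewrite mulr_ge0.
have r0 : 0 <= r by rewrite /r mulr_ge0// addr_ge0 ?mulr_ge0.
have H : Lpbound mu (M / 2) (fun x => \sum_(1 <= t2 < n.+1)
    proj mu (t2%:Z - q%:Z) (fun x => \sum_(1 <= t1 < n.+1) layer q t1 t2 * quad t1%:Z t2%:Z x) x)
    (Num.sqrt (rio_const (M / 2) * \sum_(1 <= t < n.+1) (mm t + r) ^+ 2)).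
  apply: (Lpbound_rio_desc mu_mix (a := q%:Z) p2 (H := fun t2 x => proj mu (t2%:Z - q%:Z)
    (fun x => \sum_(1 <= t1 < n.+1) layer q t1 t2 * quad t1%:Z t2%:Z x) x)) => t2 ht.
  - have := @Lpbound_column n t2 q (fun t1 => layer q t1 t2) _ _ (l0^~ t2) (rhoP q ht) (sigmaP q ht).
    apply: Lpbound_le; rewrite /mm /r /k; apply: lerD => //.
    by rewrite le_eqVlt; apply/orP; left; apply/eqP; ring.
  - exact: (@proj_dep _ mu).
  - exact: condE_proj p1 (hY t2).
apply: (Lpbound_le _ H).
apply: (le_trans (sqrt_sumD_le _ _ (rio0 p2) r0)).
rewrite /layer_bound -/kappa; apply: ler_wpM2l => //; apply: lerD => //.
have -> : \sum_(1 <= t < n.+1) mm t ^+ 2 = k ^+ 2 *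
    \sum_(1 <= t1 < n.+1) \sum_(1 <= t2 < n.+1) layer q t1 t2 ^+ 2.
  rewrite exchange_big mulr_sumr; apply: eq_bigr => t _ /=.
  by rewrite exprMn sqr_sqrtr// sumr_ge0// => i _; exact: sqr_ge0.
rewrite sqrtrM ?sqr_ge0// sqrtr_sqr (ger0_norm k0) -/(layer_norm q) /k.
by rewrite !mulrA.
Qed.

(** Each centred product is the limit of its projections with lags from [q0 t1 t2] on. Exchanging
    the sums groups the truncated expansion into layers, and a bound uniform in the number N of
    layers survives the limit. *)
Lemma Lpbound_layers c : (0 < n)%N -> (forall N, \sum_(q < N) layer_bound q <= c) ->
  Lpbound mu (M / 2) (fun x => \sum_(1 <= t1 < n.+1) \sum_(1 <= t2 < n.+1) b t1 t2 *
    (quad t1%:Z t2%:Z x - condE mu (after (t2%:Z - (q0 t1 t2)%:Z)) (quad t1%:Z t2%:Z) x)) c.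
Proof.
move=> n0 hc.
pose P t1 t2 j x := if (q0 t1 t2 <= j)%N then proj mu (t2%:Z - j%:Z) (quad t1%:Z t2%:Z) x else 0.
have cv : Lpcvg mu (M / 2) (fun x => \sum_(1 <= t1 < n.+1) \sum_(1 <= t2 < n.+1) b t1 t2 *
    (quad t1%:Z t2%:Z x - condE mu (after (t2%:Z - (q0 t1 t2)%:Z)) (quad t1%:Z t2%:Z) x))
    (fun N x => \sum_(1 <= t1 < n.+1) \sum_(1 <= t2 < n.+1) b t1 t2 * \sum_(j < N) P t1 t2 j x).
  apply: (@Lpcvg_sum _ _ _ mu (M / 2) _ _ _ (fun t1 x => \sum_(1 <= t2 < n.+1) b t1 t2 *
    (quad t1%:Z t2%:Z x - condE mu (after (t2%:Z - (q0 t1 t2)%:Z)) (quad t1%:Z t2%:Z) x))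
    (fun t1 N x => \sum_(1 <= t2 < n.+1) b t1 t2 * \sum_(j < N) P t1 t2 j x) p1) => t1 _.
  apply: (@Lpcvg_sum _ _ _ mu (M / 2) _ _ _ (fun t2 x => b t1 t2 *
    (quad t1%:Z t2%:Z x - condE mu (after (t2%:Z - (q0 t1 t2)%:Z)) (quad t1%:Z t2%:Z) x))
    (fun t2 N x => b t1 t2 * \sum_(j < N) P t1 t2 j x) p1) => t2 _.
  apply: (LpcvgZ _ p0) => e e0.
  have [N1 hN1] := condE_after_cvg mu_mix t2%:Z p1 (Lpbound_quad t1%:Z t2%:Z) e0.
  exists (maxn N1 (q0 t1 t2)) => N; rewrite geq_max => /andP[/hN1 {}hN1 hq].
  apply: eq_Lpbound hN1 => x /=.
  have -> : \sum_(j < N) P t1 t2 j x = condE mu (after (t2%:Z - N%:Z)) (quad t1%:Z t2%:Z) x -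
      condE mu (after (t2%:Z - (q0 t1 t2)%:Z)) (quad t1%:Z t2%:Z) x.
    have := sum_from (q0 t1 t2) (N - q0 t1 t2) (fun j => proj mu (t2%:Z - j%:Z) (quad t1%:Z t2%:Z) x).
    by rewrite subnKC// /P => ->; rewrite !sum_proj; ring.
  ring.
apply: (Lpcvg_bound p1 cv) => N; apply: (Lpbound_le (hc N)).
have hs : Lpbound mu (M / 2) (fun x => \sum_(q < N) \sum_(1 <= t2 < n.+1)
    proj mu (t2%:Z - q%:Z) (fun x => \sum_(1 <= t1 < n.+1) layer q t1 t2 * quad t1%:Z t2%:Z x) x)
    (\sum_(q < N) layer_bound q).
  apply: (@Lpbound_sum _ _ _ mu (M / 2) _ (index_enum 'I_N) xpredT (fun q x => \sum_(1 <= t2 < n.+1)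
    proj mu (t2%:Z - q%:Z) (fun x => \sum_(1 <= t1 < n.+1) layer q t1 t2 * quad t1%:Z t2%:Z x) x)) => // q _.
  exact: Lpbound_layer.
apply: (Lpbound_ae p0 hs).
  apply: measurable_sum => t1; apply: measurable_sum => t2; apply: measurable_funM => //.
  apply: measurable_sum => j; rewrite /P; case: (q0 t1 t2 <= j)%N => //.
  by case: (Lpbound_projB mu_mix (t2%:Z - j%:Z) p1 (Lpbound_quad t1%:Z t2%:Z)).
have e q t2 : {ae mu, forall x,
    proj mu (t2%:Z - q%:Z) (fun x => \sum_(1 <= t1 < n.+1) layer q t1 t2 * quad t1%:Z t2%:Z x) x =
    \sum_(1 <= t1 < n.+1) layer q t1 t2 * proj mu (t2%:Z - q%:Z) (quad t1%:Z t2%:Z) x}.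
  have e1 := condE_sum mu_mix (after (t2%:Z - q%:Z)) (index_iota 1 n.+1) (P := xpredT)
    (fun t1 => layer q t1 t2) p1 (fun t1 _ => Lpbound_quad t1%:Z t2%:Z).
  have e2 := condE_sum mu_mix (after (t2%:Z - q%:Z - 1)) (index_iota 1 n.+1) (P := xpredT)
    (fun t1 => layer q t1 t2) p1 (fun t1 _ => Lpbound_quad t1%:Z t2%:Z).
  move: e1 e2; apply: filterS2 => x E1 E2; rewrite /proj E1 E2 -sumrB.
  by apply: eq_bigr => t1 _; rewrite mulrBr.
have := @ae_eq_sum _ _ _ mu _ (index_enum 'I_N) xpredT _ _ (fun q _ =>
  @ae_eq_sum _ _ _ mu _ (index_iota 1 n.+1) xpredT _ _ (fun t2 _ => e q t2)).
apply: filterS => x ->.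
rewrite [RHS]exchange_big /=.
transitivity (\sum_(1 <= t2 < n.+1) \sum_(1 <= t1 < n.+1) \sum_(j < N) b t1 t2 * P t1 t2 j x); last first.
  by apply: eq_bigr => t2 _; apply: eq_bigr => t1 _; rewrite mulr_sumr.
rewrite exchange_big /=; apply: eq_bigr => t2 _.
rewrite exchange_big /=; apply: eq_bigr => t1 _; apply: eq_bigr => j _.
by rewrite /layer /P; case: ifP; rewrite ?mul0r ?mulr0.
Qed.

End Layers.

(* F_{t2} is centred given the innovations after t2, so only the part of F_{t1} that
   depends on the past of t2 contributes. *)
Lemma Lpbound_condE_quad (t1 t2 : nat) (J : pred int) : (t2 <= t1)%N ->
  (forall k, J k -> after t2%:Z k) ->
  Lpbound mu (M / 2) (condE mu J (quad t1%:Z t2%:Z)) (d%:R * (tl (t1 - t2)%N * K)).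
Proof.
move=> t21 Jt2.
pose G i x := (F t1%:Z i x - condE mu (after t2%:Z) (F t1%:Z i) x) * F t2%:Z i x.
pose G' i x := condE mu (after t2%:Z) (F t1%:Z i) x * F t2%:Z i x.
have hr i : Lpbound mu M (fun x => F t1%:Z i x - condE mu (after t2%:Z) (F t1%:Z i) x) (tl (t1 - t2)%N).
  by have := Lpbound_coord_tail t1%:Z i (t1 - t2)%N; rewrite subz_subn.
have hG i : Lpbound mu (M / 2) (G i) (tl (t1 - t2)%N * K).
  exact: LpboundM (hr i) (Lpbound_coord _ _).
have hG' i : Lpbound mu (M / 2) (G' i) (K * K).
  exact: LpboundM (Lpbound_condE mu_mix _ M1 (Lpbound_coord _ _)) (Lpbound_coord _ _).
have hGs : Lpbound mu (M / 2) (fun x => \sum_i 1 * G i x) (\sum_(i < d) `|1| * (tl (t1 - t2)%N * K)).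
  by apply: (@Lpbound_sum _ _ _ mu (M / 2) _ (index_enum 'I_d) xpredT (fun i x => 1 * G i x)) => // i _; exact: LpboundZ.
have hGs' : Lpbound mu (M / 2) (fun x => \sum_i 1 * G' i x) (\sum_(i < d) `|1| * (K * K)).
  by apply: (@Lpbound_sum _ _ _ mu (M / 2) _ (index_enum 'I_d) xpredT (fun i x => 1 * G' i x)) => // i _; exact: LpboundZ.
have -> : d%:R * (tl (t1 - t2)%N * K) = \sum_(i < d) `|1| * (tl (t1 - t2)%N * K).
  by rewrite normr1 sumr_const card_ord mul1r mulr_natl.
have quadE : quad t1%:Z t2%:Z = fun x => \sum_i 1 * G i x + \sum_i 1 * G' i x.
  apply/funext => x; rewrite /quad -big_split; apply: eq_bigr => i _.
  by rewrite /G /G' /= !mul1r -mulrDl subrK.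
have iq := Lpbound_integrable p1 (Lpbound_quad t1%:Z t2%:Z).
have iG := Lpbound_integrable p1 hGs; have iG' := Lpbound_integrable p1 hGs'.
have E0 : {ae mu, forall x, condE mu (after t2%:Z) (quad t1%:Z t2%:Z) x =
    condE mu (after t2%:Z) (fun x => \sum_i 1 * G i x) x}.
  rewrite quadE; have h1 := condED mu_mix (after t2%:Z) iG iG'.
  have h2 := condE_sum mu_mix (after t2%:Z) (index_enum 'I_d) (P := xpredT) (fun=> 1) p1 (fun i _ => hG' i).
  have h3 := @ae_eq_sum _ _ _ mu _ (index_enum 'I_d) xpredT _ _ (fun i _ =>
    condE_pull mu_mix (@condE_dep _ _ mu (after t2%:Z) (F t1%:Z i))
      (Lpbound_integrable M1 (Lpbound_coord t2%:Z i))).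
  move: h1 h2 h3; apply: filterS3 => x -> -> h3.
  under [X in _ + X = _]eq_bigr do rewrite mul1r.
  rewrite h3 [X in _ + X]big1 ?addr0// => i _.
  by rewrite condE_after_coord mulr0.
have iE1 := integrable_condE mu_mix (after t2%:Z) iq.
have iE2 := integrable_condE mu_mix (after t2%:Z) iG.
have E1 := condE_ae mu_mix J iE1 iE2 E0.
have E2 := condE_tower mu_mix J (after t2%:Z) iq.
have JE : predI J (after t2%:Z) =1 J.
  by move=> k /=; have [/Jt2 ->|] := boolP (J k); rewrite ?andbT.
rewrite (condE_eq mu _ JE) in E2.
apply: (Lpbound_ae p0 (Lpbound_condE mu_mix J p1 (Lpbound_condE mu_mix (after t2%:Z) p1 hGs))).
  by case: (Lpbound_condE mu_mix J p1 (Lpbound_quad t1%:Z t2%:Z)).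
by move: E1 E2; apply: filterS2 => x <- <-.
Qed.

(** * Explicit bounds under polynomial decay of the tails *)

Section Decay.
Variable al : R.
Hypothesis al4 : 4 < al.
Hypothesis tlE : forall u, tl u = K * (1 + u%:R) `^ (- al).

Lemma sum_tl_le L k : (0 < L)%N -> \sum_(j < k) tl (L + j)%N <= K * L%:R `^ (1 - al).
Proof.
move=> L0; under eq_bigr do rewrite tlE.
by rewrite -mulr_sumr ler_wpM2l// sum_powRN_le//; move: al4; lra.
Qed.

Lemma sum_dl_le k : \sum_(j < k) dl j <= K.
Proof. by have := dl_tail 0 k; rewrite tlE addr0 powR1 mulr1. Qed.

Let kappa := Num.sqrt (rio_const (M / 2)) * Num.sqrt 2.
Let kappa0 : 0 <= kappa. Proof. by rewrite mulr_ge0 ?sqrtr_ge0. Qed.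

(** The factor with [rio_const M] belongs to the main term, the 3 to [rho] plus twice [sigma], and 2
    K^2 to the two conditional expectations exchanged at the end of [Lpbound_far]. *)
Definition far_const := kappa * K ^+ 2 * (Num.sqrt (rio_const M) + 3) + 2 * K ^+ 2.

(** All layers from q = 0 on centre the product at its conditional expectation given [after t2]; by
    [Lpbound_condE_quad] both this and the one given J are small at lags at least L. Leaving J free
    covers the plain mean, with J empty, and the windows at large lags. *)
Lemma Lpbound_far n b L (J : nat -> nat -> pred int) : (0 < n)%N -> (0 < L)%N ->
  (forall t1 t2, `|b t1 t2| <= 1) ->
  (forall t1 t2, (t1 < t2 + L)%N -> b t1 t2 = 0) ->
  (forall t1 t2 k, (t2 + L <= t1)%N -> J t1 t2 k -> after t2%:Z k) ->
  Lpbound mu (M / 2) (fun x => \sum_(1 <= t1 < n.+1) \sum_(1 <= t2 < n.+1) b t1 t2 *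
    (quad t1%:Z t2%:Z x - condE mu (J t1 t2) (quad t1%:Z t2%:Z) x))
  (far_const * (Num.sqrt (d%:R * \sum_(1 <= t1 < n.+1) \sum_(1 <= t2 < n.+1) b t1 t2 ^+ 2) +
     d%:R * n%:R * L%:R `^ (1 - al))).
Proof.
move=> n0 L0 b1 bL hJ.
have b0 t1 t2 : (t1 <= t2)%N -> b t1 t2 = 0 by move=> h; apply: bL; rewrite (leq_ltn_trans h)// -{1}[t2]addn0 ltn_add2l.
set L' := L%:R `^ (1 - al); have L'0 : 0 <= L' by exact: powR_ge0.
have rhoP q t2 : (0 < t2 <= n)%N ->
    \sum_(1 <= t1 < n.+1) `|layer b (fun _ _ => 0%N) q t1 t2| * tl (t1 - t2)%N <= K * L'.
  move=> /andP[t20 _]; rewrite /layer /=.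
  apply: le_trans (sum_tl_le n L0).
  by apply: (sum_shift_le (c := fun t1 => b t1 t2)) => // t h; exact: bL.
have sigmaP q t2 : (0 < t2 <= n)%N ->
    \sum_(1 <= t1 < n.+1) `|layer b (fun _ _ => 0%N) q t1 t2| * dl (t1 - t2 + q)%N <= tl (L + q)%N.
  move=> /andP[t20 _]; rewrite /layer /=.
  apply: le_trans (dl_tail (L + q) n).
  under [leRHS]eq_bigr do rewrite addnAC.
  by apply: (sum_shift_le (f := fun u => dl (u + q)%N) (c := fun t1 => b t1 t2)) => // t h; exact: bL.
set nb := Num.sqrt _.
have nbE q : Num.sqrt d%:R * layer_norm n b (fun _ _ => 0%N) q = nb.
  by rewrite /layer_norm /nb sqrtrM.
have nb0 : 0 <= nb by exact: sqrtr_ge0.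
have [rM0 sM0] : 0 <= Num.sqrt (rio_const M) /\ 0 <= Num.sqrt n%:R :> R by rewrite !sqrtr_ge0.
pose c1 := kappa * (K * Num.sqrt (rio_const M) * K * nb +
   Num.sqrt n%:R * (d%:R * (K * L' * K + 2 * (K * L' * K)))).
have h1 := @Lpbound_layers n b (fun _ _ => 0%N) (fun=> K * L') (fun q => tl (L + q)%N)
  b0 rhoP sigmaP c1 n0.
have {}h1 : Lpbound mu (M / 2) (fun x => \sum_(1 <= t1 < n.+1) \sum_(1 <= t2 < n.+1) b t1 t2 *
    (quad t1%:Z t2%:Z x - condE mu (after (t2%:Z - 0%N%:Z)) (quad t1%:Z t2%:Z) x)) c1.
  apply: h1 => N.
  have -> : \sum_(q < N) layer_bound n b (fun _ _ => 0%N) (fun=> K * L') (fun q => tl (L + q)%N) q =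
    kappa * (K * Num.sqrt (rio_const M) * (\sum_(q < N) dl q) * nb +
      Num.sqrt n%:R * (d%:R * (K * L' * (\sum_(q < N) dl q) + 2 * ((\sum_(q < N) tl (L + q)%N) * K)))).
    rewrite /layer_bound -mulr_sumr big_split /=; congr (_ * (_ + _)).
      rewrite mulr_sumr mulr_suml; apply: eq_bigr => q _.
      by rewrite -(nbE q) tlE addr0 powR1; ring.
    rewrite -mulr_sumr -mulr_sumr big_split /= -mulr_sumr -mulr_sumr.
    by congr (_ * (_ * (_ + _ * _))); rewrite mulr_suml.
  rewrite /c1; apply: ler_wpM2l => //; apply: lerD.
    by rewrite ler_wpM2r// ler_wpM2l ?mulr_ge0// sum_dl_le.
  apply: ler_wpM2l => //; apply: ler_wpM2l => //; apply: lerD.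
    by rewrite ler_wpM2l ?mulr_ge0// sum_dl_le.
  by rewrite ler_wpM2l// ler_wpM2r// sum_tl_le.
have hT t1 t2 : (0 < t1 <= n)%N -> (0 < t2 <= n)%N -> Lpbound mu (M / 2) (fun x => b t1 t2 *
    (condE mu (after t2%:Z) (quad t1%:Z t2%:Z) x - condE mu (J t1 t2) (quad t1%:Z t2%:Z) x))
    (`|b t1 t2| * tl (t1 - t2)%N * (2 * (d%:R * K))).
  move=> _ _; have [lt|le] := ltnP t1 (t2 + L).
    rewrite bL// normr0 !mul0r; apply: (eq_Lpbound (f := fun=> 0)); last exact: Lpbound0.
    by move=> x; rewrite mul0r.
  have -> : `|b t1 t2| * tl (t1 - t2)%N * (2 * (d%:R * K)) =
     `|b t1 t2| * (d%:R * (tl (t1 - t2)%N * K) + d%:R * (tl (t1 - t2)%N * K)) by ring.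
  have t21 : (t2 <= t1)%N := leq_trans (leq_addr _ _) le.
  apply: LpboundZ => //; apply: LpboundB => //; apply: Lpbound_condE_quad => // k.
  exact: hJ.
(* These corrections are added by the triangle inequality, which gives a factor n where the layers
   gave sqrt n. *)
have h2 : Lpbound mu (M / 2) (fun x => \sum_(1 <= t2 < n.+1) \sum_(1 <= t1 < n.+1) b t1 t2 *
    (condE mu (after t2%:Z) (quad t1%:Z t2%:Z) x - condE mu (J t1 t2) (quad t1%:Z t2%:Z) x))
    (\sum_(1 <= t2 < n.+1) (K * L') * (2 * (d%:R * K))).
  rewrite big_nat; apply: (eq_Lpbound (f := fun x => \sum_(1 <= t2 < n.+1 | (1 <= t2 < n.+1)%N)
    \sum_(1 <= t1 < n.+1 | (1 <= t1 < n.+1)%N) b t1 t2 *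
    (condE mu (after t2%:Z) (quad t1%:Z t2%:Z) x - condE mu (J t1 t2) (quad t1%:Z t2%:Z) x))).
    by move=> x; rewrite [RHS]big_nat; apply: eq_bigr => t2 _; rewrite [RHS]big_nat.
  apply: (@Lpbound_sum _ _ _ mu (M / 2) _ _ _ (fun t2 x => \sum_(1 <= t1 < n.+1 | (1 <= t1 < n.+1)%N) b t1 t2 *
    (condE mu (after t2%:Z) (quad t1%:Z t2%:Z) x - condE mu (J t1 t2) (quad t1%:Z t2%:Z) x))) => // t2 ht2.
  have le := rhoP 0%N t2 ht2; rewrite /layer /= in le.
  have c0 : 0 <= 2 * (d%:R * K) by rewrite !mulr_ge0.
  apply: (Lpbound_le (ler_wpM2r c0 le)); rewrite mulr_suml big_nat.
  apply: (@Lpbound_sum _ _ _ mu (M / 2) _ _ _ (fun t1 x => b t1 t2 *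
    (condE mu (after t2%:Z) (quad t1%:Z t2%:Z) x - condE mu (J t1 t2) (quad t1%:Z t2%:Z) x))) => // t1 ht1.
  exact: hT.
apply: (Lpbound_le _ (eq_Lpbound _ (LpboundD p1 h1 h2))); last first.
  move=> x; rewrite [X in _ + X]exchange_big -big_split; apply: eq_bigr => t1 _ /=.
  by rewrite -big_split; apply: eq_bigr => t2 _ /=; rewrite subr0; ring.
have sn := sqrt_nat_le R n0.
rewrite sumr_const_nat subSS subn0 -(mulr_natl _ n) /c1 /far_const.
have K2 : 0 <= K ^+ 2 by exact: sqr_ge0.
have x1 : 0 <= kappa * K ^+ 2 by rewrite mulr_ge0.
have x2 : 0 <= d%:R * L' :> R by rewrite mulr_ge0.
have y1 : 0 <= kappa * K ^+ 2 * nb * 3 by rewrite !mulr_ge0.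
have y2 : 0 <= kappa * K ^+ 2 * (Num.sqrt (rio_const M)) * (d%:R * L') * n%:R.
  by rewrite !mulr_ge0.
have y3 : 0 <= K ^+ 2 * nb by rewrite !mulr_ge0.
have y4 : Num.sqrt n%:R * (kappa * K ^+ 2 * (d%:R * L')) <= n%:R * (kappa * K ^+ 2 * (d%:R * L')).
  by rewrite ler_wpM2r// mulr_ge0.
nra.
Qed.

(** 2^al comes from replacing l / 2 by l in the sum of [rho q * dl q], and 4 from the sum of
    [sigma]. *)
Definition near_const :=
  kappa * (K * Num.sqrt (rio_const M) + K ^+ 2 * (2 `^ al + 4)).

(** For t2 < t1 <= t2 + l it satisfies t2 - near_start = t1 - l - 1, so the expansion starts exactly
    at the edge of the window. *)
Definition near_start (l t1 t2 : nat) : nat := l.+1 - (t1 - t2).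

Let half_powR (l : nat) : (0 < l)%N -> (l./2.+1)%:R `^ (1 - al) <= 2 `^ (al - 1) * l%:R `^ (1 - al) :> R.
Proof.
move=> l0; have l0' : 0 < l%:R :> R by rewrite ltr0n.
have -> : 1 - al = - (al - 1) by lra.
have h : l%:R / 2 <= (l./2.+1)%:R :> R.
  rewrite ler_pdivrMr// -natrM ler_nat.
  exact: ltnW (half_lt_succ l).
have a0 : 0 <= al - 1 by move: al4; lra.
have h0 : 0 < l%:R / 2 :> R by rewrite divr_gt0.
apply: (le_trans (powRN_le h0 h a0)).
rewrite powRM ?(ltW l0')// ?invr_ge0// mulrC.
have -> : 2^-1 `^ (- (al - 1)) = 2 `^ (al - 1) :> R; last by [].
by rewrite -powR_inv1// -powRrM mulN1r opprK.
Qed.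

(** The decay in l has two sources: layers with small q contain only pairs at large lag, and layers
    with large q carry a small [dl q]. The two are separated at q = l / 2. *)
Lemma Lpbound_near n b l c : (0 < n)%N -> (0 < l)%N ->
  (forall t1 t2, `|b t1 t2| <= 1) ->
  (forall t1 t2, ~~ (t2 < t1 <= t2 + l)%N -> b t1 t2 = 0) ->
  (forall N, \sum_(q < N) dl q * (Num.sqrt d%:R * layer_norm n b (near_start l) q) <= c) ->
  Lpbound mu (M / 2) (fun x => \sum_(1 <= t1 < n.+1) \sum_(1 <= t2 < n.+1) b t1 t2 *
    (quad t1%:Z t2%:Z x - condE mu (after (t1%:Z - l%:Z - 1)) (quad t1%:Z t2%:Z) x))
  (near_const * (c + d%:R * Num.sqrt n%:R * l%:R `^ (1 - al))).
Proof.
move=> n0 l0 b1 bS hc.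
have b0 t1 t2 : (t1 <= t2)%N -> b t1 t2 = 0.
  by move=> h; apply: bS; rewrite ltnNge h.
set L' := l%:R `^ (1 - al); have L'0 : 0 <= L' by exact: powR_ge0.
set h := l./2.
set H' := (h.+1)%:R `^ (1 - al) : R; have H'0 : 0 <= H' by exact: powR_ge0.
have c1 q t1 t2 : `|layer b (near_start l) q t1 t2| <= 1.
  by rewrite /layer; case: ifP => // _; rewrite normr0.
have lsupp q t1 t2 : (t1 < t2 + maxn 1 (l.+1 - q))%N -> layer b (near_start l) q t1 t2 = 0.
  move=> lt; rewrite /layer; case: ifP => // hq; apply: bS.
  exact: before_near_start lt hq.
(* For q <= l/2 the lags in the layer are at least l + 1 - q > l/2; for larger q the plain bound K
   is kept and the tail of [dl] beyond l/2 provides the decay. *)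
pose rho q := K * (if (q <= h)%N then H' else 1).
(* Lags in layer q are at least max(1, l + 1 - q); adding q gives at least max(l, q) + 1. *)
pose sigma q := tl (maxn l q).+1.
have rhoP q t2 : (0 < t2 <= n)%N ->
    \sum_(1 <= t1 < n.+1) `|layer b (near_start l) q t1 t2| * tl (t1 - t2)%N <= rho q.
  move=> /andP[t20 _]; rewrite /rho; case: ifP => qh.
    apply: le_trans (sum_tl_le n (ltn0Sn h)).
    apply: (sum_shift_le (c := fun t1 => layer b (near_start l) q t1 t2)) => // t ht.
    by apply: lsupp; rewrite (leq_trans ht)// leq_add2l leq_max half_succ_le_sub ?orbT.
  have := sum_tl_le n (ltn0Sn 0); rewrite powR1; apply: le_trans.
  apply: (sum_shift_le (c := fun t1 => layer b (near_start l) q t1 t2)) => // t ht.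
  by apply: lsupp; rewrite (leq_trans ht)// leq_add2l leq_max.
have sigmaP q t2 : (0 < t2 <= n)%N ->
    \sum_(1 <= t1 < n.+1) `|layer b (near_start l) q t1 t2| * dl (t1 - t2 + q)%N <= sigma q.
  move=> /andP[t20 _]; apply: le_trans (dl_tail (maxn l q).+1 n).
  rewrite maxn_sub_add.
  under [leRHS]eq_bigr do rewrite addnAC.
  by apply: (sum_shift_le (f := fun u => dl (u + q)%N) (c := fun t1 => layer b (near_start l) q t1 t2)) => // t ht; exact: lsupp.
have sumrho N : \sum_(q < N) rho q * dl q <= 2 * K ^+ 2 * H'.
  have split q : rho q * dl q <= K * H' * dl q + K * (if (h.+1 <= q)%N then dl q else 0).
    rewrite /rho; case: ifP => qh.
      by rewrite lerDl mulr_ge0//; case: ifP.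
    by rewrite ltnNge qh /= mulr1 lerDr !mulr_ge0.
  apply: (@le_trans _ _ (\sum_(q < N) (K * H' * dl q +
      K * (if (h.+1 <= q)%N then dl q else 0)))).
    by apply: ler_sum => q _; exact: split.
  rewrite big_split /= -!mulr_sumr.
  have e1 : \sum_(q < N) dl q <= K by exact: sum_dl_le.
  have e2 : \sum_(q < N) (if (h.+1 <= q)%N then dl q else 0) <= K * H'.
    apply: (@le_trans _ _ (\sum_(q < h.+1 + N) (if (h.+1 <= q)%N then dl q else 0))).
      rewrite addnC big_split_ord /= lerDl; apply: sumr_ge0 => q _.
      by case: ifP.
    rewrite sum_from big_split_ord /= addrAC subrr add0r.
    apply: (le_trans (dl_tail h.+1 N)); rewrite tlE ler_wpM2l//.
    have hp : 0 < (h.+1)%:R :> R by rewrite ltr0n.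
    have hp1 : 1 <= (h.+1)%:R :> R by rewrite ler1n.
    have a0 : 0 <= al by move: al4; lra.
    apply: (@le_trans _ _ ((h.+1)%:R `^ (- al))); first by apply: powRN_le => //; lra.
    by apply: ler_powR => //; lra.
  have := ler_wpM2l (mulr_ge0 K0 H'0) e1; have := ler_wpM2l K0 e2.
  by rewrite expr2; lra.
(* The first l terms all equal [tl l.+1], and l times this is at most K l^(1 - al); the remaining
   terms form a tail sum of the same order. *)
have sumsigma N : \sum_(q < N) sigma q <= 2 * K * L'.
  apply: (@le_trans _ _ (\sum_(q < l + N) sigma q)).
    by rewrite addnC big_split_ord /= lerDl; apply: sumr_ge0 => q _; exact: tl0.
  rewrite big_split_ord /=.
  have e1 : \sum_(i < l) sigma i <= K * L'.
    rewrite (eq_bigr (fun=> tl l.+1)); last first.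
      by move=> i _; rewrite /sigma (maxn_idPl (ltnW (ltn_ord i))).
    rewrite sumr_const card_ord -(mulr_natl _ l) tlE mulrCA ler_wpM2l//.
    have lp : 0 < l%:R :> R by rewrite ltr0n.
    have -> : L' = l%:R * l%:R `^ (- al).
      by rewrite /L' powRD ?(gt_eqF lp) ?implybT// (powRr1 (ltW lp)).
    apply: ler_wpM2l => //; apply: powRN_le => //; last by move: al4; lra.
    by rewrite -natr1; lra.
  have e2 : \sum_(i < N) sigma (l + i)%N <= K * L'.
    rewrite (eq_bigr (fun i : 'I_N => tl (l.+1 + i)%N)); last first.
      by move=> i _; rewrite /sigma (maxn_idPr (leq_addr _ _)) addSn.
    apply: (le_trans (sum_tl_le N (ltn0Sn l))); rewrite ler_wpM2l// /L'.
    have -> : 1 - al = - (al - 1) by lra.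
    apply: powRN_le; [by rewrite ltr0n| |by move: al4; lra].
    by rewrite ler_nat.
  lra.
have [rM0 sM0] : 0 <= Num.sqrt (rio_const M) /\ 0 <= Num.sqrt n%:R :> R by rewrite !sqrtr_ge0.
have cge0 : 0 <= c by have := hc 0%N; rewrite big_ord0.
have h1 := @Lpbound_layers n b (near_start l) rho sigma b0 rhoP sigmaP
  (near_const * (c + d%:R * Num.sqrt n%:R * L')) n0.
apply: (eq_Lpbound _ (h1 _)) => [x|N].
  apply: eq_bigr => t1 _; apply: eq_bigr => t2 _.
  have [hS|/bS ->] := boolP (t2 < t1 <= t2 + l)%N; last by rewrite !mul0r.
  by rewrite /near_start near_start_time.
have -> : \sum_(q < N) layer_bound n b (near_start l) rho sigma q =
  kappa * (K * Num.sqrt (rio_const M) *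
      (\sum_(q < N) dl q * (Num.sqrt d%:R * layer_norm n b (near_start l) q)) +
    Num.sqrt n%:R * (d%:R * (\sum_(q < N) rho q * dl q + 2 * ((\sum_(q < N) sigma q) * K)))).
  rewrite /layer_bound -mulr_sumr big_split /=; congr (_ * (_ + _)).
    rewrite mulr_sumr; apply: eq_bigr => q _.
    by rewrite tlE addr0 powR1; ring.
  rewrite -mulr_sumr -mulr_sumr big_split /= -mulr_sumr.
  by congr (_ * (_ * (_ + _ * _))); rewrite mulr_suml.
have K2 : 0 <= K ^+ 2 by exact: sqr_ge0.
have hH : 2 * H' <= 2 `^ al * L'.
  rewrite powR2_split.
  by have := half_powR l0; rewrite -/h -/H' -/L'; lra.
have E1 : \sum_(q < N) rho q * dl q + 2 * ((\sum_(q < N) sigma q) * K) <=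
    K ^+ 2 * (2 `^ al + 4) * L'.
  have := ler_wpM2l K2 hH; have := sumrho N; have := ler_wpM2r K0 (sumsigma N).
  by rewrite expr2; lra.
have nd0 : 0 <= Num.sqrt n%:R * d%:R :> R by rewrite mulr_ge0.
have kM0 : 0 <= K * Num.sqrt (rio_const M) by rewrite mulr_ge0.
have A1 := ler_wpM2l kM0 (hc N).
have A2 := ler_wpM2l nd0 E1.
have B1 : 0 <= K * Num.sqrt (rio_const M) * (d%:R * Num.sqrt n%:R * L') by rewrite !mulr_ge0.
have B2 : 0 <= K ^+ 2 * (2 `^ al + 4) * c.
  by rewrite !mulr_ge0// addr_ge0// powR_ge0.
rewrite /near_const -(mulrA kappa); apply: ler_wpM2l => //.
by move: A1 A2 B1 B2; rewrite !mulrDl !mulrDr !mulrA; lra.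
Qed.

Variables (n : nat) (b : nat -> nat -> R).
Hypothesis n0 : (0 < n)%N.
Hypothesis b1 : forall t1 t2, (0 < t1 <= n)%N -> (0 < t2 <= n)%N -> `|b t1 t2| <= 1.

Let flip_b1 b' : b' = b \/ b' = flip b ->
  forall t1 t2, (0 < t1 <= n)%N -> (0 < t2 <= n)%N -> `|b' t1 t2| <= 1.
Proof. by case=> -> t1 t2 h1 h2; apply: b1. Qed.

Let flip_sqr b' (Q : pred nat) : b' = b \/ b' = flip b ->
  \sum_(1 <= t1 < n.+1) \sum_(1 <= t2 < n.+1 | Q (dist_nat t1 t2)) b' t1 t2 ^+ 2 =
  \sum_(1 <= t1 < n.+1) \sum_(1 <= t2 < n.+1 | Q (dist_nat t1 t2)) b t1 t2 ^+ 2.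
Proof. by case=> ->//; exact: sum_flip_sqr. Qed.

Lemma quadC t1 t2 : quad t1 t2 = quad t2 t1.
Proof. by apply/funext => x; apply: eq_bigr => i _; rewrite mulrC. Qed.

Lemma far_const_ge0 : 0 <= far_const.
Proof. by rewrite /far_const; do !rewrite ?addr_ge0 ?mulr_ge0 ?sqr_ge0 ?sqrtr_ge0. Qed.

Lemma near_const_ge0 : 0 <= near_const.
Proof.
by rewrite /near_const; do !rewrite ?addr_ge0 ?mulr_ge0 ?sqr_ge0 ?sqrtr_ge0 ?powR_ge0.
Qed.

Lemma Lpbound_centered L : (0 < L)%N ->
  (forall t1 t2, (0 < t1 <= n)%N -> (0 < t2 <= n)%N -> (dist_nat t1 t2 < L)%N -> b t1 t2 = 0) ->
  Lpbound mu (M / 2) (fun x => \sum_(1 <= t1 < n.+1) \sum_(1 <= t2 < n.+1) b t1 t2 *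
    (quad t1%:Z t2%:Z x - \int[mu]_x quad t1%:Z t2%:Z x))
  (2 * (far_const * (Num.sqrt (d%:R * \sum_(1 <= t1 < n.+1) \sum_(1 <= t2 < n.+1) b t1 t2 ^+ 2) +
     d%:R * n%:R * L%:R `^ (1 - al)))).
Proof.
move=> L0 bL.
apply: (Lpbound_lower (f := fun t1 t2 x => quad t1%:Z t2%:Z x - \int[mu]_x quad t1%:Z t2%:Z x)) => //.
- by move=> t ht; apply: bL => //; rewrite dist_natxx.
- by move=> t1 t2; rewrite quadC.
move=> b' hb'; have b'1 := flip_b1 hb'.
have b'L t1 t2 : (0 < t1 <= n)%N -> (0 < t2 <= n)%N -> (dist_nat t1 t2 < L)%N -> b' t1 t2 = 0.
  by move: hb' => [->|->] h1 h2; [|rewrite dist_natC]; apply: bL.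
have := @Lpbound_far n (lower n b') L (fun _ _ => pred0) n0 L0
  (fun t1 t2 => lower_le1 t1 t2 b'1) (fun t1 t2 => lower_eq0 b'L) (fun _ _ _ _ h => ltac:(by [])).
move=> h; apply: Lpbound_le (eq_Lpbound _ h) => [|x].
  rewrite ler_wpM2l ?far_const_ge0// lerD2r ler_wsqrtr// ler_wpM2l//.
  rewrite -(flip_sqr predT hb').
  exact: (sum_lower_sqr n b' predT).
by apply: eq_bigr => t1 _; apply: eq_bigr => t2 _; congr (_ * (_ - _)).
Qed.

(** Pairs at lag at most l fall under [Lpbound_near]. At larger lags t2 <= t1 - l - 1, so the
    conditioning set lies in the future of t2 and [Lpbound_far] applies with gap l + 1. *)
Lemma Lpbound_window l B c : (0 < l)%N -> (0 < B)%N ->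
  (forall t1 t2, (0 < t1 <= n)%N -> (0 < t2 <= n)%N -> (dist_nat t1 t2 < B)%N -> b t1 t2 = 0) ->
  (forall N, \sum_(1 <= q < N) dl q * Num.sqrt (d%:R *
     \sum_(1 <= t1 < n.+1) \sum_(1 <= t2 < n.+1 | (maxn B (l.+1 - q) <= dist_nat t1 t2 <= l)%N)
        b t1 t2 ^+ 2) <= c) ->
  Lpbound mu (M / 2) (fun x => \sum_(1 <= t1 < n.+1) \sum_(1 <= t2 < n.+1) b t1 t2 *
    (quad t1%:Z t2%:Z x -
     condE mu (after ((maxn t1 t2)%:Z - l%:Z - 1)) (quad t1%:Z t2%:Z) x))
  (2 * (near_const * (c + d%:R * Num.sqrt n%:R * l%:R `^ (1 - al)) +
    far_const * (Num.sqrt (d%:R *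
       \sum_(1 <= t1 < n.+1) \sum_(1 <= t2 < n.+1 | (l < dist_nat t1 t2)%N) b t1 t2 ^+ 2) +
     d%:R * n%:R * l.+1%:R `^ (1 - al)))).
Proof.
move=> l0 B0 bB hc.
apply: (Lpbound_lower (f := fun t1 t2 x => quad t1%:Z t2%:Z x -
     condE mu (after ((maxn t1 t2)%:Z - l%:Z - 1)) (quad t1%:Z t2%:Z) x)) => //.
- by move=> t ht; apply: bB => //; rewrite dist_natxx.
- by move=> t1 t2; rewrite quadC maxnC.
move=> b' hb'; have b'1 := flip_b1 hb'.
have b'B t1 t2 : (0 < t1 <= n)%N -> (0 < t2 <= n)%N -> (dist_nat t1 t2 < B)%N -> b' t1 t2 = 0.
  by move: hb' => [->|->] h1 h2; [|rewrite dist_natC]; apply: bB.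
pose part (Q : pred nat) t1 t2 := if Q (t1 - t2)%N then lower n b' t1 t2 else 0.
have part1 Q t1 t2 : `|part Q t1 t2| <= 1.
  by rewrite /part; case: ifP => _; [exact: lower_le1|rewrite normr0].
have near : Lpbound mu (M / 2) (fun x => \sum_(1 <= t1 < n.+1) \sum_(1 <= t2 < n.+1)
    part (fun k => k <= l)%N t1 t2 *
    (quad t1%:Z t2%:Z x - condE mu (after (t1%:Z - l%:Z - 1)) (quad t1%:Z t2%:Z) x))
    (near_const * (c + d%:R * Num.sqrt n%:R * l%:R `^ (1 - al))).
  apply: Lpbound_near => //.
    move=> t1 t2; rewrite /part /lower; case: ifP => // h1; case: ifP => // /and3P[h2 h3 h4].
    by lia.
  move=> N; apply: le_trans (hc N); case: N => [|N]; first by rewrite big_ord0 big_geq.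
  rewrite big_ord_recl big_add1 /= big_mkord.
  (* At lags up to l the expansion starts at 1 or later, so layer 0 is empty and the sum begins at q
     = 1. *)
  have -> : layer_norm n (part (fun k => k <= l)%N) (near_start l) 0 = 0.
    rewrite /layer_norm big1 ?sqrtr0// => t1 _; rewrite big1// => t2 _.
    rewrite /layer /near_start /part; case: ifP => // h1; last by rewrite expr0n.
    case: ifP => // h2; last by rewrite expr0n.
    by lia.
  rewrite !mulr0 add0r; apply: ler_sum => q _; rewrite ler_wpM2l//.
  rewrite /layer_norm -sqrtrM// ler_wsqrtr// ler_wpM2l//.
  (* In this shifted sum q stands for layer q + 1. Membership in that layer forces the lag to be at
     least l + 1 - (q + 1), and the coefficients vanish below B. *)
  pose Q k := (maxn B (l.+1 - q.+1) <= k <= l)%N.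
  apply: le_trans (_ : \sum_(1 <= t1 < n.+1) \sum_(1 <= t2 < n.+1) part Q t1 t2 ^+ 2 <= _).
    apply: ler_sum => t1 _; apply: ler_sum => t2 _; rewrite /layer /near_start /part.
    case: ifP => h1; last by rewrite expr0n sqr_ge0.
    case: ifP => h2; last by rewrite expr0n sqr_ge0.
    have [h3|h3] := boolP (Q (t1 - t2)%N) => //.
    rewrite (lower_eq0 b'B) ?expr0n ?sqr_ge0//; move: h1 h2 h3 B0; rewrite /Q /bump /=; clear; lia.
  by rewrite -(flip_sqr Q hb'); exact: sum_lower_sqr.
have far : Lpbound mu (M / 2) (fun x => \sum_(1 <= t1 < n.+1) \sum_(1 <= t2 < n.+1)
    part (fun k => l < k)%N t1 t2 *
    (quad t1%:Z t2%:Z x - condE mu (after (t1%:Z - l%:Z - 1)) (quad t1%:Z t2%:Z) x))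
    (far_const * (Num.sqrt (d%:R *
       \sum_(1 <= t1 < n.+1) \sum_(1 <= t2 < n.+1 | (l < dist_nat t1 t2)%N) b t1 t2 ^+ 2) +
     d%:R * n%:R * l.+1%:R `^ (1 - al))).
  apply: Lpbound_le (@Lpbound_far n (part (fun k => l < k)%N) l.+1
    (fun t1 t2 => after (t1%:Z - l%:Z - 1)) n0 _ _ _ _) => //.
  - rewrite ler_wpM2l ?far_const_ge0// lerD2r ler_wsqrtr// ler_wpM2l//.
    by rewrite -(flip_sqr (fun k => l < k)%N hb'); exact: sum_lower_sqr.
  - move=> t1 t2 h; rewrite /part; case: ifP => //; lia.
  - by move=> t1 t2 k; rewrite /after; lia.
apply: eq_Lpbound (LpboundD p1 near far) => x.
rewrite -big_split; apply: eq_bigr => t1 _; rewrite -big_split; apply: eq_bigr => t2 _ /=.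
rewrite -mulrDl /part.
have [h|h] := leqP (t1 - t2)%N l; rewrite ?addr0 ?add0r; rewrite /lower;
  (case: ifP => [/and3P[h1 _ _]|_]; last by rewrite !mul0r);
  by rewrite (maxn_idPl (ltnW h1)).
Qed.

End Decay.

End FixedSampleSize.

(** * Transfer to the original probability space *)

Section Transfer.
Context (R : realType) (disp : measure_display) (Omega : measurableType disp).
Variables (P : probability Omega R) (e edag : int -> {RV P >-> R}).

Lemma Lpbound_law p (f : paths R int -> R) c : measurable_fun setT f ->
  Lpbound (law e) p f c <-> Lpbound P p (fun w => f (joint e w)) c.
Proof.
move=> mf.
have E : ('N[law e]_p%:E[EFin \o f] = 'N[P]_p%:E[EFin \o (fun w => f (joint e w))])%E.
  rewrite unlock /Lnorm; congr (_ `^ _)%E.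
  rewrite (@ge0_integral_pushforward _ _ _ _ _ _ (measurable_joint e) P setT
    (fun x => (`|(EFin \o f) x| `^ p)%E))//.
    exact/measurable_EFinP/measurable_powR_norm.
  by move=> x _; exact: poweR_ge0.
rewrite /Lpbound E; split=> -[_ h]; split => //.
exact: (measurableT_comp mf (measurable_joint e)).
Qed.

Hypothesis inde : mutually_independent P (fun t => e t : Omega -> R).
Hypothesis copy : independent_copy e edag.

Lemma mix_invariant_e : mix_invariant (law e).
Proof. exact: mix_invariant_law. Qed.

(** Bounds on the coupled process, known on [Omega], are moved to the product of two path spaces by
    [pair_law]. *)
Lemma Lpbound_pair p (f : paths R int * paths R int -> R) c : 0 < p -> measurable_fun setT f ->
  Lpbound P p (fun w => f (joint e w, joint edag w)) c ->
  Lpbound (law e \x law e)%E p f c.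
Proof.
move=> p0 mf hf; have c0 := Lpbound_ge0 hf; have mp := Lpbound_meas hf.
apply/LpboundP => //; move/LpboundP: hf => /(_ p0 c0 mp); apply: le_trans.
have mpair : measurable_fun setT (fun w => (joint e w, joint edag w)).
  by apply: measurable_fun_pair; exact: measurable_joint.
rewrite le_eqVlt; apply/orP; left; apply/eqP.
transitivity (\int[pushforward P (fun w => (joint e w, joint edag w))]_z (`|f z| `^ p)%:E)%E.
  apply: eq_measure_integral => A mA _.
  have [ind same] := copy.
  apply: esym; apply: (@pair_law _ _ _ P int e edag inde _ same A mA).
  have -> // : (fun i : int + int => (match i with inl t => e t | inr t => edag t end
    : {RV P >-> R}) : Omega -> R) = (fun i => match i with inl t => e t : Omega -> R | inr t => edag t end).
  by apply/funext => -[].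
rewrite (@ge0_integral_pushforward _ _ _ _ _ _ mpair P setT (fun z => (`|f z| `^ p)%:E))//.
exact/measurable_EFinP/measurable_powR_norm.
Qed.

Lemma integral_law (f : paths R int -> R) : (law e).-integrable setT (EFin \o f) ->
  (\int[P]_w (f (joint e w))%:E = (\int[law e]_x f x)%:E)%E.
Proof.
move=> fi; rewrite /Rintegral fineK ?integrable_fin_num//.
have mf := measurable_int _ fi.
rewrite (@integral_pushforward _ _ _ _ _ _ (measurable_joint e) P setT (fun x => (f x)%:E) mf)//.
apply/integrableP; split; first exact: (measurableT_comp mf (measurable_joint e)).
case/integrableP : fi => _; apply: le_lt_trans.
rewrite (@ge0_integral_pushforward _ _ _ _ _ _ (measurable_joint e) P setT
  (fun x => `|(f x)%:E|)%E)//.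
exact: measurableT_comp.
Qed.

End Transfer.

(** * Comparison with arbitrary versions of the conditional expectation *)

Section CondExpUnique.
Context (R : realType) (disp : measure_display) (Omega : measurableType disp).
Variables (P : probability Omega R) (G : set (set Omega)).
Hypothesis GM : <<s G >> `<=` measurable.

Lemma sub_sigma_measurable (Y : Omega -> R) :
  (forall A : set R, measurable A -> <<s G >> (Y @^-1` A)) ->
  measurable_fun (setT : set (g_sigma_algebraType G)) Y.
Proof. by move=> h _ A mA; rewrite setTI; exact: h. Qed.

(** The set where Y >= W belongs to the sub-sigma-algebra, as does its complement; integrating Y - W
    over both shows that |Y - W| has integral 0. *)
Lemma condexp_unique (Y W : Omega -> R) :
  (forall A : set R, measurable A -> <<s G >> (Y @^-1` A)) ->
  (forall A : set R, measurable A -> <<s G >> (W @^-1` A)) ->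
  P.-integrable setT (EFin \o Y) -> P.-integrable setT (EFin \o W) ->
  (forall A, <<s G >> A -> (\int[P]_(w in A) (Y w)%:E = \int[P]_(w in A) (W w)%:E)%E) ->
  {ae P, forall w, Y w = W w}.
Proof.
move=> GY GW iY iW eqA.
pose D := [set w | 0 <= Y w - W w].
have GD : <<s G >> D.
  have mD := measurable_funB (sub_sigma_measurable GY) (sub_sigma_measurable GW).
  have := mD measurableT _ (measurable_itv `[0, +oo[).
  by rewrite setTI; congr <<s _ >>; apply/seteqP; split => w /=; rewrite in_itv /= andbT.
have mD := GM GD.
have iYW : P.-integrable setT (EFin \o (fun w => Y w - W w)).
  exact: (integrableB measurableT iY iW).
have mYW := measurable_int _ iYW.
have zero A : <<s G >> A -> (\int[P]_(w in A) ((Y w - W w)%:E) = 0)%E.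
  move=> GA; have mA := GM GA.
  under eq_integral do rewrite EFinB.
  rewrite integralB//; last 2 first.
  - exact: integrableS iY.
  - exact: integrableS iW.
  rewrite (eqA A GA) subee// integrable_fin_num//; exact: integrableS iW.
have GDC : <<s G >> (~` D) by exact: sigma_algebraC.
have mDC := GM GDC.
have : (\int[P]_w `|(Y w - W w)%:E| = 0)%E.
  rewrite -(setUv D) ge0_integral_setU//; last 2 first.
  - by rewrite setUv; apply: measurableT_comp.
  - by rewrite disj_set2E setICr.
  rewrite (eq_integral (fun w => (Y w - W w)%:E)); last first.
    by move=> w; rewrite inE => h; rewrite gee0_abs.
  rewrite [X in (_ + X)%E](eq_integral (fun w => - (Y w - W w)%:E)%E); last first.
    move=> w; rewrite inE => /negP; rewrite -ltNge => h.
    by rewrite lte0_abs.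
  rewrite integralN ?zero//; last first.
    exact: (integrable_add_def mDC (integrableS measurableT mDC (@subsetT _ _) iYW)).
  by rewrite oppe0 adde0.
move/(ae_eq_integral_abs P measurableT mYW).
by apply: filterS => w /(_ Logic.I) [] /eqP; rewrite subr_eq0 => /eqP.
Qed.

End CondExpUnique.

Section Window.
Context (R : realType) (disp : measure_display) (Omega : measurableType disp).
Variables (P : probability Omega R) (e : int -> {RV P >-> R}).
Hypothesis inde : mutually_independent P (fun t => e t : Omega -> R).
Variable J : pred int.

Definition window_sets : set (set Omega) :=
  \bigcup_(i in [set i | J i]) preimage_set_system setT (e i) measurable.

Lemma window_sets_measurable : <<s window_sets >> `<=` measurable.
Proof.
apply: smallest_sub; first exact: sigma_algebra_measurable.
move=> _ [i Ji [A mA <-]].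
have me : measurable_fun setT (e i) by exact: measurable_funP.
exact: me.
Qed.

Let restrict (w : Omega) : paths R int := mix J (joint e w) (fun=> 0).

(** h sees the path only through [restrict], which fills the coordinates outside J with 0 and is
    measurable for the window. *)
Lemma window_measurable (h : paths R int -> R) (A : set R) :
  measurable_fun setT h -> depends_on J h -> measurable A ->
  <<s window_sets >> ((fun w => h (joint e w)) @^-1` A).
Proof.
move=> mh Jh mA.
have mr : measurable_fun (setT : set (g_sigma_algebraType window_sets)) restrict.
  apply: measurable_into_paths => i; rewrite /restrict /mix /joint.
  case E: (J i); last exact: measurable_cst.
  move=> _ B mB; apply: sub_sigma_algebra.
  by exists i; [exact: E|exists B].
have := (measurableT_comp mh mr) measurableT A mA.
rewrite setTI; congr <<s _ >>; apply/seteqP; split=> w /=;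
  by rewrite /restrict depends_on_mix.
Qed.

Lemma window_preimage (A : set Omega) : <<s window_sets >> A ->
  exists2 A', measurable A' & A = restrict @^-1` A'.
Proof.
have : <<s window_sets >> `<=` preimage_set_system setT restrict measurable.
  apply: smallest_sub.
    apply: sigma_algebra_preimage; exact: sigma_algebra_measurable.
  move=> _ [i Ji [B mB <-]].
  exists ((fun x : paths R int => x i) @^-1` B).
    by rewrite -[X in measurable X]setTI; exact: measurable_coord.
  by rewrite !setTI; apply/seteqP; split => w; rewrite /restrict /mix /joint /= Ji.
by move=> h /h [A' mA' <-]; exists A' => //; rewrite setTI.
Qed.

(** K may exceed J as long as the result depends on J alone: the indicators of window sets are then
    functions of coordinates in K and can be pulled out of [condE]. *)
Lemma condE_version (K : pred int) (f : paths R int -> R) :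
  (forall i, J i -> K i) -> depends_on J (condE (law e) K f) ->
  (law e).-integrable setT (EFin \o f) ->
  cond_expectation_version P <<s window_sets >> (fun w => f (joint e w))
    (fun w => condE (law e) K f (joint e w)).
Proof.
move=> JK Jf fi; have mixe := mix_invariant_e inde.
have ci := integrable_condE mixe K fi.
have pushi (h : paths R int -> R) : (law e).-integrable setT (EFin \o h) ->
    P.-integrable setT (EFin \o (fun w => h (joint e w))).
  move=> hi; have [c hc] := integrable_Lpbound1 hi.
  have mh := Lpbound_meas hc.
  by have /Lpbound1_integral[] := (Lpbound_law e 1 c mh).1 hc.
split.
- by move=> A mA; apply: window_measurable => //; apply/measurable_EFinP; exact: measurable_int ci.
- exact: pushi.
move=> A GA; have [A' mA' AE] := window_preimage GA.
have mA := window_sets_measurable GA.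
(* The indicator of A as a function on path space, depending on the coordinates in J only. *)
pose chi x : R := \1_A' (mix J x (fun=> 0)).
have chiE w : chi (joint e w) = \1_A w by rewrite AE.
have Jchi : depends_on J chi.
  by move=> x y xy; rewrite /chi; congr (\1_A' _); apply/funext => i; rewrite /mix; case: ifP => // /xy.
have mchi : measurable_fun setT chi.
  apply: measurableT_comp; first exact: measurable_indic.
  apply: measurable_into_paths => i; rewrite /mix; case: (J i) => //.
  exact: measurable_coord.
have chii h : (law e).-integrable setT (EFin \o h) -> (law e).-integrable setT (EFin \o (fun x => chi x * h x)).
  move=> hi; apply: (le_integrable measurableT _ _ hi) => /=.
    apply/measurable_EFinP; apply: measurable_funM => //; apply/measurable_EFinP; exact: measurable_int hi.
  move=> x _; rewrite lee_fin normrM ler_piMl// /chi indicE.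
  by case: (_ \in _); rewrite ?normr1 ?normr0.
have intA h : (law e).-integrable setT (EFin \o h) ->
    (\int[P]_(w in A) (h (joint e w))%:E = (\int[law e]_x (chi x * h x))%:E)%E.
  move=> hi; rewrite integral_mkcond -(integral_law (chii _ hi)).
  apply: eq_integral => w _; rewrite patchE chiE indicE.
  by case: (w \in A); rewrite ?mul1r ?mul0r.
rewrite !intA//; congr _%:E.
rewrite -(integral_condE mixe K (chii _ fi)) /Rintegral; congr fine.
apply: ae_eq_integral => //.
- exact: measurable_int (chii _ ci).
- exact: measurable_int (integrable_condE mixe K (chii _ fi)).
have Kchi : depends_on K chi by move=> x y xy; apply: Jchi => i /JK/xy.
by have := condE_pull mixe Kchi fi; apply: filterS => x -> _.
Qed.

Lemma condE_version_unique (K : pred int) (f : paths R int -> R) Y :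
  (forall i, J i -> K i) -> depends_on J (condE (law e) K f) ->
  (law e).-integrable setT (EFin \o f) ->
  cond_expectation_version P <<s window_sets >> (fun w => f (joint e w)) Y ->
  {ae P, forall w, Y w = condE (law e) K f (joint e w)}.
Proof.
move=> JK Jf fi [GY iY hY]; have [GW iW hW] := condE_version JK Jf fi.
apply: (condexp_unique window_sets_measurable GY GW iY iW) => A GA.
by rewrite hY// hW.
Qed.

End Window.

Lemma sigma_windowE (R : realType) (disp : measure_display) (Omega : measurableType disp)
    (P : probability Omega R) (e : int -> {RV P >-> R}) (t : int) (l : nat) :
  sigma_window e t l = <<s window_sets e (predI (after (t - l%:Z - 1)) (upto t)) >>.
Proof.
congr <<s _ >>; apply/seteqP; split => [A [k /= kl ?]|A [i /= /andP[h1 h2] ?]].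
  exists (t - k%:Z) => //=; rewrite /after /upto; lia.
exists `|t - i|%N; rewrite /after /upto /= in h1 h2 *; first lia.
have -> // : t - `|t - i|%N%:Z = i by lia.
Qed.

(** As f ignores innovations later than t, its conditional expectation given all innovations after t
    - l - 1 depends on the window alone, hence is a version for the window. *)
Lemma condE_after_version (R : realType) (disp : measure_display) (Omega : measurableType disp)
    (P : probability Omega R) (e : int -> {RV P >-> R}) (t : int) (l : nat)
    (f : paths R int -> R) Y :
  mutually_independent P (fun t => e t : Omega -> R) ->
  depends_on (upto t) f -> (law e).-integrable setT (EFin \o f) ->
  cond_expectation_version P (sigma_window e t l) (fun w => f (joint e w)) Y ->
  {ae P, forall w, Y w = condE (law e) (after (t - l%:Z - 1)) f (joint e w)}.
Proof.
move=> inde tf fi; rewrite sigma_windowE; apply: condE_version_unique => //.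
  by move=> i /andP[].
exact: condE_depI.
Qed.

(** * The process of the theorem satisfies the path-space hypotheses *)

Section LagPaths.
Context (R : realType) (disp : measure_display) (Omega : measurableType disp).
Variables (P : probability Omega R) (e edag : int -> {RV P >-> R}).
Variables (d : nat) (g : int -> 'I_d -> (nat -> R) -> R) (M al K : R).

Definition lagF (t : int) (i : 'I_d) (x : paths R int) : R := g t i (fun k => x (t - k%:Z)).

Hypothesis copy : independent_copy e edag.
Hypothesis inde : mutually_independent P (fun t => e t : Omega -> R).
Hypothesis gm : forall t i, path_measurable (g t i).
Hypothesis mean0 : forall t i, ('E_P[fun w => (epsilon e g t w i 0)%R] = 0)%E.
Hypothesis d0 : (0 < d)%N.
Hypothesis M4 : 4 < M.
Hypothesis momentK : (moment_sup e g M <= K%:E)%E.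
Hypothesis tailK : (delta_tail_sup e edag g M al <= K%:E)%E.

Let mix_e := mix_invariant_e inde.
Let M1 : 1 <= M. Proof. by move: M4; lra. Qed.
Let M0 : 0 < M. Proof. by move: M4; lra. Qed.

Lemma lagF_measurable t i : measurable_fun setT (lagF t i).
Proof.
have mlag : measurable_fun setT (fun x : paths R int => (fun k : nat => x (t - k%:Z)) : paths R nat).
  by apply: measurable_into_paths => k; exact: measurable_coord.
exact: (measurableT_comp (gm t i) mlag).
Qed.

Lemma lagF_dep t i : depends_on (upto t) (lagF t i).
Proof.
move=> x y xy; rewrite /lagF; congr (g t i _); apply/funext => k; apply: xy.
rewrite /upto; lia.
Qed.

Let lin (v : 'I_d -> R) t x := \sum_i v i * lagF t i x.

Let lin_measurable v t : measurable_fun setT (lin v t).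
Proof.
by apply: measurable_sum => i; apply: measurable_funM => //; exact: lagF_measurable.
Qed.

Lemma dotv_sum (u v : 'cV[R]_d) : dotv u v = \sum_i u i 0 * v i 0.
Proof. by rewrite /dotv mxE; apply: eq_bigr => i _; rewrite mxE. Qed.

Let dir (v : 'I_d -> R) : 'cV[R]_d := (Num.sqrt (\sum_i v i ^+ 2))^-1 *: \col_i v i.

Let dir_unit v : Num.sqrt (\sum_i v i ^+ 2) != 0 -> enorm (dir v) = 1.
Proof.
move=> s0; rewrite /enorm dotv_sum.
have -> : \sum_i dir v i 0 * dir v i 0 = 1; last by rewrite sqrtr1.
under eq_bigr => i _ do rewrite !mxE mulrACA -!expr2.
by rewrite -mulr_sumr exprVn sqr_sqrtr ?mulVf ?sumr_ge0// => [|i _]; rewrite ?sqr_ge0//; apply: contra s0 => /eqP ->; rewrite sqrtr0.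
Qed.

Let lin0 v t : Num.sqrt (\sum_i v i ^+ 2) = 0 -> lin v t = cst 0.
Proof.
move=> /eqP; rewrite sqrtr_eq0 => h; apply/funext => x.
apply: big1 => i _; have -> : v i = 0; last by rewrite mul0r.
apply/eqP; rewrite -sqrf_eq0 eq_le sqr_ge0 andbT (le_trans _ h)//.
by rewrite (bigD1 i)//= lerDl sumr_ge0// => j _; exact: sqr_ge0.
Qed.

Let lin_dir v t w : Num.sqrt (\sum_i v i ^+ 2) != 0 ->
  lin v t (joint e w) = Num.sqrt (\sum_i v i ^+ 2) * dotv (dir v) (epsilon e g t w).
Proof.
move=> s0; rewrite dotv_sum mulr_sumr; apply: eq_bigr => i _.
by rewrite !mxE !mulrA mulfV// mul1r.
Qed.

Let lin_dir_coupled v t j w : Num.sqrt (\sum_i v i ^+ 2) != 0 ->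
  lin v t (joint e w) - lin v t (mix (other (t - j%:Z)) (joint e w) (joint edag w)) =
  Num.sqrt (\sum_i v i ^+ 2) *
    dotv (dir v) (epsilon e g t w - epsilon_coupled e edag g j%:Z t w).
Proof.
move=> s0; rewrite -sumrB dotv_sum mulr_sumr; apply: eq_bigr => i _.
rewrite !mxE !mulrA mulfV// mul1r mulrBr; congr (_ - _ * _).
rewrite /lagF; congr (g t i _); apply/funext => k; rewrite /mix /other /joint.
have -> : (t - k%:Z != t - j%:Z) = ~~ (k%:Z == j%:Z :> int) by lia.
by case: (_ == _).
Qed.

(** As d > 0, the normalised all-ones vector is a unit direction, so the supremum dominates a norm;
    over an empty set it would be -oo. *)
Lemma moment_bound_ge0 : 0 <= K.
Proof.
have u1 : enorm (dir (fun=> 1)) = 1.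
  apply: dir_unit; rewrite lt0r_neq0// sqrtr_gt0 sumr_const card_ord expr1n.
  by rewrite ltr0n.
rewrite -lee_fin; apply: le_trans momentK; apply: le_trans (Lnorm_ge0 _ _ _) _.
by apply: ereal_sup_ubound; exists (0, dir (fun=> 1)).
Qed.

Lemma lagF_lin t (v : 'I_d -> R) :
  Lpbound (law e) M (fun x => \sum_i v i * lagF t i x) (K * Num.sqrt (\sum_i v i ^+ 2)).
Proof.
rewrite -/(lin v t); have [s0|s0] := eqVneq (Num.sqrt (\sum_i v i ^+ 2)) 0.
  by rewrite lin0// s0 mulr0; exact: Lpbound0.
apply/Lpbound_law; first exact: lin_measurable.
under eq_fun do rewrite lin_dir//.
rewrite mulrC -{2}[Num.sqrt _]ger0_norm ?sqrtr_ge0//; apply: LpboundZ; first by [].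
split.
  have -> : (fun w => dotv (dir v) (epsilon e g t w)) =
      (fun w => (Num.sqrt (\sum_i v i ^+ 2))^-1 * lin v t (joint e w)).
    by apply/funext => w; rewrite lin_dir// mulrA mulVf// mul1r.
  apply: measurable_funM => //.
  exact: (measurableT_comp (lin_measurable v t) (measurable_joint e)).
apply: le_trans momentK; apply: ereal_sup_ubound.
by exists (t, dir v) => //; exact: dir_unit.
Qed.

Lemma delta_ge0 s : (0 <= delta e edag g M s)%E.
Proof.
have u1 : enorm (dir (fun=> 1)) = 1.
  apply: dir_unit; rewrite lt0r_neq0// sqrtr_gt0 sumr_const card_ord expr1n.
  by rewrite ltr0n.
apply: le_trans (Lnorm_ge0 _ _ _) _; last first.
  by apply: ereal_sup_ubound; exists (0, dir (fun=> 1)).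
Qed.

Lemma delta_series_le u :
  (\sum_(u <= j <oo) delta e edag g M j%:Z <= (K * (1 + u%:R) `^ (- al))%:E)%E.
Proof.
have p0 : 0 < (1 + u%:R) `^ al :> R by rewrite powR_gt0// ltr_pwDl.
have : (((1 + u%:R) `^ al)%:E * \sum_(u <= j <oo) delta e edag g M j%:Z <= K%:E)%E.
  by apply: le_trans tailK; apply: ereal_sup_ubound; exists u.
by rewrite -lee_pdivlMl// powRN -EFinM mulrC.
Qed.

Lemma delta_fin j : delta e edag g M j%:Z \is a fin_num.
Proof.
rewrite ge0_fin_numE ?delta_ge0//; apply: le_lt_trans (ltry (K * (1 + j%:R) `^ (- al))).
apply: le_trans (delta_series_le j).
have := @nneseries_lim_ge R (fun j => delta e edag g M j%:Z) xpredT j j.+1 (fun n _ _ => delta_ge0 n%:Z).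
by rewrite big_nat1.
Qed.

(** Nothing is lost by [fine]: each coefficient is finite, being at most the bounded series that
    starts at j. *)
Definition fdelta j : R := fine (delta e edag g M j%:Z).

Lemma fdeltaE j : (fdelta j)%:E = delta e edag g M j%:Z.
Proof. by rewrite fineK// delta_fin. Qed.

Lemma fdelta_ge0 j : 0 <= fdelta j.
Proof. by rewrite fine_ge0// delta_ge0. Qed.

Lemma fdelta_tail u n : \sum_(j < n) fdelta (u + j)%N <= K * (1 + u%:R) `^ (- al).
Proof.
rewrite -lee_fin; apply: le_trans (delta_series_le u).
apply: le_trans (@nneseries_lim_ge R (fun j => delta e edag g M j%:Z) xpredT u (u + n) (fun n _ _ => delta_ge0 n%:Z)).
rewrite -sumEFin -[X in (_ <= \sum_(X <= _ < _) _)%E]add0n big_addn addKn big_mkord.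
by apply: lee_sum => i _; rewrite fdeltaE addnC.
Qed.

(** The coupled vector at lag j is the process evaluated at the path whose coordinate t - j comes
    from [edag]. Homogeneity reduces to unit directions, the zero vector being treated apart, and
    [Lpbound_sub_condE] averages over the copy. *)
Lemma lagF_lin_delta t (v : 'I_d -> R) (j : nat) :
  Lpbound (law e) M (fun x => \sum_i v i * lagF t i x -
      condE (law e) (other (t - j%:Z)) (fun x => \sum_i v i * lagF t i x) x)
    (fdelta j * Num.sqrt (\sum_i v i ^+ 2)).
Proof.
apply: (Lpbound_sub_condE mix_e _ (lagF_lin t v)); first by [].
rewrite -/(lin v t).
apply: (@Lpbound_pair _ _ _ _ e edag) => //.
  apply: measurable_funB.
    exact: (measurableT_comp (lin_measurable v t) measurable_fst).
  exact: (measurableT_comp (lin_measurable v t) (measurable_mixz _)).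
have [s0|s0] := eqVneq (Num.sqrt (\sum_i v i ^+ 2)) 0.
  rewrite s0 mulr0 (_ : (fun w => _) = cst 0); first exact: Lpbound0.
  apply/funext => w; transitivity (lin v t (joint e w) - lin v t (mixz (other (t - j%:Z)) (joint e w, joint edag w))) => //.
  by rewrite lin0// subrr.
have E w : lin v t (joint e w, joint edag w).1 - lin v t (mixz (other (t - j%:Z)) (joint e w, joint edag w)) =
   Num.sqrt (\sum_i v i ^+ 2) * dotv (dir v) (epsilon e g t w - epsilon_coupled e edag g j%:Z t w).
  exact: lin_dir_coupled.
rewrite (_ : (fun w => _) = (fun w => Num.sqrt (\sum_i v i ^+ 2) *
    dotv (dir v) (epsilon e g t w - epsilon_coupled e edag g j%:Z t w))); last first.
  by apply/funext => w; exact: E.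
rewrite mulrC -{2}[Num.sqrt _]ger0_norm ?sqrtr_ge0//; apply: LpboundZ; first by [].
split.
  have -> : (fun w => dotv (dir v) (epsilon e g t w - epsilon_coupled e edag g j%:Z t w)) =
      (fun w => (Num.sqrt (\sum_i v i ^+ 2))^-1 *
        (lin v t (joint e w) - lin v t (mixz (other (t - j%:Z)) (joint e w, joint edag w)))).
    by apply/funext => w; rewrite E mulrA mulVf// mul1r.
  apply: measurable_funM => //; apply: measurable_funB.
    exact: (measurableT_comp (lin_measurable v t) (measurable_joint e)).
  apply: (measurableT_comp (lin_measurable v t)).
  apply: (measurableT_comp (measurable_mixz _)).
  by apply: measurable_fun_pair; exact: measurable_joint.
rewrite fdeltaE; apply: ereal_sup_ubound.
by exists (t, dir v) => //; exact: dir_unit.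
Qed.

Lemma lagF_integrable t i : (law e).-integrable setT (EFin \o lagF t i).
Proof.
have := lagF_lin t (fun k => (k == i)%:R).
have -> : (fun x => \sum_k (k == i)%:R * lagF t k x) = lagF t i.
  apply/funext => x; rewrite (bigD1 i)//= eqxx mul1r big1 ?addr0// => k /negbTE ->.
  by rewrite mul0r.
exact: Lpbound_integrable.
Qed.

Lemma lagF_mean t i : \int[law e]_x lagF t i x = 0.
Proof.
apply: EFin_inj; rewrite -(integral_law (lagF_integrable t i)); apply: etrans (mean0 t i).
rewrite expectation.unlock; apply: eq_integral => w _.
by rewrite mxE.
Qed.

Lemma eps_dotE t1 t2 w : eps_dot e g t1 t2 w = quad lagF t1%:Z t2%:Z (joint e w).
Proof. by rewrite /eps_dot dotv_sum; apply: eq_bigr => i _; rewrite !mxE. Qed.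

Hypothesis al4 : 4 < al.
Variables (n : nat) (b : nat -> nat -> R).
Hypothesis n0 : (0 < n)%N.
Hypothesis b1 : forall t1 t2, (0 < t1 <= n)%N -> (0 < t2 <= n)%N -> `|b t1 t2| <= 1.

Let p1 : 1 <= M / 2. Proof. by move: M4; lra. Qed.
Let p0 : 0 < M / 2. Proof. by move: M4; lra. Qed.

Let quad_integrable t1 t2 : (law e).-integrable setT (EFin \o quad lagF t1 t2).
Proof. exact: Lpbound_integrable p1 (Lpbound_quad M4 lagF_lin t1 t2). Qed.

Let quad_dep (t1 t2 : nat) : depends_on (upto (maxn t1 t2)%:Z) (quad lagF t1%:Z t2%:Z).
Proof.
have up (t t' : nat) k : (t <= t')%N -> upto t%:Z k -> upto t'%:Z k.
  by rewrite /upto -lez_nat => h1 h2; exact: le_trans h2 h1.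
move=> x y xy; apply: eq_bigr => i _.
by congr (_ * _); apply: lagF_dep => k kt; apply/xy/(up _ _ _ _ kt); rewrite ?leq_maxl ?leq_maxr.
Qed.

Lemma sample_centered_bound L : (0 < L)%N ->
  (forall t1 t2, (0 < t1 <= n)%N -> (0 < t2 <= n)%N -> (dist_nat t1 t2 < L)%N -> b t1 t2 = 0) ->
  (Lpnorm P (M / 2)%R (fun w => (\sum_(1 <= t1 < n.+1) \sum_(1 <= t2 < n.+1) b t1 t2 *
     (eps_dot e g t1 t2 w - fine 'E_P[eps_dot e g t1 t2]))%R) <=
  (2 * (far_const M K * (Num.sqrt (d%:R * \sum_(1 <= t1 < n.+1) \sum_(1 <= t2 < n.+1) b t1 t2 ^+ 2) +
     d%:R * n%:R * L%:R `^ (1 - al))))%:E)%E.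
Proof.
move=> L0 bL.
have h := Lpbound_centered mix_e M4 moment_bound_ge0 fdelta_ge0 lagF_dep lagF_lin lagF_lin_delta
  lagF_mean fdelta_tail al4 (fun _ => erefl) n0 b1 L0 bL.
have [_] := (Lpbound_law e _ _ (Lpbound_meas h)).1 h.
apply: le_trans; rewrite le_eqVlt; apply/orP; left; apply/eqP; congr ('N[P]_ _ [_])%E.
apply/funext => w /=; congr _%:E; apply: eq_bigr => t1 _; apply: eq_bigr => t2 _.
rewrite eps_dotE; congr (_ * (_ - _)).
rewrite expectation.unlock -[RHS]/(fine (_%:E)) -(integral_law (quad_integrable _ _)).
by congr fine; apply: eq_integral => w' _; rewrite eps_dotE.
Qed.

Lemma sample_window_bound l B c CE : (0 < l)%N -> (0 < B)%N ->
  (forall t1 t2, (0 < t1 <= n)%N -> (0 < t2 <= n)%N -> (dist_nat t1 t2 < B)%N -> b t1 t2 = 0) ->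
  (forall N, \sum_(1 <= q < N) fdelta q * Num.sqrt (d%:R *
     \sum_(1 <= t1 < n.+1) \sum_(1 <= t2 < n.+1 | (maxn B (l.+1 - q) <= dist_nat t1 t2 <= l)%N)
        b t1 t2 ^+ 2) <= c) ->
  (forall t1 t2 : nat, (0 < t1 <= n)%N -> (0 < t2 <= n)%N ->
     cond_expectation_version P (sigma_window e (maxn t1 t2)%:Z l) (eps_dot e g t1 t2) (CE t1 t2)) ->
  (Lpnorm P (M / 2)%R (fun w => (\sum_(1 <= t1 < n.+1) \sum_(1 <= t2 < n.+1) b t1 t2 *
     (eps_dot e g t1 t2 w - CE t1 t2 w))%R) <=
  (2 * (near_const M K al * (c + d%:R * Num.sqrt n%:R * l%:R `^ (1 - al)) +
    far_const M K * (Num.sqrt (d%:R *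
       \sum_(1 <= t1 < n.+1) \sum_(1 <= t2 < n.+1 | (l < dist_nat t1 t2)%N) b t1 t2 ^+ 2) +
     d%:R * n%:R * l.+1%:R `^ (1 - al))))%:E)%E.
Proof.
move=> l0 B0 bB hc hCE.
have h := Lpbound_window mix_e M4 moment_bound_ge0 fdelta_ge0 lagF_dep lagF_lin lagF_lin_delta
  lagF_mean fdelta_tail al4 (fun _ => erefl) n0 b1 l0 B0 bB hc.
have hP := (Lpbound_law e _ _ (Lpbound_meas h)).1 h.
(* [CE] is known to be measurable only for indices in the sample; the value 0 elsewhere makes the
   measurability argument uniform. *)
pose CE' t1 t2 := if (0 < t1 <= n)%N && (0 < t2 <= n)%N then CE t1 t2 else cst 0.
have mCE' t1 t2 : measurable_fun setT (CE' t1 t2).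
  rewrite /CE'; case: ifP => [/andP[h1 h2]|_]; last exact: measurable_cst.
  have [hm _ _] := hCE _ _ h1 h2.
  move=> _ A mA; rewrite setTI; have := hm A mA; rewrite sigma_windowE.
  exact: window_sets_measurable.
have [] : Lpbound P (M / 2) (fun w => \sum_(1 <= t1 < n.+1) \sum_(1 <= t2 < n.+1) b t1 t2 *
     (quad lagF t1%:Z t2%:Z (joint e w) - CE' t1 t2 w))
  (2 * (near_const M K al * (c + d%:R * Num.sqrt n%:R * l%:R `^ (1 - al)) +
    far_const M K * (Num.sqrt (d%:R *
       \sum_(1 <= t1 < n.+1) \sum_(1 <= t2 < n.+1 | (l < dist_nat t1 t2)%N) b t1 t2 ^+ 2) +
     d%:R * n%:R * l.+1%:R `^ (1 - al)))).
  apply: (Lpbound_ae p0 hP).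
    do 2!(apply: measurable_sum => ?); apply: measurable_funM => //.
    apply: measurable_funB => //.
    have mq := Lpbound_meas (Lpbound_quad M4 lagF_lin _ _).
    exact: (measurableT_comp (mq _ _) (measurable_joint e)).
  have H t1 t2 : {ae P, forall w, (0 < t1 <= n)%N && (0 < t2 <= n)%N -> CE' t1 t2 w =
      condE (law e) (after ((maxn t1 t2)%:Z - l%:Z - 1)) (quad lagF t1%:Z t2%:Z) (joint e w)}.
    have [|?] := boolP ((0 < t1 <= n)%N && (0 < t2 <= n)%N); last by apply: aeW.
    rewrite /CE' => h12; rewrite h12; case/andP: h12 => h1 h2.
    have := condE_after_version inde _ (quad_integrable t1%:Z t2%:Z) (Y := CE t1 t2) (t := (maxn t1 t2)%:Z) (l := l).
    move=> /(_ (@quad_dep t1 t2)) hae; apply: filterS (hae _) => [w -> //|].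
    have <- : eps_dot e g t1 t2 = (fun w => quad lagF t1%:Z t2%:Z (joint e w)).
      by apply/funext => w; rewrite eps_dotE.
    exact: hCE.
  have HH := ae_foralln (fun t1 => ae_foralln (H t1)).
  apply: filterS HH => w Hw; apply: eq_big_nat => t1 h1; apply: eq_big_nat => t2 h2.
  by rewrite Hw// h1 h2.
move=> _; apply: le_trans; rewrite le_eqVlt; apply/orP; left; apply/eqP; congr ('N[P]_ _ [_])%E.
apply/funext => w /=; congr _%:E; apply: eq_big_nat => t1 h1; apply: eq_big_nat => t2 h2.
by move: h1 h2; rewrite !ltnS => h1 h2; rewrite eps_dotE /CE' h1 h2.
Qed.

End LagPaths.

(** The left side is the geometric mean of the two terms on the right: after dividing by x^(3/2)
    y^(-al) it reads s y <= s^2 + y^2 with s = sqrt x. It converts the error d T B^(1 - alpha) into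
    the two terms of the first bound. *)
Lemma powR_mid_le (R : realType) (x y al : R) : 0 < x -> 0 < y ->
  x ^+ 2 * y `^ (1 - al) <= x `^ (5 / 2) / y `^ al + x `^ (3 / 2) / y `^ (al - 2).
Proof.
move=> x0 y0; have x0' := ltW x0.
have xn0 : x != 0 by rewrite gt_eqF.
have yn0 : y != 0 by rewrite gt_eqF.
have nz (z r : R) : z != 0 -> (r == 0) ==> (z != 0) by move=> ->; rewrite implybT.
have -> : x `^ (5 / 2) = x `^ (3 / 2) * x.
  rewrite -{3}(powRr1 x0') -powRD; last exact: nz.
  by congr (_ `^ _); field.
have -> : x ^+ 2 = x `^ (3 / 2) * Num.sqrt x.
  rewrite -powR12_sqrt// -powRD; last exact: nz.
  by rewrite -powR_mulrn//; congr (_ `^ _); field.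
have -> : y `^ (1 - al) = y * y `^ (- al).
  by rewrite powRD ?powRr1 ?(ltW y0)//; exact: nz.
rewrite -!powRN.
have -> : y `^ (- (al - 2)) = y ^+ 2 * y `^ (- al).
  by rewrite -powR_mulrn ?(ltW y0)// -powRD; [congr (_ `^ _); ring|exact: nz].
set X := x `^ _; set Y := y `^ _.
have X0 : 0 <= X by exact: powR_ge0.
have Y0 : 0 <= Y by exact: powR_ge0.
have {2}<- : Num.sqrt x ^+ 2 = x by rewrite sqr_sqrtr.
set s := Num.sqrt x; have s0 : 0 <= s by exact: sqrtr_ge0.
have -> : X * s * (y * Y) = X * Y * (s * y) by ring.
have -> : X * s ^+ 2 * Y + X * (y ^+ 2 * Y) = X * Y * (s ^+ 2 + y ^+ 2) by ring.
rewrite ler_wpM2l ?mulr_ge0//.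
have := sqr_ge0 (s - y); have := sqr_ge0 s; have := sqr_ge0 y; nra.
Qed.

Lemma le_powR_three_halves (R : realType) (n : nat) : (0 < n)%N ->
  Num.sqrt n%:R <= n%:R `^ (3 / 2) :> R /\ n%:R <= n%:R `^ (3 / 2) :> R.
Proof.
move=> n0; have n1 : 1 <= n%:R :> R by rewrite ler1n.
split.
  by rewrite -powR12_sqrt// ler_powR//; lra.
by rewrite -{1}[n%:R]powRr1// ler_powR//; lra.
Qed.

(* The natural-number subtraction l.+1 - q is truncated at 0, which does not
   matter since its maximum with B T > 0 is taken. *)
Theorem theorem4p2 (R : realType) (disp : measure_display)
    (Omega : measurableType disp) (P : probability Omega R)
    (e edag : int -> {RV P >-> R}) (M alpha : R) (d : nat -> nat)
    (g : forall T : nat, int -> 'I_(d T) -> (nat -> R) -> R)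
    (b : nat -> nat -> nat -> R) (B : nat -> nat)
    (hcopy : independent_copy e edag)
    (hsrd : short_range_dependent e edag M alpha g)
    (hM : 4 < M) (halpha : 4 < alpha)
    (hd : asymp_seq (fun T => (d T)%:R : R) (fun T => T%:R : R))
    (hb1 : forall T t1 t2 : nat, (0 < t1 <= T)%N -> (0 < t2 <= T)%N ->
      `|b T t1 t2| <= 1)
    (hb0 : forall T t1 t2 : nat, (0 < t1 <= T)%N -> (0 < t2 <= T)%N ->
      (dist_nat t1 t2 < B T)%N -> b T t1 t2 = 0)
    (hB1 : forall T : nat, (0 < T)%N -> (1 < B T)%N)
    (hB : littleo_seq (fun T => T%:R `^ (2 / alpha)) (fun T => (B T)%:R : R)) :
  bigO_seq
    (fun T => Lpnorm P (M / 2) (fun w =>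
       \sum_(1 <= t1 < T.+1) \sum_(1 <= t2 < T.+1)
         b T t1 t2 * (eps_dot e (g T) t1 t2 w
                      - fine 'E_P[eps_dot e (g T) t1 t2])))
    (fun T =>
       Num.sqrt ((d T)%:R *
         \sum_(1 <= t1 < T.+1) \sum_(1 <= t2 < T.+1) b T t1 t2 ^+ 2)
       + T%:R `^ (5 / 2) / (B T)%:R `^ alpha
       + T%:R `^ (3 / 2) / (B T)%:R `^ (alpha - 2))
  /\
  exists C : R, 0 < C /\
    forall (T l : nat) (CE : nat -> nat -> Omega -> R),
      (0 < T)%N -> (B T <= l)%N ->
      (forall t1 t2 : nat, (0 < t1 <= T)%N -> (0 < t2 <= T)%N ->
         cond_expectation_version P (sigma_window e (maxn t1 t2)%:Z l)
           (eps_dot e (g T) t1 t2) (CE t1 t2)) ->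
      (Lpnorm P (M / 2)%R (fun w =>
         (\sum_(1 <= t1 < T.+1) \sum_(1 <= t2 < T.+1)
           b T t1 t2 * (eps_dot e (g T) t1 t2 w - CE t1 t2 w))%R)
       <= C%:E * (\sum_(1 <= q <oo)
                    delta e edag (g T) M q%:Z *
                    (Num.sqrt ((d T)%:R *
                      \sum_(1 <= t1 < T.+1)
                        \sum_(1 <= t2 < T.+1 |
                              (maxn (B T) (l.+1 - q) <= dist_nat t1 t2 <= l)%N)
                          b T t1 t2 ^+ 2))%:E)
          + (C * Num.sqrt ((d T)%:R *
               \sum_(1 <= t1 < T.+1)
                 \sum_(1 <= t2 < T.+1 | (l < dist_nat t1 t2)%N)
                   b T t1 t2 ^+ 2))%:E
          + (C * (d T)%:R * T%:R `^ (3 / 2) / l%:R `^ (alpha - 1))%:E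
          + (C * (d T)%:R * Num.sqrt T%:R / (B T)%:R `^ alpha)%:E)%E.
Proof.
case: hsrd => _ [inde gm mean [C1 mom] [C2 tail]].
case: hd => c [C [c0 _ hdT]].
pose K := `|C1| + `|C2|; have K0 : 0 <= K by rewrite addr_ge0.
(* T <= C d excludes d = 0, so unit directions exist at every sample size. *)
have d0 T : (0 < T)%N -> (0 < d T)%N.
  move=> T0; have /andP[_] := hdT T T0; rewrite lt0n; apply: contraTneq => ->.
  by rewrite mulr0 -ltNge ltr0n.
have dT T : (0 < T)%N -> (d T)%:R <= c^-1 * T%:R.
  by move=> T0; have /andP[h _] := hdT T T0; rewrite -ler_pdivrMl ?invr_gt0// invrK.
have momK T : (0 < T)%N -> (moment_sup e (g T) M <= K%:E)%E.
  move=> T0; apply: le_trans (lee_abs _) (le_trans (mom T T0) _).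
  by rewrite normr1 mulr1 lee_fin /K; have := ler_norm C1; have := normr_ge0 C2; lra.
have tailK T : (0 < T)%N -> (delta_tail_sup e edag (g T) M alpha <= K%:E)%E.
  move=> T0; apply: le_trans (lee_abs _) (le_trans (tail T T0) _).
  by rewrite normr1 mulr1 lee_fin /K; have := ler_norm C2; have := normr_ge0 C1; lra.
have Kf := far_const_ge0 M K0.
have Kn := near_const_ge0 M K0 alpha.
split.
  (* The 1 serves the square-root term; c^-1 comes from d <= c^-1 T in the error term. *)
  exists (2 * far_const M K * (1 + c^-1)) => T T0.
  rewrite gee0_abs ?Lnorm_ge0//.
  have B0 : (0 < B T)%N := ltnW (hB1 T T0).
  have := @sample_centered_bound _ _ _ P e edag _ (g T) M alpha K hcopy inde
    (fun t i => gm T t i T0) (fun t i => mean T t i T0) (d0 T T0) hM (momK T T0) (tailK T T0)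
    halpha T (b T) T0 (hb1 T) (B T) B0 (hb0 T).
  move/le_trans; apply; rewrite lee_fin.
  have TB := @powR_mid_le R T%:R (B T)%:R alpha.
  rewrite !ltr0n in TB; move/(_ T0 B0) in TB.
  set s := Num.sqrt _; have s0 : 0 <= s by exact: sqrtr_ge0.
  rewrite -addrA; set rest := (X in `|s + X|) in TB *.
  have rest0 : 0 <= rest by rewrite addr_ge0// divr_ge0 ?powR_ge0.
  rewrite ger0_norm ?addr_ge0//.
  set Z := (B T)%:R `^ (1 - alpha) in TB *; have Z0 : 0 <= Z by exact: powR_ge0.
  have h : (d T)%:R * T%:R * Z <= c^-1 * rest.
    apply: le_trans (_ : c^-1 * T%:R * T%:R * Z <= _).
      by rewrite !ler_wpM2r// dT.
    by rewrite -!mulrA ler_wpM2l ?invr_ge0 ?(ltW c0)// mulrA -expr2.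
  rewrite -!mulrA ler_wpM2l// ler_wpM2l//.
  have c0' : 0 <= c^-1 by rewrite invr_ge0 ltW.
  have := mulr_ge0 c0' s0.
  lra.
(* Both parts contribute to the error in l, so their constants are added; the final 1 makes the
   constant positive. *)
pose C' := 2 * near_const M K alpha + 2 * far_const M K + 1.
have C'0 : 0 < C' by rewrite /C'; lra.
exists C'; split => // T l CE T0 Bl hCE.
have B0 : (0 < B T)%N := ltnW (hB1 T T0).
have l0 : (0 < l)%N := leq_trans B0 Bl.
pose w q := Num.sqrt ((d T)%:R * \sum_(1 <= t1 < T.+1) \sum_(1 <= t2 < T.+1 |
  (maxn (B T) (l.+1 - q) <= dist_nat t1 t2 <= l)%N) b T t1 t2 ^+ 2).
have dge0 := @delta_ge0 _ _ _ P e edag _ (g T) M (d0 T T0).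
set S := (X in (C'%:E * X)%E).
have term0 q : (0 <= delta e edag (g T) M q%:Z * (w q)%:E)%E.
  by rewrite mule_ge0// lee_fin sqrtr_ge0.
have S0 : (0 <= S)%E by apply: nneseries_ge0 => q _ _; exact: term0.
have far0 : (0 <= (C' * Num.sqrt ((d T)%:R * \sum_(1 <= t1 < T.+1)
   \sum_(1 <= t2 < T.+1 | (l < dist_nat t1 t2)%N) b T t1 t2 ^+ 2))%:E)%E.
  by rewrite lee_fin mulr_ge0 ?sqrtr_ge0 ?(ltW C'0).
(* If the series is infinite the right side is +oo and the bound is trivial; otherwise its value is
   a real bound for all partial sums. *)
have [Soo|Sfin] := eqVneq S +oo%E.
  by rewrite Soo gt0_muley ?lte_fin// !addye// leey.
have [s SE] : exists s : R, S = s%:E.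
  by exists (fine S); rewrite fineK// ge0_fin_numE// ltey.
have s0 : 0 <= s by rewrite -lee_fin -SE.
have fd := fdeltaE (d0 T T0) (tailK T T0).
have hc N : \sum_(1 <= q < N) fdelta e edag (g T) M q * w q <= s.
  rewrite -lee_fin -SE -sumEFin.
  under eq_bigr do rewrite EFinM fd.
  exact: nneseries_lim_ge.
have := @sample_window_bound _ _ _ P e edag _ (g T) M alpha K hcopy inde
    (fun t i => gm T t i T0) (fun t i => mean T t i T0) (d0 T T0) hM (momK T T0) (tailK T T0)
    halpha T (b T) T0 (hb1 T) l (B T) s CE l0 B0 (hb0 T) hc hCE.
move/le_trans; apply; rewrite SE -EFinM -!EFinD lee_fin.
set f := Num.sqrt (_ * \sum_(1 <= t1 < _) _); have f0 : 0 <= f by exact: sqrtr_ge0.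
(* The near part leaves sqrt T and the far part T in front of d l^(1 - alpha); both are at most
   T^(3/2). *)
have [T1 T2] := le_powR_three_halves R T0.
set x := T%:R `^ (3 / 2) in T1 T2 *.
have l0' : 0 < l%:R :> R by rewrite ltr0n.
have -> : C' * (d T)%:R * x / l%:R `^ (alpha - 1) = C' * ((d T)%:R * x * l%:R `^ (1 - alpha)).
  by rewrite -powRN opprB !mulrA.
have lle : l.+1%:R `^ (1 - alpha) <= l%:R `^ (1 - alpha) :> R.
  rewrite -opprB; apply: powRN_le => //; first by rewrite ler_nat.
  by move: halpha; lra.
set y := l%:R `^ (1 - alpha) in lle *; have y0 : 0 <= y by exact: powR_ge0.
set D := (d T)%:R : R; have D0 : 0 <= D by [].
have err1 : D * Num.sqrt T%:R * y <= D * x * y by rewrite ler_wpM2r// ler_wpM2l.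
have err2 : D * T%:R * l.+1%:R `^ (1 - alpha) <= D * x * y.
  by rewrite ler_pM ?mulr_ge0 ?powR_ge0// ler_wpM2l.
have last0 : 0 <= C' * D * Num.sqrt T%:R / (B T)%:R `^ alpha.
  by rewrite divr_ge0 ?powR_ge0// !mulr_ge0 ?sqrtr_ge0 ?(ltW C'0).
have E0 : 0 <= D * x * y by rewrite !mulr_ge0 ?powR_ge0.
set E := D * x * y in err1 err2 E0 *.
apply: le_trans (_ : C' * s + C' * f + C' * E <= _); last by rewrite lerDl.
apply: le_trans (_ : 2 * (near_const M K alpha * (s + E) + far_const M K * (f + E)) <= _).
  by rewrite ler_wpM2l// lerD// ler_wpM2l// lerD2l.
have := mulr_ge0 Kn s0; have := mulr_ge0 Kn f0; have := mulr_ge0 Kf s0; have := mulr_ge0 Kf f0.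
rewrite /C'; lra.
Qed.
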